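(* Let $A$ be a unital $C^*$-algebra and let $I$ be an ideal of $A$. Assume that an element $a\in A$ satisfies $a+I\in Z(A/I)$. Then $a\in Z(A)+I$ if and only if $$\Psi_{A/I}(a+I)(P_1/I)=\Psi_{A/I}(a+I)(P_2/I)$$ for all primitive ideals $P_1,P_2$ of $A$ containing $I$ such that $P_1\cap Z(A)=P_2\cap Z(A)$.
   Context: ''Ideal'' means closed two-sided ideal; $Z(A)$ is the centre of $A$. $\mathrm{Prim}(B)$ is the set of primitive ideals of $B$ with the Jacobson topology. For a unital $C^*$-algebra $B$, $\Psi_B: Z(B)\to C(\mathrm{Prim}(B))$ is the Dauns–Hofmann isomorphism, characterised by $z+P=\Psi_B(z)(P)1+P$ in $B/P$ for all $z\in Z(B)$ and $P\in\mathrm{Prim}(B)$. For a primitive ideal $P$ of $A$ containing $I$, $P/I$ is the corresponding primitive ideal of $A/I$. *)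

(* Defs.v *)
From HB Require Import structures.
From mathcomp Require Import all_boot all_order all_algebra.
From mathcomp Require Import generic_quotient complex.
From mathcomp Require Import boolp classical_sets reals topology normedtype sequences.
From mathcomp Require Import ring lra.

Set Implicit Arguments.
Unset Strict Implicit.
Unset Printing Implicit Defensive.

Import Order.TTheory GRing.Theory Num.Theory.
Import numFieldNormedType.Exports.
Local Open Scope classical_set_scope.
Local Open Scope ring_scope.
Local Open Scope complex_scope.
Local Open Scope quotient_scope.

(* Unital C*-algebras. The zero algebra is allowed, so that A/A is one. The
   multiplication is a field of the mixin because Hierarchy Builder rejects a
   join of PzRing with a normed module declared after numDomainType; the
   canonical instance below gives every C*-algebra the ring notations. *)
HB.mixin Record CompleteNormedModule_isCStarAlgebra (R : realType) A
    & CompleteNormedModule R[i] A := {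
  cmul : A -> A -> A;
  cone : A;
  cmulA : associative cmul;
  cmul1r : left_id cone cmul;
  cmulr1 : right_id cone cmul;
  cmulDl : left_distributive cmul +%R;
  cmulDr : right_distributive cmul +%R;
  cmulZl : forall (c : R[i]) (x y : A), cmul (c *: x) y = c *: cmul x y;
  cmulZr : forall (c : R[i]) (x y : A), cmul x (c *: y) = c *: cmul x y;
  cnormM_le : forall x y : A, `|cmul x y| <= `|x| * `|y|;
  star : A -> A;
  starK : involutive star;
  starD : {morph star : x y / x + y};
  starZ : forall (c : R[i]) (x : A), star (c *: x) = c^* *: star x;
  cstarM : forall x y : A, star (cmul x y) = cmul (star y) (star x);
  cnorm_star : forall x : A, `|cmul (star x) x| = `|x| ^+ 2
}.

#[short(type="cstarAlgType")]
HB.structure Definition CStarAlgebra (R : realType) :=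
  {A of CompleteNormedModule R[i] A & CompleteNormedModule_isCStarAlgebra R A}.

HB.instance Definition _ (R : realType) (A : cstarAlgType R) :=
  GRing.Zmodule_isPzRing.Build (CStarAlgebra.sort A)
    cmulA cmul1r cmulr1 cmulDl cmulDr.

HB.mixin Record CompleteNormedModule_isHilbert (R : realType) H
    & CompleteNormedModule R[i] H := {
  inner : H -> H -> R[i];
  inner_linearl : forall (c : R[i]) (x y z : H),
    inner (c *: x + y) z = c * inner x z + inner y z;
  innerC : forall x y : H, inner y x = (inner x y)^*;
  inner_norm : forall x : H, inner x x = `|x| ^+ 2
}.

#[short(type="hilbertType")]
HB.structure Definition Hilbert (R : realType) :=
  {H of CompleteNormedModule R[i] H & CompleteNormedModule_isHilbert R H}.

Section RealNorm.
Variables (R : realType) (V : normedModType R[i]).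
Implicit Types x y : V.

Definition rnorm (x : V) : R := complex.Re `|x|.

Lemma normE x : `|x| = (rnorm x)%:C.
Proof. by symmetry; apply: RRe_real; apply: ger0_real. Qed.

Lemma rnorm_ge0 x : 0 <= rnorm x.
Proof. by rewrite -ler0c -normE. Qed.

Lemma rnormD x y : rnorm (x + y) <= rnorm x + rnorm y.
Proof. by rewrite -lecR rmorphD /= -!normE ler_normD. Qed.

Lemma rnormN x : rnorm (- x) = rnorm x.
Proof. by rewrite /rnorm normrN. Qed.

Lemma rnormB x y : rnorm (x - y) = rnorm (y - x).
Proof. by rewrite /rnorm distrC. Qed.

Lemma rnormZ (c : R[i]) x : rnorm (c *: x) = complex.Re `|c| * rnorm x.
Proof.
by apply: complexI; rewrite [RHS]rmorphM /= -!normE normrZ; congr (_ * _).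
Qed.

Lemma rnorm0 : rnorm 0 = 0.
Proof. by rewrite /rnorm normr0. Qed.

Lemma closedP_rnorm (S : set V) x : closed S ->
  (forall e : R, 0 < e -> exists2 y, S y & rnorm (x - y) <= e) -> S x.
Proof.
move=> cS H; apply: cS => U /nbhs_ballP[e /= e0 eU].
have e0' : 0 < complex.Re e by move: e0; rewrite ltcE => /andP[].
have [|y Sy xy] := H (complex.Re e / 2); first by rewrite divr_gt0.
exists y; split => //; apply: eU; rewrite -ball_normE /ball_ /= normE.
rewrite -(@RRe_real _ e) ?gtr0_real // ltcR (le_lt_trans xy) //.
by rewrite ltr_pdivrMr // ltr_pMr // ltr1n.
Qed.

End RealNorm.

Lemma pow_lt_eps (R : realType) (q e : R) : 0 <= q -> q < 1 -> 0 < e ->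
  exists n, forall m, (n <= m)%N -> q ^+ m < e.
Proof.
move=> q0 q1 e0.
have : (fun n : nat => q ^+ n) @ \oo --> (0 : R).
  by apply: cvg_expr; rewrite ger0_norm.
move/cvgrPdist_lt => /(_ e e0)[n _ H]; exists n => m nm.
by have := H m nm; rewrite /= sub0r normrN ger0_norm // exprn_ge0.
Qed.

Section Complete.
Variables (R : realType) (V : completeNormedModType R[i]).

Lemma rnorm_cauchy_cvg (u : nat -> V) :
  (forall e : R, 0 < e -> exists N, forall n, (N <= n)%N ->
     rnorm (u n - u N) <= e) ->
  exists l, forall e : R, 0 < e -> exists N, forall n, (N <= n)%N ->
     rnorm (l - u n) <= e.
Proof.
move=> H.
have cu : cauchy (u @ \oo).
  apply/cauchy_ballP => e e0.
  have e0' : 0 < complex.Re e by move: e0; rewrite ltcE => /andP[].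
  have [|N HN] := H (complex.Re e / 4); first by rewrite divr_gt0.
  exists (ball (u N) (e / 2), ball (u N) (e / 2)) => /=.
    have uN : (u @ \oo) (ball (u N) (e / 2)).
      exists N => // n /= Nn; rewrite -ball_normE /ball_ /= distrC normE.
      rewrite -(@RRe_real _ e) ?gtr0_real //.
      have -> : (complex.Re e)%:C / 2 = (complex.Re e / 2)%:C :> R[i].
        by rewrite rmorphM /= fmorphV rmorph_nat.
      rewrite ltcR (le_lt_trans (HN _ Nn)) // ltr_pM2l // ltf_pV2 ?posrE //.
      by rewrite ltr_nat.
    by [].
  move=> [x y] /= [xN yN].
  exact: ball_splitr xN yN.
have ul : u @ \oo --> lim (u @ \oo). by apply: cauchy_cvg cu.
exists (lim (u @ \oo)) => e e0.
have e0' : 0 < e%:C by rewrite ltcR.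
move/cvgrPdist_le : ul => /(_ _ e0')[N _ HN].
by exists N => n Nn; have := HN n Nn; rewrite /= normE lecR.
Qed.

Lemma rnorm_geo_cvg (u : nat -> V) (C q : R) : 0 <= q -> q < 1 ->
  (forall n, rnorm (u n.+1 - u n) <= C * q ^+ n) ->
  exists l, forall e : R, 0 < e -> exists N, forall n, (N <= n)%N ->
     rnorm (l - u n) <= e.
Proof.
move=> q0 q1 Hu; apply: rnorm_cauchy_cvg => e e0.
have C0 : 0 <= C.
  by have := le_trans (rnorm_ge0 _) (Hu 0%N); rewrite expr0 mulr1.
have d0 : 0 < 1 - q by rewrite subr_gt0.
have bound k N : rnorm (u (N + k)%N - u N) <= C / (1 - q) * q ^+ N * (1 - q ^+ k).
  elim: k => [|k IH]; first by rewrite addn0 subrr rnorm0 expr0 subrr mulr0.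
  rewrite addnS -(subrKA (u (N + k)%N)).
  rewrite (le_trans (rnormD _ _))// (le_trans (lerD (Hu _) IH))//.
  rewrite le_eqVlt; apply/orP; left; apply/eqP.
  by rewrite exprD exprS; field; rewrite gt_eqF.
have C1 : 0 < C / (1 - q) + 1 by rewrite ltr_wpDl // divr_ge0 // ltW.
have [|N HN] := pow_lt_eps q0 q1 (e := e / (C / (1 - q) + 1)).
  by rewrite divr_gt0.
exists N => n Nn; rewrite -(subnKC Nn) (le_trans (bound _ _))//.
have qN := HN N (leqnn N); rewrite ltr_pdivlMr // in qN.
have qN0 : 0 <= q ^+ N by rewrite exprn_ge0.
have qk0 : 0 <= q ^+ (n - N) by rewrite exprn_ge0.
have D0 : 0 <= C / (1 - q) * q ^+ N by rewrite !mulr_ge0 // invr_ge0 ltW.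
rewrite (le_trans (ler_piMr D0 _)) ?gerBl //.
by rewrite (le_trans _ (ltW qN)) // mulrC ler_wpM2l // lerDl.
Qed.

End Complete.

Section CStarTheory.
Variables (R : realType) (A : cstarAlgType R).
Implicit Types x y z : A.

Lemma scalerMl (c : R[i]) x y : (c *: x) * y = c *: (x * y).
Proof. exact: cmulZl. Qed.

Lemma scalerMr (c : R[i]) x y : x * (c *: y) = c *: (x * y).
Proof. exact: cmulZr. Qed.

Lemma starM x y : star (x * y) = star y * star x.
Proof. exact: cstarM. Qed.

Lemma star0 : star 0 = 0 :> A.
Proof. by rewrite -(scale0r 0) starZ rmorph0 !scale0r. Qed.

Lemma starN x : star (- x) = - star x.
Proof. by rewrite -scaleN1r starZ rmorphN1 scaleN1r. Qed.

Lemma starB x y : star (x - y) = star x - star y.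
Proof. by rewrite starD starN. Qed.

Lemma star1 : star 1 = 1 :> A.
Proof. by rewrite -[LHS]mul1r -{1}[1]starK -starM mul1r starK. Qed.

Lemma starX x n : star (x ^+ n) = star x ^+ n.
Proof.
by elim: n => [|n IH]; rewrite ?expr0 ?star1 // exprS starM IH -exprSr.
Qed.

Lemma rnormM x y : rnorm (x * y) <= rnorm x * rnorm y.
Proof. by rewrite -lecR rmorphM /= -!normE cnormM_le. Qed.

Lemma rnorm_star_mul x : rnorm (star x * x) = rnorm x ^+ 2.
Proof. by apply: complexI; rewrite rmorphXn /= -!normE; exact: cnorm_star. Qed.

Lemma rnorm_star x : rnorm (star x) = rnorm x.
Proof.
suff H y : rnorm y <= rnorm (star y).
  by apply/eqP; rewrite eq_le H -{2}[x]starK H.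
have := rnorm_ge0 y; rewrite le_eqVlt => /orP[/eqP <-|y0].
  exact: rnorm_ge0.
by rewrite -(ler_pM2r y0) -expr2 -rnorm_star_mul rnormM.
Qed.

Lemma rnorm1_le1 : rnorm (1 : A) <= 1.
Proof.
have := rnorm_star_mul 1; rewrite star1 mul1r => H.
have [//|h] := leP (rnorm (1 : A)) 1.
by have := ltr_pM2l (lt_trans ltr01 h) 1 (rnorm (1 : A)); rewrite -expr2 -H mulr1 ltxx h.
Qed.

Lemma rnormM_le1 x y : rnorm x <= 1 -> rnorm y <= 1 -> rnorm (x * y) <= 1.
Proof.
move=> x1 y1; rewrite (le_trans (rnormM x y)) // -[leRHS]mulr1.
by rewrite ler_pM // rnorm_ge0.
Qed.

Lemma rnormX_le1 x n : rnorm x <= 1 -> rnorm (x ^+ n) <= 1.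
Proof.
move=> x1; elim: n => [|n IH]; first by rewrite expr0 rnorm1_le1.
by rewrite exprS rnormM_le1.
Qed.

Lemma rnorm_neumann x : rnorm x < 1 ->
  exists w : A, (1 - x) * w = 1 /\ w * (1 - x) = 1.
Proof.
move=> x1; pose u n : A := \sum_(k < n) x ^+ k.
have xn n : rnorm (x ^+ n) <= rnorm x ^+ n.
  elim: n => [|n IH]; first by rewrite !expr0 rnorm1_le1.
  by rewrite !exprS (le_trans (rnormM _ _)) // ler_wpM2l // rnorm_ge0.
have ux n : (1 - x) * u n = 1 - x ^+ n.
  elim: n => [|n IH]; first by rewrite /u big_ord0 mulr0 expr0 subrr.
  rewrite /u big_ord_recr /= -/(u n) mulrDr IH mulrBl mul1r -exprS.
  by rewrite addrA subrK.
have xu n : u n * (1 - x) = 1 - x ^+ n.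
  elim: n => [|n IH]; first by rewrite /u big_ord0 mul0r expr0 subrr.
  rewrite /u big_ord_recr /= -/(u n) mulrDl IH mulrBr mulr1 -exprSr.
  by rewrite addrA subrK.
have [|w Hw] := rnorm_geo_cvg (u := u) (C := 1) (rnorm_ge0 x) x1.
  by move=> n; rewrite /u big_ord_recr /= addrAC subrr add0r mul1r.
have cl1 : closed [set 0 : A].
  by apply: accessible_closed_set1; apply: hausdorff_accessible; exact: norm_hausdorff.
have key z : (forall n, rnorm (z - (1 - x ^+ n)) <= rnorm (1 - x) * rnorm (w - u n)) -> z = 1.
  move=> H; apply/eqP; rewrite -subr_eq0; apply/eqP.
  apply: (closedP_rnorm cl1) => e e0; exists 0 => //; rewrite subr0.
  have e2 : 0 < e / 2 by rewrite divr_gt0.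
  have c0 : 0 < rnorm (1 - x) + 1 by rewrite ltr_wpDl // rnorm_ge0.
  have [N1 H1] := Hw (e / 2 / (rnorm (1 - x) + 1)) (divr_gt0 e2 c0).
  have [N2 H2] := pow_lt_eps (rnorm_ge0 x) x1 e2.
  pose n := maxn N1 N2.
  have -> : z - 1 = (z - (1 - x ^+ n)) - x ^+ n.
    by rewrite opprB addrA [RHS]addrAC addrK.
  rewrite (le_trans (rnormD _ _)) // rnormN (splitr e) lerD //.
    rewrite (le_trans (H n)) //.
    have := H1 n (leq_maxl _ _); rewrite ler_pdivlMr // => /(le_trans _); apply.
    by rewrite mulrC ler_wpM2l ?rnorm_ge0 // lerDl.
  by rewrite (le_trans (xn n)) // ltW // H2 // leq_maxr.
exists w; split; apply: key => n.
  by rewrite -ux -mulrBr rnormM.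
by rewrite -xu -mulrBl (le_trans (rnormM _ _)) // mulrC.
Qed.

End CStarTheory.

Section CayleyCesaro.
Variables (R : realType) (A : cstarAlgType R).
Implicit Types x y z h : A.

Lemma cayley h : star h = h -> rnorm h < 1 -> exists c d e : A,
  [/\ star c = c, rnorm c <= 1, 1 - c = d * (h * h) & h * h = e * (1 - c)].
Proof.
move=> sh h1; pose k : A := 'i *: h.
have sk : star k = - k by rewrite /k starZ sh -scaleNr; congr (_ *: _); simpc.
have kk : k * k = - (h * h).
  by rewrite /k scalerMl scalerMr scalerA -expr2 sqr_i scaleN1r.
have nk : rnorm k < 1.
  rewrite /k rnormZ (_ : complex.Re _ = 1) ?mul1r //=.
  by rewrite expr0n /= add0r expr1n sqrtr1.
pose p : A := 1 + k; pose m : A := 1 - k.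
have sm : star m = p by rewrite /m starB star1 sk opprK.
have sp : star p = m by rewrite -sm starK.
have pm : p * m = m * p.
  rewrite [LHS]mulrBr mulr1 {2}/p mulrDl mul1r opprD addrA addrK.
  by rewrite [RHS]mulrDr mulr1 {2}/m mulrBl mul1r addrA subrK.
have [w [mw wm]] := rnorm_neumann nk.
rewrite -/m in mw wm.
pose w' := star w.
have w'p : w' * p = 1 by rewrite -sm -starM mw star1.
have pw' : p * w' = 1 by rewrite -sm -starM wm star1.
pose u := w * p; pose us := w' * m.
have su : star u = us.
  rewrite /u starM sp -/w' /us.
  by rewrite -[m * w']mul1r -w'p -mulrA (mulrA p) pm -(mulrA m) pw' mulr1.
have usu : us * u = 1 by rewrite /u /us -mulrA (mulrA m) mw mul1r.
have nu : rnorm u <= 1.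
  rewrite -(@ler_pXn2r _ 2) ?nnegrE ?rnorm_ge0 // expr1n.
  by rewrite -rnorm_star_mul su usu rnorm1_le1.
have nus : rnorm us <= 1 by rewrite -su rnorm_star.
have two : (2 : R[i]) != 0 by rewrite pnatr_eq0.
pose c : A := (2^-1 : R[i]) *: (u + us).
have mpu : m * p * u = p * p by rewrite -pm /u -mulrA (mulrA m) mw mul1r.
have mpus : m * p * us = m * m by rewrite /us -mulrA (mulrA p) pw' mul1r.
have ppmm : p * p + m * m = (2 : R[i]) *: (1 - h * h).
  rewrite {1}/p {1}/m mulrDl mulrBl !mul1r addrACA -mulrBr.
  have -> : p - m = k + k by rewrite /p /m opprB addrCA [1 + k]addrC addrK.
  rewrite /p /m addrACA subrr addr0 mulrDr kk scaler_nat mulr2n.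
  by rewrite [RHS]addrACA.
have mp : m * p = 1 + h * h.
  by rewrite [LHS]mulrDr mulr1 {2}/m mulrBl mul1r addrA subrK kk opprK.
have hc : m * p * (1 - c) = (2 : R[i]) *: (h * h).
  rewrite mulrBr mulr1 /c scalerMr (mulrDr (m * p)) mpu mpus ppmm scalerA mulVf //.
  by rewrite scale1r mp scaler_nat mulr2n opprB addrCA [1 + _]addrC addrK.
exists c, ((2 : R[i]) *: (w' * w)), ((2^-1 : R[i]) *: (m * p)); split.
- rewrite /c starZ starD -su starK addrC; congr (_ *: _).
  by rewrite fmorphV rmorph_nat.
- rewrite /c rnormZ.
  have -> : complex.Re `|2^-1 : R[i]| = 2^-1.
    by rewrite ger0_norm ?invr_ge0 ?ler0n // -(rmorph_nat (real_complex R)) -fmorphV.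
  by rewrite mulrC ler_pdivrMr // mul1r (le_trans (rnormD _ _)) // (natrD _ 1 1) lerD.
- rewrite scalerMl -scalerMr -hc mulrA.
  by rewrite -(mulrA w') (mulrA w) wm mul1r w'p mul1r.
- by rewrite scalerMl hc scalerA mulVf // scale1r.
Qed.

End CayleyCesaro.

(* Closed two-sided ideals; as A is unital, they are linear subspaces. *)
Record cideal (R : realType) (A : cstarAlgType R) := CIdeal {
  cideal_set :> A -> Prop;
  cideal0 : cideal_set 0;
  cidealD : forall x y, cideal_set x -> cideal_set y -> cideal_set (x + y);
  cidealMl : forall a x, cideal_set x -> cideal_set (a * x);
  cidealMr : forall a x, cideal_set x -> cideal_set (x * a);
  cideal_closed : closed cideal_set
}.

Section IdealTheory.
Variables (R : realType) (A : cstarAlgType R) (I : cideal A).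
Implicit Types x y z h a : A.

Lemma cidealZ (c : R[i]) x : I x -> I (c *: x).
Proof. by move=> Ix; rewrite -[x]mul1r -scalerMl; exact: cidealMl. Qed.

Lemma cidealN x : I x -> I (- x).
Proof. by move=> Ix; rewrite -scaleN1r; exact: cidealZ. Qed.

Lemma cidealB x y : I x -> I y -> I (x - y).
Proof. by move=> Ix Iy; apply: cidealD => //; exact: cidealN. Qed.

Lemma cideal_sum n (f : 'I_n -> A) : (forall i, I (f i)) -> I (\sum_i f i).
Proof. by move=> If; apply: (big_ind I) => //; [exact: cideal0|exact: cidealD]. Qed.

Lemma cideal_sqr_unit h (e : R) : star h = h -> rnorm h < 1 -> I h -> 0 < e ->
  exists y, [/\ star y = y, rnorm y <= 1, I (1 - y) & rnorm (h * h * y) <= e].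
Proof.
move=> sh h1 Ih e0; have [c [d [f [sc c1 Ec Eh]]]] := cayley sh h1.
have Ic : I (1 - c) by rewrite Ec; do 2 apply: cidealMl.
have Icn n : I (1 - c ^+ n).
  elim: n => [|n IH]; first by rewrite expr0 subrr; exact: cideal0.
  have -> : 1 - c ^+ n.+1 = (1 - c) + c * (1 - c ^+ n).
    by rewrite mulrBr mulr1 -exprS addrA subrK.
  by apply: cidealD => //; exact: cidealMl.
pose s n : A := \sum_(k < n) c ^+ k.
have cs n : (1 - c) * s n = 1 - c ^+ n.
  elim: n => [|n IH]; first by rewrite /s big_ord0 mulr0 expr0 subrr.
  rewrite /s big_ord_recr /= -/(s n) mulrDr IH mulrBl mul1r -exprS.
  by rewrite addrA subrK.
pose n := (Num.bound (rnorm f * 2 / e)).+1.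
have n0 : (0 : R) < n%:R by rewrite ltr0n.
have nC (t : R) : complex.Re `|(n%:R : R[i])^-1| * t = n%:R^-1 * t.
  congr (_ * _); rewrite ger0_norm ?invr_ge0 ?ler0n //.
  by rewrite -(rmorph_nat (real_complex R)) -fmorphV.
exists ((n%:R^-1 : R[i]) *: s n); split.
- rewrite starZ fmorphV rmorph_nat; congr (_ *: _).
  rewrite /s; elim: (n) => [|m IH]; first by rewrite big_ord0 star0.
  by rewrite big_ord_recr /= starD IH starX sc.
- rewrite rnormZ nC ler_pdivrMl // mulr1 /s; elim: (n) => [|m IH].
    by rewrite big_ord0 rnorm0.
  by rewrite big_ord_recr /= (le_trans (rnormD _ _)) // -natr1 lerD // rnormX_le1.
- have -> : 1 - (n%:R^-1 : R[i]) *: s n =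
            (n%:R^-1 : R[i]) *: \sum_(k < n) (1 - c ^+ k).
    rewrite sumrB scalerBr sumr_const card_ord.
    have -> : (1 : A) *+ n = (n%:R : R[i]) *: (1 : A) by rewrite scaler_nat.
    by rewrite scalerA mulVf ?scale1r // pnatr_eq0.
  by apply: cidealZ; apply: cideal_sum => i; exact: Icn.
- rewrite scalerMr rnormZ nC Eh -mulrA cs ler_pdivrMl //.
  rewrite (le_trans (rnormM _ _)) //.
  apply: (@le_trans _ _ (rnorm f * 2)).
    rewrite ler_wpM2l ?rnorm_ge0 // (le_trans (rnormD _ _)) // rnormN.
    by rewrite (natrD _ 1 1) lerD // ?rnorm1_le1 // rnormX_le1.
  rewrite -ler_pdivrMr //.
  have fe : 0 <= rnorm f * 2 / e by rewrite divr_ge0 ?mulr_ge0 ?rnorm_ge0 // ltW.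
  by rewrite (le_trans (ltW (archi_boundP fe))) // ler_nat.
Qed.

Lemma cideal_approx_unit x (e : R) : I x -> 0 < e ->
  exists y, [/\ star y = y, rnorm y <= 1, I (1 - y) & rnorm (x * y) <= e].
Proof.
move=> Ix e0; pose b := star x * x.
have Ib : I b by exact: cidealMl.
have sb : star b = b by rewrite /b starM starK.
pose t : R := (rnorm b + 1)^-1 / 2.
have b1 : 0 < rnorm b + 1 by rewrite ltr_wpDl // rnorm_ge0.
have t0 : 0 < t by rewrite divr_gt0 // invr_gt0.
pose h : A := t%:C *: b.
have tZ z : rnorm (t%:C *: z) = t * rnorm z.
  by rewrite rnormZ; congr (_ * _); rewrite ger0_norm // ler0c ltW.
have [||||y [sy y1 Iy hy]] := @cideal_sqr_unit h (t ^+ 2 * e ^+ 4).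
- by rewrite /h starZ sb; congr (_ *: _); exact: conjc_real.
- rewrite /h tZ /t mulrAC ltr_pdivrMr // mul1r mulrC ltr_pdivrMr //.
  by have := rnorm_ge0 b; lra.
- exact: cidealZ.
- by rewrite mulr_gt0 ?exprn_gt0.
exists y; split => //.
rewrite -(@ler_pXn2r _ 4) ?nnegrE ?rnorm_ge0 ?(ltW e0) //.
rewrite (exprM _ 2 2) -rnorm_star_mul.
have by1 z : rnorm (y * z) <= rnorm z.
  by rewrite (le_trans (rnormM _ _)) // ler_piMl ?rnorm_ge0.
apply: (@le_trans _ _ (rnorm (b * y) ^+ 2)).
  rewrite ler_pXn2r ?nnegrE ?rnorm_ge0 // starM sy -mulrA.
  by rewrite (le_trans (by1 _)) // mulrA.
rewrite -rnorm_star_mul starM sb sy -mulrA (le_trans (by1 _)) //.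
rewrite -(@ler_pM2l _ (t ^+ 2)) ?exprn_gt0 // (le_trans _ hy) //.
by rewrite /h !(scalerMl, scalerMr, tZ) expr2 !mulrA.
Qed.

Lemma cideal_star x : I x -> I (star x).
Proof.
move=> Ix; apply: (closedP_rnorm (@cideal_closed _ _ I)) => e e0.
have [y [sy y1 Iy xy]] := cideal_approx_unit Ix e0.
exists ((1 - y) * star x); first exact: cidealMr.
by rewrite mulrBl mul1r opprB addrCA subrr addr0 -{1}sy -starM rnorm_star.
Qed.

End IdealTheory.

Section Quotient.
Variables (R : realType) (A : cstarAlgType R) (I : cideal A).
Implicit Types x y z a : A.

Definition cideal_rel x y : bool := `[< I (x - y) >].

Lemma cideal_rel_equiv : equiv_class_of cideal_rel.
Proof.
split=> [x|x y|y x z].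
- by apply/asboolP; rewrite subrr; exact: cideal0.
- by apply/asboolP/asboolP => /cidealN; rewrite opprB.
- move=> /asboolP xy /asboolP yz; apply/asboolP.
  by rewrite -(subrKA y); exact: cidealD.
Qed.

Canonical cideal_equiv := EquivRelPack cideal_rel_equiv.

Definition quot : Type := {eq_quot cideal_equiv}.

HB.instance Definition _ := Choice.on quot.
HB.instance Definition _ := EqQuotient.on quot.

Definition qproj (a : A) : quot := \pi_quot a.

Lemma qprojP x y : qproj x = qproj y <-> I (x - y).
Proof. by split=> [/eqquotP/asboolP|H] //; apply/eqquotP/asboolP. Qed.

Lemma qprojK (q : quot) : qproj (repr q) = q.
Proof. exact: reprK. Qed.

Lemma repr_qproj x : I (repr (qproj x) - x).
Proof. by apply/qprojP; rewrite qprojK. Qed.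

Lemma qprojW (P : quot -> Prop) : (forall a, P (qproj a)) -> forall q, P q.
Proof. by move=> H q; rewrite -[q]qprojK. Qed.

Definition quot_add (p q : quot) := qproj (repr p + repr q).
Definition quot_opp (p : quot) := qproj (- repr p).
Definition quot_mul (p q : quot) := qproj (repr p * repr q).
Definition quot_scale (c : R[i]) (p : quot) := qproj (c *: repr p).
Definition quot_star (p : quot) := qproj (star (repr p)).

Lemma quot_addE x y : quot_add (qproj x) (qproj y) = qproj (x + y).
Proof. by apply/qprojP; rewrite opprD addrACA; apply: cidealD; exact: repr_qproj. Qed.

Lemma quot_oppE x : quot_opp (qproj x) = qproj (- x).
Proof. by apply/qprojP; rewrite -opprD; apply: cidealN; exact: repr_qproj. Qed.

Lemma quot_mulE x y : quot_mul (qproj x) (qproj y) = qproj (x * y).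
Proof.
apply/qprojP; rewrite -(subrKA (repr (qproj x) * y)) -mulrBr -mulrBl.
by apply: cidealD; [apply: cidealMl|apply: cidealMr]; exact: repr_qproj.
Qed.

Lemma quot_scaleE c x : quot_scale c (qproj x) = qproj (c *: x).
Proof. by apply/qprojP; rewrite -scalerBr; apply: cidealZ; exact: repr_qproj. Qed.

Lemma quot_starE x : quot_star (qproj x) = qproj (star x).
Proof. by apply/qprojP; rewrite -starB; apply: cideal_star; exact: repr_qproj. Qed.

Lemma quot_addA : associative quot_add.
Proof.
elim/qprojW => x; elim/qprojW => y; elim/qprojW => z.
by rewrite !quot_addE addrA.
Qed.

Lemma quot_addC : commutative quot_add.
Proof. by elim/qprojW => x; elim/qprojW => y; rewrite !quot_addE addrC. Qed.

Lemma quot_add0 : left_id (qproj 0) quot_add.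
Proof. by elim/qprojW => x; rewrite quot_addE add0r. Qed.

Lemma quot_addN : left_inverse (qproj 0) quot_opp quot_add.
Proof. by elim/qprojW => x; rewrite quot_oppE quot_addE addNr. Qed.

HB.instance Definition _ :=
  GRing.isZmodule.Build quot quot_addA quot_addC quot_add0 quot_addN.

Lemma qprojD x y : qproj (x + y) = qproj x + qproj y.
Proof. by rewrite -quot_addE. Qed.

Lemma qprojN x : qproj (- x) = - qproj x.
Proof. by rewrite -quot_oppE. Qed.

Lemma quot_scaleA (b c : R[i]) (q : quot) :
  quot_scale b (quot_scale c q) = quot_scale (b * c) q.
Proof. by elim/qprojW: q => x; rewrite !quot_scaleE scalerA. Qed.

Lemma quot_scale1 : left_id 1 quot_scale.
Proof. by elim/qprojW => x; rewrite quot_scaleE scale1r. Qed.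

Lemma quot_scaleDr : right_distributive quot_scale +%R.
Proof.
move=> c; elim/qprojW => x; elim/qprojW => y.
by rewrite -qprojD !quot_scaleE scalerDr qprojD.
Qed.

Lemma quot_scaleDl (q : quot) : {morph quot_scale^~ q : b c / b + c}.
Proof.
by elim/qprojW: q => x b c; rewrite !quot_scaleE scalerDl qprojD.
Qed.

HB.instance Definition _ := GRing.Zmodule_isLmodule.Build R[i] quot
  quot_scaleA quot_scale1 quot_scaleDr quot_scaleDl.

Lemma qprojZ (c : R[i]) x : qproj (c *: x) = c *: qproj x.
Proof. by rewrite -quot_scaleE. Qed.

(* The quotient norm. *)
Definition quot_rnorm (q : quot) : R :=
  inf [set rnorm x | x in [set x | qproj x = q]].

Lemma quot_rnorm_has_inf (q : quot) :
  has_inf [set rnorm x | x in [set x | qproj x = q]].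
Proof.
split; first by exists (rnorm (repr q)); exists (repr q) => //; exact: qprojK.
by exists 0 => _ [x _ <-]; exact: rnorm_ge0.
Qed.

Lemma quot_rnorm_le x : quot_rnorm (qproj x) <= rnorm x.
Proof. by apply: ge_inf; [case: (quot_rnorm_has_inf (qproj x))|exists x]. Qed.

Lemma le_quot_rnorm (q : quot) (t : R) :
  (forall x, qproj x = q -> t <= rnorm x) -> t <= quot_rnorm q.
Proof.
move=> H; apply: lb_le_inf; first by case: (quot_rnorm_has_inf q).
by move=> _ [x xq <-]; exact: H.
Qed.

Lemma quot_rnorm_ge0 (q : quot) : 0 <= quot_rnorm q.
Proof. by apply: le_quot_rnorm => x _; exact: rnorm_ge0. Qed.

Lemma quot_rnorm_lift (q : quot) (e : R) : 0 < e ->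
  exists2 x, qproj x = q & rnorm x < quot_rnorm q + e.
Proof.
move=> e0; have [_ [x xq <-] H] := inf_adherent e0 (quot_rnorm_has_inf q).
by exists x.
Qed.

Lemma quot_rnormD (p q : quot) :
  quot_rnorm (p + q) <= quot_rnorm p + quot_rnorm q.
Proof.
apply/ler_addgt0Pr => e e0; have e2 : 0 < e / 2 by rewrite divr_gt0.
have [x <- Hx] := quot_rnorm_lift p e2.
have [y <- Hy] := quot_rnorm_lift q e2.
rewrite -qprojD (le_trans (quot_rnorm_le _)) // (le_trans (rnormD _ _)) //.
lra.
Qed.

Lemma quot_rnormM (p q : quot) :
  quot_rnorm (quot_mul p q) <= quot_rnorm p * quot_rnorm q.
Proof.
apply/ler_addgt0Pr => e e0.
set a := quot_rnorm p; set b := quot_rnorm q.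
have a0 : 0 <= a by exact: quot_rnorm_ge0.
have b0 : 0 <= b by exact: quot_rnorm_ge0.
pose d := Num.min 1 (e / (a + b + 1)).
have ab : 0 < a + b + 1 by lra.
have d0 : 0 < d by rewrite lt_min ltr01 divr_gt0.
have d1 : d <= 1 by rewrite ge_min lexx.
have de : d * (a + b + 1) <= e.
  by rewrite -ler_pdivlMr // ge_min lexx orbT.
have [x xp Hx] := quot_rnorm_lift p d0.
have [y yq Hy] := quot_rnorm_lift q d0.
rewrite -xp -yq quot_mulE (le_trans (quot_rnorm_le _)) //.
rewrite (le_trans (rnormM _ _)) // (@le_trans _ _ ((a + d) * (b + d))) //.
  by rewrite ler_pM ?rnorm_ge0 // ltW.
nra.
Qed.

Lemma quot_rnormZ_le (c : R[i]) (q : quot) :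
  quot_rnorm (c *: q) <= complex.Re `|c| * quot_rnorm q.
Proof.
have c0 : 0 <= complex.Re `|c| by rewrite -ler0c RRe_real ?ger0_real.
apply/ler_addgt0Pr => e e0; set k := complex.Re `|c| in c0 *.
have k1 : 0 < k + 1 by lra.
have [x <- Hx] := quot_rnorm_lift q (divr_gt0 e0 k1).
rewrite -qprojZ (le_trans (quot_rnorm_le _)) // rnormZ -/k.
rewrite (le_trans (ler_wpM2l c0 (ltW Hx))) // mulrDr lerD2l.
by rewrite mulrCA ger_pMr // ler_pdivrMr // mul1r lerDl.
Qed.

Lemma quot_rnormZ (c : R[i]) (q : quot) :
  quot_rnorm (c *: q) = complex.Re `|c| * quot_rnorm q.
Proof.
apply/eqP; rewrite eq_le quot_rnormZ_le andTb.
have [->|c0] := eqVneq c 0.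
  by rewrite normr0 mul0r quot_rnorm_ge0.
have n0 : 0 < complex.Re `|c|.
  by rewrite -ltcR RRe_real ?normr_gt0 // ger0_real.
rewrite -ler_pdivlMl // -{1}[q]scale1r -(mulVf c0) -scalerA.
rewrite (le_trans (quot_rnormZ_le _ _)) // normfV.
suff -> : complex.Re `|c|^-1 = (complex.Re `|c|)^-1 by [].
have {1}<- : (complex.Re `|c|)%:C = `|c| by rewrite RRe_real ?ger0_real.
by rewrite -fmorphV.
Qed.

Lemma quot_rnorm_eq0 (q : quot) : quot_rnorm q = 0 -> q = 0.
Proof.
elim/qprojW: q => x x0; apply/qprojP; rewrite subr0.
apply: (closedP_rnorm (@cideal_closed _ _ I)) => e e0.
have [y yx] := quot_rnorm_lift (qproj x) e0; rewrite x0 add0r => ye.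
exists (x - y); last by rewrite subKr ltW.
by apply/qprojP.
Qed.

Lemma quot_normD (p q : quot) :
  (quot_rnorm (p + q))%:C <= (quot_rnorm p)%:C + (quot_rnorm q)%:C.
Proof. by rewrite -rmorphD lecR quot_rnormD. Qed.

Lemma quot_normZ (c : R[i]) (q : quot) :
  (quot_rnorm (c *: q))%:C = `|c| * (quot_rnorm q)%:C.
Proof.
by rewrite quot_rnormZ [LHS]rmorphM; congr (_ * _).
Qed.

Lemma quot_norm_eq0 (q : quot) : (quot_rnorm q)%:C = 0 -> q = 0.
Proof. by move=> /complexI; exact: quot_rnorm_eq0. Qed.

HB.instance Definition _ := Lmodule_isNormed.Build R[i] quot
  quot_normD quot_normZ quot_norm_eq0.

Lemma quot_rnormE (q : quot) : rnorm q = quot_rnorm q.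
Proof. by []. Qed.

Lemma quot_complete (F : set_system quot) : ProperFilter F -> cauchy F -> cvg F.
Proof.
move=> FF /cauchyP cF.
have h0 n : 0 < (2^-1 : R) ^+ n by rewrite exprn_gt0 // invr_gt0.
have /choice[b Hb] : forall n, exists q : quot,
    F (ball q ((2^-1 ^+ n)%:C : R[i])).
  by move=> n; apply: cF; rewrite ltcR.
have ballE (p q : quot) (e : R) : ball p (e%:C : R[i]) q -> rnorm (p - q) < e.
  by rewrite -ball_normE /ball_ /= normE ltcR.
have bb n : rnorm (b n.+1 - b n) < 2 * 2^-1 ^+ n.
  have [z [/ballE z1 /ballE z2]] := filter_ex (filterI (Hb n.+1) (Hb n)).
  rewrite -(subrKA z) (le_lt_trans (rnormD _ _)) // (rnormB z).
  by move: z1 z2 (h0 n); rewrite exprS; lra.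
have step (p : A * nat) : exists y, qproj p.1 = b p.2 ->
    qproj y = b p.2.+1 /\ rnorm (y - p.1) <= 3 * 2^-1 ^+ p.2.
  case: p => x n /=; have [d dq dn] := quot_rnorm_lift (b n.+1 - b n) (h0 n).
  exists (x + d) => xn; rewrite qprojD dq xn subrKC; split=> //.
  by rewrite addrAC subrr add0r; move: dn (bb n); rewrite quot_rnormE; lra.
have [s Hs] := choice step.
pose u := fix u n := if n is m.+1 then s (u m, m) else repr (b 0%N).
have ub n : qproj (u n) = b n.
  by elim: n => [|n IH] /=; [exact: qprojK|have [] := Hs (u n, n) IH].
have uu n : rnorm (u n.+1 - u n) <= 3 * 2^-1 ^+ n.
  by have [] := Hs (u n, n) (ub n).
have hh0 : (0 : R) <= 2^-1 by rewrite invr_ge0.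
have hh1 : (2^-1 : R) < 1 by lra.
have [l Hl] := rnorm_geo_cvg hh0 hh1 uu.
apply: (@cvgP _ _ (qproj l)); apply/cvg_ballP => e e0.
have e0' : 0 < complex.Re e by move: e0; rewrite ltcE => /andP[].
have e2 : 0 < complex.Re e / 2 by rewrite divr_gt0.
have [N1 H1] := Hl _ e2.
have [N2 H2] := pow_lt_eps hh0 hh1 e2.
pose n := maxn N1 N2.
apply: filterS (Hb n) => z /ballE bz; rewrite -ball_normE /ball_ /= normE.
rewrite -(@RRe_real _ e) ?gtr0_real // ltcR.
rewrite -(subrKA (b n)) (le_lt_trans (rnormD _ _)) // -ub -qprojN -qprojD ub.
have := quot_rnorm_le (l - u n); rewrite -quot_rnormE.
by move: (H1 n (leq_maxl _ _)) (H2 n (leq_maxr _ _)) bz; lra.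
Qed.

HB.instance Definition _ := Uniform_isComplete.Build quot quot_complete.

Lemma qproj_mulA : associative quot_mul.
Proof.
elim/qprojW => x; elim/qprojW => y; elim/qprojW => z.
by rewrite !quot_mulE mulrA.
Qed.

Lemma quot_mul1r : left_id (qproj 1) quot_mul.
Proof. by elim/qprojW => x; rewrite quot_mulE mul1r. Qed.

Lemma quot_mulr1 : right_id (qproj 1) quot_mul.
Proof. by elim/qprojW => x; rewrite quot_mulE mulr1. Qed.

Lemma quot_mulDl : left_distributive quot_mul +%R.
Proof.
elim/qprojW => x; elim/qprojW => y; elim/qprojW => z.
by rewrite -qprojD !quot_mulE mulrDl qprojD.
Qed.

Lemma quot_mulDr : right_distributive quot_mul +%R.
Proof.
elim/qprojW => x; elim/qprojW => y; elim/qprojW => z.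
by rewrite -qprojD !quot_mulE mulrDr qprojD.
Qed.

Lemma quot_mulZl (c : R[i]) (p q : quot) :
  quot_mul (c *: p) q = c *: quot_mul p q.
Proof.
elim/qprojW: p => x; elim/qprojW: q => y.
by rewrite -qprojZ !quot_mulE scalerMl qprojZ.
Qed.

Lemma quot_mulZr (c : R[i]) (p q : quot) :
  quot_mul p (c *: q) = c *: quot_mul p q.
Proof.
elim/qprojW: p => x; elim/qprojW: q => y.
by rewrite -qprojZ !quot_mulE scalerMr qprojZ.
Qed.

Lemma quot_normM (p q : quot) : `|quot_mul p q| <= `|p| * `|q|.
Proof. by rewrite !normE -rmorphM lecR; exact: quot_rnormM. Qed.

Lemma quot_starK : involutive quot_star.
Proof. by elim/qprojW => x; rewrite !quot_starE starK. Qed.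

Lemma quot_starD : {morph quot_star : p q / p + q}.
Proof.
elim/qprojW => x; elim/qprojW => y.
by rewrite -qprojD !quot_starE starD qprojD.
Qed.

Lemma quot_starZ (c : R[i]) (q : quot) : quot_star (c *: q) = c^* *: quot_star q.
Proof. by elim/qprojW: q => x; rewrite -qprojZ !quot_starE starZ qprojZ. Qed.

Lemma quot_starM (p q : quot) :
  quot_star (quot_mul p q) = quot_mul (quot_star q) (quot_star p).
Proof.
elim/qprojW: p => x; elim/qprojW: q => y.
by rewrite quot_mulE !quot_starE quot_mulE starM.
Qed.

Lemma quot_rnorm_star (q : quot) : quot_rnorm (quot_star q) <= quot_rnorm q.
Proof.
apply: le_quot_rnorm => x <-.
by rewrite quot_starE (le_trans (quot_rnorm_le _)) // rnorm_star.
Qed.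

Lemma quot_norm_starM (q : quot) :
  `|quot_mul (quot_star q) q| = `|q| ^+ 2.
Proof.
rewrite !normE -rmorphXn; congr (_%:C); rewrite !quot_rnormE.
apply/eqP; rewrite eq_le; apply/andP; split.
  rewrite (le_trans (quot_rnormM _ _)) // expr2.
  by rewrite ler_wpM2r ?quot_rnorm_ge0 // quot_rnorm_star.
elim/qprojW: q => a; rewrite quot_starE quot_mulE.
apply: le_quot_rnorm => x /qprojP Ix.
apply/ler_addgt0Pr => e e0.
have [y [sy y1 Iy xy]] := cideal_approx_unit Ix e0.
have -> : qproj a = qproj (a * y).
  by apply/qprojP; rewrite -{1}[a]mulr1 -mulrBr; exact: cidealMl.
apply: (@le_trans _ _ (rnorm (a * y) ^+ 2)).
  by rewrite ler_pXn2r ?nnegrE ?rnorm_ge0 ?quot_rnorm_ge0 // quot_rnorm_le.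
rewrite -rnorm_star_mul starM sy.
have y1z z : rnorm (y * z) <= rnorm z.
  by rewrite (le_trans (rnormM _ _)) // ler_piMl ?rnorm_ge0.
have -> : y * star a * (a * y) = y * (x * y) - y * ((x - star a * a) * y).
  by rewrite -mulrBr -mulrBl subKr !mulrA.
rewrite (le_trans (rnormD _ _)) // rnormN lerD // ?(le_trans (y1z _)) //.
by rewrite (le_trans (rnormM _ _)) // ler_piMr ?rnorm_ge0.
Qed.

HB.instance Definition _ := CompleteNormedModule_isCStarAlgebra.Build R quot
  qproj_mulA quot_mul1r quot_mulr1 quot_mulDl quot_mulDr quot_mulZl quot_mulZr
  quot_normM quot_starK quot_starD quot_starZ quot_starM quot_norm_starM.

End Quotient.

Section QuotientMap.
Variables (R : realType) (A : cstarAlgType R) (I : cideal A).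

HB.instance Definition _ := GRing.PzRing.copy (quot I)
  (CStarAlgebra.sort (quot I : cstarAlgType R)).

Lemma qproj1 : qproj I 1 = 1.
Proof. by []. Qed.

Lemma qprojM (x y : A) :
  qproj I (x * y) = qproj I x * qproj I y.
Proof. by rewrite -quot_mulE. Qed.

Lemma qproj_star (x : A) : qproj I (star x) = star (qproj I x).
Proof. by rewrite -quot_starE. Qed.

End QuotientMap.

Definition alg_center (R : realType) (B : cstarAlgType R) : set B :=
  [set z | forall b, z * b = b * z].
Arguments alg_center {R} B.

Record star_rep (R : realType) (B : cstarAlgType R) (H : hilbertType R) :=
  StarRep {
    rep_fun :> B -> H -> H;
    rep_linear : forall b (c : R[i]) x y,
      rep_fun b (c *: x + y) = c *: rep_fun b x + rep_fun b y;
    rep_continuous : forall b, continuous (rep_fun b);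
    repD : forall a b x, rep_fun (a + b) x = rep_fun a x + rep_fun b x;
    repZ : forall (c : R[i]) b x, rep_fun (c *: b) x = c *: rep_fun b x;
    repM : forall a b x, rep_fun (a * b) x = rep_fun a (rep_fun b x);
    rep_star : forall b x y,
      inner (rep_fun (star b) x) y = inner x (rep_fun b y)
  }.

Definition rep_kernel (R : realType) (B : cstarAlgType R) (H : hilbertType R)
    (pi : star_rep B H) : set B :=
  [set b | forall x, pi b x = 0].

Definition irreducible_rep (R : realType) (B : cstarAlgType R)
    (H : hilbertType R) (pi : star_rep B H) : Prop :=
  rep_kernel pi <> setT /\
  forall V : set H, V 0 ->
    (forall (c : R[i]) x y, V x -> V y -> V (c *: x + y)) ->
    closed V ->
    (forall b x, V x -> V (pi b x)) ->
    V = [set 0] \/ V = setT.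

(* Such a kernel is automatically a closed two-sided ideal. *)
Definition primitive_ideal (R : realType) (B : cstarAlgType R)
    (P : set B) : Prop :=
  exists (H : hilbertType R) (pi : star_rep B H),
    irreducible_rep pi /\ P = rep_kernel pi.

Record Prim (R : realType) (B : cstarAlgType R) := MkPrim {
  prim_set :> B -> Prop;
  prim_primitive : primitive_ideal prim_set
}.

HB.instance Definition _ (R : realType) (B : cstarAlgType R) :=
  gen_eqMixin (Prim B).
HB.instance Definition _ (R : realType) (B : cstarAlgType R) :=
  gen_choiceMixin (Prim B).

Section Jacobson.
Variables (R : realType) (B : cstarAlgType R).

Lemma rep0 (H : hilbertType R) (pi : star_rep B H) b : pi b 0 = 0.
Proof. by have := rep_linear pi b (-1) 0 0; rewrite scaler0 addr0 scaleN1r addNr. Qed.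

Lemma prim_proper (P : Prim B) : ~ P 1.
Proof.
have [H [pi [[pi0 _] PE]]] := prim_primitive P.
rewrite PE => P1; apply: pi0; apply/seteqP; split=> // b _ x.
by rewrite -[b]mulr1 repM P1 rep0.
Qed.

Lemma primMl (P : Prim B) a x : P x -> P (a * x).
Proof.
have [H [pi [_ ->]]] := prim_primitive P.
by move=> Px v; rewrite repM Px rep0.
Qed.

Lemma primMr (P : Prim B) a x : P x -> P (x * a).
Proof.
have [H [pi [_ ->]]] := prim_primitive P.
by move=> Px v; rewrite repM Px.
Qed.

Lemma prim_prime (P : Prim B) (s t : B) :
  (forall b, P (s * b * t)) -> P s \/ P t.
Proof.
have [H [pi [[_ irr] ->]]] := prim_primitive P => st.
have [|/existsNP[x tx]] := pselect (rep_kernel pi t); first by right.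
left; pose V := [set v | forall b, pi (s * b) v = 0].
have [||||V0|VT] := irr V.
- by move=> b; exact: rep0.
- by move=> c v w Vv Vw b; rewrite rep_linear Vv Vw scaler0 addr0.
- have -> : V = \bigcap_b (pi (s * b) @^-1` [set 0]).
    by apply/seteqP; split=> [v Vv b _|v Vv b]; [exact: Vv|exact: Vv].
  apply: closed_bigI => b _; apply: preimage_closed.
    by move=> v _; exact: rep_continuous.
  apply: accessible_closed_set1; apply: hausdorff_accessible.
  exact: norm_hausdorff.
- by move=> b v Vv c; rewrite /= -repM -mulrA; exact: Vv.
- exfalso; apply: tx.
  suff : V (pi t x) by rewrite V0.
  by move=> b; rewrite -repM; exact: st.
- move=> v; have : V v by rewrite VT.
  by move/(_ 1); rewrite mulr1.
Qed.

(* The closed sets are the hulls {P | S `<=` P}; S may be any subset, since it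
   has the same hull as the closed ideal it generates. *)
Definition jacobson_open : set_system (Prim B) :=
  [set U | exists S : set B, U = [set P : Prim B | ~ (S `<=` P)]].

Lemma jacobson_openT : jacobson_open setT.
Proof.
exists setT; apply/seteqP; split=> // P _ TP.
by apply: (@prim_proper P); exact: TP.
Qed.

Lemma jacobson_openI : setI_closed jacobson_open.
Proof.
move=> _ _ [S ->] [T ->].
exists [set x | exists s b t, [/\ S s, T t & x = s * b * t]].
apply/seteqP; split=> P /=.
  move=> [/existsNP[s /not_implyP[Ss Ps]] /existsNP[t /not_implyP[Tt Pt]]] ST.
  have [] // : P s \/ P t.
  by apply: prim_prime => b; apply: ST; exists s, b, t.
move=> ST; split=> SP; apply: ST => _ [s [b [t [Ss Tt ->]]]].
  by rewrite -mulrA; apply: primMr; exact: SP.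
by apply: primMl; exact: SP.
Qed.

Lemma jacobson_open_bigU (J : Type) (f : J -> set (Prim B)) :
  (forall j, jacobson_open (f j)) -> jacobson_open (\bigcup_j f j).
Proof.
move=> /choice[S HS]; exists (\bigcup_j S j).
apply/seteqP; split=> P /=.
  move=> [j _]; rewrite HS => /= nP SP; apply: nP => x Sx.
  by apply: SP; exists j.
move=> /existsNP[x /not_implyP[[j _ Sx] Px]]; exists j => //.
by rewrite HS => SP; apply: Px; exact: SP.
Qed.

HB.instance Definition _ := isOpenTopological.Build (Prim B)
  jacobson_openT jacobson_openI jacobson_open_bigU.

End Jacobson.

(* The equality z + P = f(P)1 + P in B/P is written as z - f(P)1 \in P. It
   determines f, because 1 \notin P, and for central z the Dauns-Hofmann theorem
   provides such a continuous f; the default value 0 concerns only z outside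
   the centre. *)
Definition dauns_hofmann (R : realType) (B : cstarAlgType R) (z : B) :
    continuousType (Prim B) R[i]^o :=
  xget (mkcts (@cst_continuous _ _ 0) : continuousType (Prim B) R[i]^o)
    [set f : continuousType (Prim B) R[i]^o |
      forall P : Prim B, P (z - (f P : R[i]) *: (1 : B))].

(* P/I, as a point of Prim (A/I). *)
Section PrimQuotient.
Variables (R : realType) (A : cstarAlgType R) (I : cideal A).
Variables (P : Prim A) (IP : I `<=` P).

Lemma prim_quot_subproof : primitive_ideal (qproj I @` P).
Proof.
have [H [pi [[pi0 irr] PE]]] := prim_primitive P.
have piI a x : I a -> pi a x = 0 by move=> /IP; rewrite PE; exact.
have piE a x : pi (repr (qproj I a)) x = pi a x.
  rewrite -[repr _](subrK a) repD piI ?add0r //; exact: repr_qproj.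
pose rho (q : quot I) := pi (repr q).
have rl q : forall (c : R[i]) x y, rho q (c *: x + y) = c *: rho q x + rho q y.
  exact: rep_linear.
have rc q : continuous (rho q) by exact: rep_continuous.
have rD p q x : rho (p + q) x = rho p x + rho q x.
  by elim/qprojW: p => a; elim/qprojW: q => b; rewrite -qprojD /rho !piE repD.
have rZ (c : R[i]) q x : rho (c *: q) x = c *: rho q x.
  by elim/qprojW: q => a; rewrite -qprojZ /rho !piE repZ.
have rM p q x : rho (p * q) x = rho p (rho q x).
  by elim/qprojW: p => a; elim/qprojW: q => b; rewrite -qprojM /rho !piE repM.
have rs q x y : inner (rho (star q) x) y = inner x (rho q y).
  by elim/qprojW: q => a; rewrite -qproj_star /rho !piE rep_star.
exists H, (@StarRep R (quot I) H rho rl rc rD rZ rM rs).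
have kE : qproj I @` P = rep_kernel (@StarRep R (quot I) H rho rl rc rD rZ rM rs).
  apply/seteqP; split=> [_ [a Pa <-] x|q qk].
    by rewrite /= /rho piE; move: Pa; rewrite PE; exact.
  by exists (repr q); [rewrite PE => x; exact: qk|exact: qprojK].
split=> //; split.
  move=> kT; apply: pi0; apply/seteqP; split=> // a _ x.
  have : rep_kernel (@StarRep R (quot I) H rho rl rc rD rZ rM rs) (qproj I a).
    by rewrite kT.
  by move/(_ x); rewrite /= /rho piE.
move=> V V0 Vl Vc Vi; apply: irr => // b x Vx.
by have := Vi (qproj I b) x Vx; rewrite /= /rho piE.
Qed.

Definition prim_quot : Prim (quot I) := MkPrim prim_quot_subproof.

End PrimQuotient.
Arguments prim_quot {R A I P} IP.

(* Main.v *)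
(* Pointwise, the condition says that the function of a + I on the primitive
   ideals P above I factors through P |-> P :&: Z(A). Necessity is immediate from
   z - lambda \in P :&: Z(A). For sufficiency we may take a self-adjoint. The
   values of self-adjoint elements of Z(A) separate the points that are not
   identified, and Z(A) is a lattice, so the Kakutani-Stone argument, with the
   compactness of the set of primitive ideals above I, approximates the values of
   a uniformly by values of elements z_n of Z(A). Truncating the differences
   z_(n+1) - z_n inside Z(A) does not change them modulo I and makes their norms
   summable; the sum z has the same values as a, hence a - z lies in every
   primitive ideal above I, and so in I.

   Compactness and the last step need enough primitive ideals: every proper ideal
   lies in one, by the GNS representation of a pure state of a quotient. Values
   exist by Schur's lemma. The functional calculus that this requires (square
   roots, positive parts, positivity of x^* x) is derived from an iteration for
   the square root. *)

(* The values of [z_(n+1) - z_n] at the primitive ideals above [I] control its norm modulo [I] only;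
   in [A] these differences may stay large, so the approximants themselves need not converge and
   their truncated differences are summed instead. No spectrum is ever formed. Nonnegativity of a
   self-adjoint [x] is the condition that [t - x] has norm at most [t] for some [t]; it passes to
   quotients because quotient maps are contractive. Its borderline case leaves no geometric rate for
   the square-root iteration. The order theory grows from one inequality: the norm of [p] squared is
   at most the norm of [p^2 + q^2] for commuting self-adjoint [p] and [q]. A pure state usually
   comes from Hahn-Banach, weak compactness and Krein-Milman. Here a convex set of functionals is
   represented by a sublinear bound, and a single use of Zorn's lemma on faces encoded in this way
   yields an extreme point directly. Values are treated as a relation between an element, an ideal
   and a scalar, so that computing with them involves no choice; the Dauns-Hofmann function enters
   only at the end. *)
Require Import Defs.
From HB Require Import structures.
From mathcomp Require Import all_boot all_order all_algebra complex.
From mathcomp Require Import boolp classical_sets functions reals topology normedtype.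
From mathcomp Require Import ring lra.

Set Implicit Arguments.
Unset Strict Implicit.
Unset Printing Implicit Defensive.

Import Order.TTheory GRing.Theory Num.Theory.
Import numFieldNormedType.Exports.
Local Open Scope classical_set_scope.
Local Open Scope ring_scope.
Local Open Scope complex_scope.

(** * Normalisation in an algebra *)

(* A reflexive decision procedure for identities between polynomial expressions
   with coefficients in [R[i]]: [nc] is for free variables, [cnc] for pairwise
   commuting ones. What remains is the vanishing of the coefficients. *)
Inductive nexpr (K : Type) :=
  | NVar of nat | NZero | NOne | NAdd of nexpr K & nexpr K | NOpp of nexpr K
  | NMul of nexpr K & nexpr K | NScale of K & nexpr K.
Arguments NVar {K}.
Arguments NZero {K}.
Arguments NOne {K}.

Fixpoint word_eqb (v w : seq nat) : bool :=
  match v, w with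
  | [::], [::] => true
  | i :: v', j :: w' => if Nat.eqb i j then word_eqb v' w' else false
  | _, _ => false
  end.

Fixpoint word_insert (i : nat) (w : seq nat) : seq nat :=
  if w is j :: w' then
    if Nat.leb i j then i :: w else j :: word_insert i w'
  else [:: i].

Definition word_id (w : seq nat) := w.
Definition word_sort (w : seq nat) := List.fold_right word_insert [::] w.

Section Normalise.
Variables (R : realType) (A : cstarAlgType R) (env : seq A).
Variable canon : seq nat -> seq nat.
Local Notation K := R[i].

Fixpoint neval (e : nexpr K) : A :=
  match e with
  | NVar n => List.nth n env 0
  | NZero => 0
  | NOne => 1
  | NAdd a b => neval a + neval b
  | NOpp a => - neval a
  | NMul a b => neval a * neval b
  | NScale c a => c *: neval a
  end.

Definition weval (w : seq nat) : A :=
  List.fold_right (fun i x => List.nth i env 0 * x) 1 w.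

Definition meval (l : seq (K * seq nat)) : A :=
  List.fold_right (fun m x => m.1 *: weval m.2 + x) 0 l.

Fixpoint nnorm (e : nexpr K) : seq (K * seq nat) :=
  match e with
  | NVar n => [:: (1, [:: n])]
  | NZero => [::]
  | NOne => [:: (1, [::])]
  | NAdd a b => List.app (nnorm a) (nnorm b)
  | NOpp a => List.map (fun m => (- m.1, m.2)) (nnorm a)
  | NMul a b =>
      List.flat_map (fun m => List.map (fun p => (m.1 * p.1, List.app m.2 p.2)) (nnorm b))
        (nnorm a)
  | NScale c a => List.map (fun m => (c * m.1, m.2)) (nnorm a)
  end.

Fixpoint mcollect1 (c : K) (w : seq nat) (l : seq (K * seq nat)) :=
  match l with
  | [::] => [:: (c, w)]
  | m :: l' => if word_eqb w m.2 then (c + m.1, w) :: l' else m :: mcollect1 c w l'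
  end.

(** Words are brought to canonical form before like ones are merged: [word_id] gives the procedure
    for free variables, [word_sort] the one for commuting variables. *)
Definition mcollect (l : seq (K * seq nat)) :=
  List.fold_right (fun m l' => mcollect1 m.1 (canon m.2) l') [::] l.

Fixpoint mzero (l : seq (K * seq nat)) : Prop :=
  match l with
  | [::] => True
  | [:: m] => m.1 = 0
  | m :: l' => m.1 = 0 /\ mzero l'
  end.

Hypothesis canonE : forall w, weval (canon w) = weval w.

Lemma word_eqbP v w : word_eqb v w -> v = w.
Proof.
elim: v w => [|i v IH] [|j w] //=.
by case E : (Nat.eqb i j) => // /IH ->; rewrite (PeanoNat.Nat.eqb_eq i j).1.
Qed.

Lemma meval_cat l1 l2 : meval (List.app l1 l2) = meval l1 + meval l2.
Proof. by elim: l1 => [|m l1 IH] /=; rewrite ?add0r // IH addrA. Qed.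

Lemma weval_cat v w : weval (List.app v w) = weval v * weval w.
Proof. by elim: v => [|i v IH] /=; rewrite ?mul1r // IH mulrA. Qed.

Lemma nnormE e : neval e = meval (nnorm e).
Proof.
elim: e => /= [n|||a -> b ->|a ->|a -> b ->|c a ->].
- by rewrite mulr1 scale1r addr0.
- by [].
- by rewrite scale1r addr0.
- by rewrite meval_cat.
- elim: (nnorm a) => [|m l IH] /=; first by rewrite oppr0.
  by rewrite opprD IH scaleNr.
- elim: (nnorm a) => [|m l IH] /=; first by rewrite mul0r.
  rewrite meval_cat mulrDl IH; congr (_ + _).
  elim: (nnorm b) => [|p l' IH'] /=; first by rewrite mulr0.
  by rewrite mulrDr IH' weval_cat scalerMl scalerMr scalerA.
- elim: (nnorm a) => [|m l IH] /=; first by rewrite scaler0.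
  by rewrite scalerDr IH scalerA.
Qed.

Lemma mcollectE l : meval (mcollect l) = meval l.
Proof.
have E1 c w l' : meval (mcollect1 c w l') = c *: weval w + meval l'.
  elim: l' => //= m l' IH.
  case E: (word_eqb w m.2) => /=; last by rewrite IH addrCA.
  by rewrite -(word_eqbP E) scalerDl addrA.
by elim: l => //= m l IH; rewrite E1 IH canonE.
Qed.

Lemma mzeroE l : mzero l -> meval l = 0.
Proof.
elim: l => //= m [|m' l] IH; first by move=> ->; rewrite scale0r addr0.
by move=> [-> /IH ->]; rewrite scale0r add0r.
Qed.

Lemma neval_eq e1 e2 :
  mzero (mcollect (nnorm (NAdd e1 (NOpp e2)))) -> neval e1 = neval e2.
Proof.
move=> /mzeroE; rewrite mcollectE -nnormE /= => /eqP.
by rewrite subr_eq0 => /eqP.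
Qed.

End Normalise.

Section Commute.
Variables (R : realType) (A : cstarAlgType R).
Implicit Types (x y : A) (env : seq A).

Fixpoint all_comm x env : Prop :=
  if env is y :: env' then x * y = y * x /\ all_comm x env' else True.

Fixpoint pairwise_comm env : Prop :=
  if env is x :: env' then all_comm x env' /\ pairwise_comm env' else True.

Lemma all_comm_nth x env j : all_comm x env -> GRing.comm x (List.nth j env 0).
Proof.
elim: env j => [|y env IH] [|j] //=; rewrite /GRing.comm ?mulr0 ?mul0r //.
  by case.
by move=> [_ xe]; exact: IH.
Qed.

Lemma pairwise_comm_nth env i j : pairwise_comm env ->
  GRing.comm (List.nth i env 0) (List.nth j env 0).
Proof.
elim: env i j => [|x env IH] [|i] [|j] //= [xe ee].
- exact: all_comm_nth.
- by apply: commr_sym; exact: all_comm_nth.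
- exact: IH.
Qed.

Lemma word_sortE env w :
  pairwise_comm env -> weval env (word_sort w) = weval env w.
Proof.
move=> H.
have E1 i v : weval env (word_insert i v) = List.nth i env 0 * weval env v.
  elim: v => //= j v IH; case: (Nat.leb i j) => //=.
  by rewrite IH !mulrA; congr (_ * _); exact: pairwise_comm_nth.
by elim: w => //= i w IH; rewrite E1 IH.
Qed.

Lemma neval_eq_nc env e1 e2 :
  mzero (mcollect word_id (nnorm (NAdd e1 (NOpp e2)))) ->
  neval env e1 = neval env e2.
Proof. exact: neval_eq. Qed.

Lemma neval_eq_comm env e1 e2 :
  pairwise_comm env ->
  mzero (mcollect word_sort (nnorm (NAdd e1 (NOpp e2)))) ->
  neval env e1 = neval env e2.
Proof. by move=> H; apply: neval_eq => w; exact: word_sortE. Qed.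

End Commute.

Ltac nc_find x l :=
  lazymatch l with
  | cons x _ => constr:(O)
  | cons _ ?l' => let n := nc_find x l' in constr:(S n)
  end.

Ltac nc_vars t l :=
  lazymatch t with
  | @GRing.add _ ?a ?b => let l1 := nc_vars a l in nc_vars b l1
  | @GRing.mul _ ?a ?b => let l1 := nc_vars a l in nc_vars b l1
  | @GRing.opp _ ?a => nc_vars a l
  | @GRing.scale _ _ _ ?a => nc_vars a l
  | @GRing.natmul _ ?a _ => nc_vars a l
  | @GRing.zero _ => l
  | @GRing.one _ => l
  | _ => match l with
         | context [cons t _] => l
         | _ => constr:(cons t l)
         end
  end.

Ltac nc_quote K t l :=
  lazymatch t with
  | @GRing.add _ ?a ?b =>
      let a' := nc_quote K a l in let b' := nc_quote K b l in constr:(NAdd a' b')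
  | @GRing.mul _ ?a ?b =>
      let a' := nc_quote K a l in let b' := nc_quote K b l in constr:(NMul a' b')
  | @GRing.opp _ ?a => let a' := nc_quote K a l in constr:(NOpp a')
  | @GRing.scale _ _ ?c ?a => let a' := nc_quote K a l in constr:(NScale c a')
  | @GRing.natmul _ ?a ?n =>
      let a' := nc_quote K a l in constr:(NScale (n%:R : K) a')
  | @GRing.zero _ => constr:(@NZero K)
  | @GRing.one _ => constr:(@NOne K)
  | _ => let n := nc_find t l in constr:(@NVar K n)
  end.

Ltac nc_reify tac :=
  lazymatch goal with
  | |- @eq ?T ?x ?y =>
    let r := open_constr:(_ : realType) in
    let B := open_constr:(_ : cstarAlgType r) in
    unify T (@CStarAlgebra.sort r B);
    let K := constr:((complex r) : Type) in
    let l := nc_vars x (@nil (@CStarAlgebra.sort r B)) in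
    let l := nc_vars y l in
    let ex := nc_quote K x l in
    let ey := nc_quote K y l in
    transitivity (@neval r B l ex);
    [rewrite /= ?scaler_nat; reflexivity|];
    transitivity (@neval r B l ey);
    [tac|rewrite /= ?scaler_nat; reflexivity]
  end.

Ltac nc_compute :=
  cbv [mzero mcollect mcollect1 nnorm word_id word_sort word_insert word_eqb
       Nat.eqb Nat.leb List.app List.map List.flat_map List.fold_right fst snd].

Ltac nc_coef :=
  repeat split;
  first
    [ done
    | ring
    | apply/eqP; rewrite eq_complex /=; apply/andP; split; apply/eqP;
      first [done | ring | by field | field => //] ].

Ltac nc_comm :=
  cbv [pairwise_comm all_comm]; repeat split;
  first [done | by symmetry | by auto | by symmetry; auto].

Tactic Notation "nc" := nc_reify ltac:(apply: neval_eq_nc; nc_compute); try nc_coef.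
Tactic Notation "cnc" :=
  nc_reify ltac:(apply: neval_eq_comm; [nc_comm|nc_compute]); try nc_coef.

(** * Norm identities for self-adjoint elements *)

Section SelfAdjoint.
Variables (R : realType) (A : cstarAlgType R).
Implicit Types (x y z w k p q u : A) (s t : R).

Lemma Re_normc_real t : complex.Re `|t%:C : R[i]| = `|t|.
Proof.
case: (leP 0 t) => t0; first by rewrite !ger0_norm // ler0c.
by rewrite !ltr0_norm // ?ltcR // -rmorphN.
Qed.

Lemma rnormZr (V : normedModType R[i]) t (x : V) :
  rnorm (t%:C *: x) = `|t| * rnorm x.
Proof. by rewrite rnormZ Re_normc_real. Qed.

Lemma rnorm_eq0 (V : normedModType R[i]) (x : V) : rnorm x = 0 -> x = 0.
Proof. by move=> x0; apply/eqP; rewrite -normr_eq0 normE x0. Qed.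

Lemma rnorm_small_eq0 (V : normedModType R[i]) (x : V) :
  (forall e : R, 0 < e -> rnorm x <= e) -> x = 0.
Proof.
move=> H; apply: rnorm_eq0; apply/eqP; rewrite eq_le rnorm_ge0 andbT.
by apply/ler_addgt0Pr => e e0; rewrite add0r H.
Qed.

Lemma starZr t x : star (t%:C *: x) = t%:C *: star x.
Proof. by rewrite starZ; congr (_ *: _); exact: conjc_real. Qed.

Lemma rnorm_sqr_sa x : star x = x -> rnorm (x * x) = rnorm x ^+ 2.
Proof. by move=> sx; rewrite -{1}sx rnorm_star_mul. Qed.

Lemma sqr_eq0_sa x : star x = x -> x * x = 0 -> x = 0.
Proof.
move=> sx x0; apply: rnorm_eq0; apply/eqP; rewrite -sqrf_eq0.
by rewrite -rnorm_sqr_sa // x0 rnorm0.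
Qed.

Lemma star_mul_eq0 x : star x * x = 0 -> x = 0.
Proof.
move=> x0; apply: rnorm_eq0; apply/eqP; rewrite -sqrf_eq0.
by rewrite -rnorm_star_mul x0 rnorm0.
Qed.

(** The element [u = p + 'i q] is normal with [star u * u = p^2 + q^2], and its real part [p] has
    norm at most that of [u]. This stands in for the monotonicity of the norm on positive elements
    before any order is available. *)
Lemma sqr_add_norm p q : star p = p -> star q = q -> p * q = q * p ->
  rnorm p ^+ 2 <= rnorm (p * p + q * q).
Proof.
move=> sp sq pq; pose u : A := p + 'i *: q.
have su : star u = p - 'i *: q.
  by rewrite /u starD sp starZ sq -scaleNr; congr (_ + _ *: _); simpc.
have uu : star u * u = p * p + q * q by rewrite su /u; cnc.
rewrite -uu rnorm_star_mul ler_pXn2r ?nnegrE ?rnorm_ge0 //.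
have pE : (2%:R%:C : R[i]) *: p = u + star u.
  by rewrite su /u addrACA subrr addr0 rmorph_nat scaler_nat.
have := rnormD u (star u); rewrite -pE rnorm_star rnormZr ger0_norm //.
lra.
Qed.

End SelfAdjoint.

(** * Limits of sequences in norm *)

Section SequenceLimits.
Variables (R : realType) (V : normedModType R[i]).
Implicit Types (u v : nat -> V) (l m : V).

Definition rcvg u l := forall e : R, 0 < e ->
  exists N, forall n, (N <= n)%N -> rnorm (l - u n) <= e.

Lemma rcvg_dominated u l v m (C : R) :
  rcvg u l -> (forall n, rnorm (m - v n) <= C * rnorm (l - u n)) -> rcvg v m.
Proof.
move=> ul H e e0; have C1 : 0 < `|C| + 1 by rewrite ltr_wpDl.
have [N HN] := ul (e / (`|C| + 1)) (divr_gt0 e0 C1); exists N => n Nn.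
rewrite (le_trans (H n)) // (le_trans (ler_wpM2r (rnorm_ge0 _) (ler_norm C))) //.
have := HN n Nn; rewrite ler_pdivlMr // => /(le_trans _); apply.
by rewrite mulrC ler_wpM2l ?rnorm_ge0 // lerDl.
Qed.

Lemma rcvg_cst l : rcvg (fun=> l) l.
Proof. by move=> e e0; exists 0%N => n _; rewrite subrr rnorm0 ltW. Qed.

Lemma rcvgD u l v m : rcvg u l -> rcvg v m -> rcvg (fun n => u n + v n) (l + m).
Proof.
move=> ul vm e e0; have e2 : 0 < e / 2 by rewrite divr_gt0.
have [N1 H1] := ul _ e2; have [N2 H2] := vm _ e2.
exists (maxn N1 N2) => n; rewrite geq_max => /andP[n1 n2].
rewrite opprD addrACA (le_trans (rnormD _ _)) //.
by have := H1 _ n1; have := H2 _ n2; lra.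
Qed.

Lemma rcvgZ (c : R[i]) u l : rcvg u l -> rcvg (fun n => c *: u n) (c *: l).
Proof.
move=> ul; apply: (rcvg_dominated (C := complex.Re `|c|) ul) => n.
by rewrite -scalerBr rnormZ.
Qed.

Lemma rcvg_uniq u l m : rcvg u l -> rcvg u m -> l = m.
Proof.
move=> ul um; apply/eqP; rewrite -subr_eq0; apply/eqP.
apply: rnorm_small_eq0 => e e0; have e2 : 0 < e / 2 by rewrite divr_gt0.
have [N1 H1] := ul _ e2; have [N2 H2] := um _ e2.
have := H1 (maxn N1 N2) (leq_maxl _ _); have := H2 (maxn N1 N2) (leq_maxr _ _).
rewrite (rnormB m) => h2 h1.
rewrite -(subrKA (u (maxn N1 N2))) (le_trans (rnormD _ _)) //; lra.
Qed.

Lemma rcvg_shift u l : rcvg u l -> rcvg (fun n => u n.+1) l.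
Proof.
by move=> ul e /ul[N H]; exists N => n Nn; apply: H; exact: leqW.
Qed.

Lemma rcvg_norm_le u l (c : R) : rcvg u l -> (forall n, rnorm (u n) <= c) ->
  rnorm l <= c.
Proof.
move=> ul uc; apply/ler_addgt0Pr => e /ul[N H].
have := H N (leqnn N); have := uc N; have := rnormD (l - u N) (u N).
rewrite subrK; lra.
Qed.

Lemma rcvg_closed (S : set V) u l : closed S -> rcvg u l -> (forall n, S (u n)) -> S l.
Proof.
move=> cS ul uS; apply: (closedP_rnorm cS) => e /ul[N H].
by exists (u N) => //; exact: H.
Qed.

End SequenceLimits.

Section AlgebraLimits.
Variables (R : realType) (A : cstarAlgType R).
Implicit Types (u v : nat -> A) (l m w : A).

Lemma rcvgMl w u l : rcvg u l -> rcvg (fun n => w * u n) (w * l).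
Proof.
by move=> ul; apply: (rcvg_dominated (C := rnorm w) ul) => n; rewrite -mulrBr rnormM.
Qed.

Lemma rcvgMr w u l : rcvg u l -> rcvg (fun n => u n * w) (l * w).
Proof.
move=> ul; apply: (rcvg_dominated (C := rnorm w) ul) => n.
by rewrite -mulrBl mulrC rnormM.
Qed.

Lemma rcvg_star u l : rcvg u l -> rcvg (fun n => star (u n)) (star l).
Proof.
move=> ul; apply: (rcvg_dominated (C := 1) ul) => n.
by rewrite -starB rnorm_star mul1r.
Qed.

Lemma rcvg_sqr u l (c : R) : rcvg u l -> (forall n, rnorm (u n) <= c) ->
  rcvg (fun n => u n * u n) (l * l).
Proof.
move=> ul uc; apply: (rcvg_dominated (C := rnorm l + c) ul) => n.
have -> : l * l - u n * u n = l * (l - u n) + (l - u n) * u n by nc.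
rewrite [leRHS]mulrDl (le_trans (rnormD _ _)) // lerD // ?rnormM //.
by rewrite (le_trans (rnormM _ _)) // mulrC ler_wpM2r ?rnorm_ge0.
Qed.

End AlgebraLimits.

(** * Positive elements and square roots *)

Section SquareRoot.
Variables (R : realType) (A : cstarAlgType R).
Implicit Types (x y z w : A) (t : R).
Local Notation h := ((2^-1 : R)%:C).

(* The iteration [y' = (1 - x + y^2) / 2] has the fixed point [y] with
   [(1 - y)^2 = x]; it is dominated by the scalar iteration with [1 - x] replaced
   by [1], which increases to [1]. *)
Fixpoint sqrt_iter x n : A :=
  if n is m.+1 then h *: ((1 - x) + sqrt_iter x m * sqrt_iter x m) else 0.

Fixpoint sqrt_maj n : R := if n is m.+1 then (1 + sqrt_maj m ^+ 2) / 2 else 0.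

Lemma sqrt_maj_itv n : 0 <= sqrt_maj n <= 1.
Proof.
elim: n => [|n /andP[h0 h1]] /=; first by rewrite lexx ler01.
by apply/andP; split; nra.
Qed.

Lemma sqrt_iter_le x n : rnorm (1 - x) <= 1 -> rnorm (sqrt_iter x n) <= sqrt_maj n.
Proof.
move=> x1; elim: n => [|n IH] /=; first by rewrite rnorm0.
rewrite rnormZr ger0_norm ?invr_ge0 // [leRHS]mulrC ler_wpM2l ?invr_ge0 //.
rewrite (le_trans (rnormD _ _)) // lerD // (le_trans (rnormM _ _)) // expr2.
by rewrite ler_pM ?rnorm_ge0.
Qed.

(** All iterates are polynomials in [x], so they commute and the difference of two steps factors as
    [(y' - y) (y' + y) / 2]; the scalar majorant factors in the same way. *)
Lemma sqrt_iter_step x n : rnorm (1 - x) <= 1 ->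
  rnorm (sqrt_iter x n.+1 - sqrt_iter x n) <= sqrt_maj n.+1 - sqrt_maj n.
Proof.
move=> x1; have cm m : sqrt_iter x m * (1 - x) = (1 - x) * sqrt_iter x m.
  elim: m => [|m IH] /=; first by rewrite mul0r mulr0.
  by move: (1 - x) (sqrt_iter x m) IH => a b ab; cnc.
have cmm m : sqrt_iter x m.+1 * sqrt_iter x m = sqrt_iter x m * sqrt_iter x m.+1.
  by rewrite /=; move: (1 - x) (sqrt_iter x m) (cm m) => a b ab; cnc.
elim: n => [|n IH].
  by rewrite /= mul0r addr0 subr0 rnormZr ger0_norm ?invr_ge0 // expr0n /=; lra.
have -> : sqrt_iter x n.+2 - sqrt_iter x n.+1 =
    h *: ((sqrt_iter x n.+1 - sqrt_iter x n) * (sqrt_iter x n.+1 + sqrt_iter x n)).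
  transitivity (h *: ((1 - x) + sqrt_iter x n.+1 * sqrt_iter x n.+1)
                - h *: ((1 - x) + sqrt_iter x n * sqrt_iter x n)) => //.
  move: (sqrt_iter x n.+1) (sqrt_iter x n) (1 - x) (cmm n) (cm n.+1) (cm n) => a b c ab ac bc.
  by cnc.
rewrite rnormZr ger0_norm ?invr_ge0 // (le_trans (ler_wpM2l _ (rnormM _ _))) ?invr_ge0 //.
have -> : sqrt_maj n.+2 - sqrt_maj n.+1 =
    2^-1 * ((sqrt_maj n.+1 - sqrt_maj n) * (sqrt_maj n.+1 + sqrt_maj n)).
  transitivity ((1 + sqrt_maj n.+1 ^+ 2) / 2 - (1 + sqrt_maj n ^+ 2) / 2) => //.
  by field.
rewrite ler_wpM2l ?invr_ge0 // ler_pM ?rnorm_ge0 //.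
by rewrite (le_trans (rnormD _ _)) // lerD ?sqrt_iter_le.
Qed.

(** The steps telescope against the majorant, which is increasing and bounded by [1]; a term near
    its supremum gives the Cauchy index. The majorant approaches [1] more slowly than any geometric
    sequence, so [rnorm_geo_cvg] would not apply. *)
Lemma sqrt_iter_cvg x : rnorm (1 - x) <= 1 -> exists l, rcvg (sqrt_iter x) l.
Proof.
move=> x1; apply: rnorm_cauchy_cvg => e e0.
have bnd n k : rnorm (sqrt_iter x (n + k) - sqrt_iter x n) <= sqrt_maj (n + k) - sqrt_maj n.
  elim: k => [|k IH]; first by rewrite addn0 !subrr rnorm0.
  rewrite addnS -(subrKA (sqrt_iter x (n + k))) (le_trans (rnormD _ _)) //.
  by have := sqrt_iter_step (n + k) x1; lra.
pose S := [set sqrt_maj n | n in setT].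
have hS : has_sup S.
  split; first by exists (sqrt_maj 0); exists 0%N.
  by exists 1 => _ [n _ <-]; case/andP: (sqrt_maj_itv n).
have [_ [N _ <-] HN] := sup_adherent e0 hS.
exists N => n Nn; rewrite -(subnKC Nn) (le_trans (bnd _ _)) //.
have : sqrt_maj (N + (n - N)) <= sup S by apply: ub_le_sup; [case: hS|exists (N + (n - N))%N].
lra.
Qed.

Definition unit_sqrt x : A := xget 0 [set y | rcvg (fun n => 1 - sqrt_iter x n) y].

Lemma unit_sqrt_cvg x : rnorm (1 - x) <= 1 ->
  rcvg (fun n => 1 - sqrt_iter x n) (unit_sqrt x).
Proof.
move=> x1; rewrite /unit_sqrt; case: xgetP => // H.
have [l Hl] := sqrt_iter_cvg x1; exfalso; apply: (H (1 - l)).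
by rewrite -scaleN1r; apply: rcvgD; [exact: rcvg_cst|]; under eq_fun do rewrite -scaleN1r; exact: rcvgZ.
Qed.

Lemma unit_sqrt_sqr x : rnorm (1 - x) <= 1 -> unit_sqrt x * unit_sqrt x = x.
Proof.
move=> x1; have ul := unit_sqrt_cvg x1.
have uc n : rnorm (1 - sqrt_iter x n) <= 2.
  rewrite (le_trans (rnormD _ _)) // rnormN.
  have := sqrt_iter_le n x1; case/andP: (sqrt_maj_itv n) => _.
  by have := rnorm1_le1 A; lra.
(* For [z = 1 - sqrt_iter x n] the recurrence reads [z' = z + (x - z^2) / 2], so its limit squares
   to [x]. *)
have H := rcvg_uniq (rcvg_shift ul) _.
have := rcvgD (rcvg_cst (h *: x)) (rcvgD ul (rcvgZ (- h) (rcvg_sqr ul uc))).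
under eq_fun => n.
  have -> : h *: x + (1 - sqrt_iter x n +
     - h *: ((1 - sqrt_iter x n) * (1 - sqrt_iter x n))) = 1 - sqrt_iter x n.+1.
    by rewrite /=; move: (sqrt_iter x n) => y; nc.
  over.
move/H => E.
apply/eqP; rewrite eq_sym -subr_eq0; apply/eqP.
move: (unit_sqrt x) E => y E.
transitivity (2%:R%:C *: (h *: x + (y + - h *: (y * y)) - y)); first by nc.
by rewrite -E subrr scaler0.
Qed.

(** Each iterate is the same polynomial in [x1] and in [x2], and intertwining survives the limit.
    Taking [x1 = x2] gives commutation; two different elements occur in the proof that [star x * x]
    is positive. *)
Lemma unit_sqrt_intertwine x1 x2 w : rnorm (1 - x1) <= 1 -> rnorm (1 - x2) <= 1 ->
  w * x1 = x2 * w -> w * unit_sqrt x1 = unit_sqrt x2 * w.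
Proof.
move=> h1 h2 wx.
have iw n : w * sqrt_iter x1 n = sqrt_iter x2 n * w.
  elim: n => [|n IH] /=; first by rewrite mulr0 mul0r.
  rewrite scalerMr scalerMl; congr (_ *: _); rewrite mulrDr mulrDl.
  by congr (_ + _); [rewrite mulrBr mulrBl mulr1 mul1r wx|rewrite mulrA IH -mulrA IH mulrA].
apply: (rcvg_uniq (rcvgMl w (unit_sqrt_cvg h1))).
have := rcvgMr w (unit_sqrt_cvg h2).
by under eq_fun do rewrite mulrBl mul1r -iw -{1}[w]mulr1 -mulrBr.
Qed.

Lemma unit_sqrt_sa x : star x = x -> rnorm (1 - x) <= 1 ->
  star (unit_sqrt x) = unit_sqrt x.
Proof.
move=> sx x1.
have si n : star (sqrt_iter x n) = sqrt_iter x n.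
  elim: n => [|n IH] /=; first exact: star0.
  by rewrite starZr starD starB star1 sx starM IH.
apply: (rcvg_uniq _ (unit_sqrt_cvg x1)).
by have := rcvg_star (unit_sqrt_cvg x1); under eq_fun do rewrite starB star1 si.
Qed.

Lemma unit_sqrt_le x : rnorm (1 - x) <= 1 -> rnorm (1 - unit_sqrt x) <= 1.
Proof.
move=> x1; have := rcvgD (rcvg_cst (1 : A)) (rcvgZ (-1) (unit_sqrt_cvg x1)).
rewrite scaleN1r => ul; apply: (rcvg_norm_le ul) => n.
rewrite scaleN1r opprB addrCA subrr addr0 (le_trans (sqrt_iter_le n x1)) //.
by case/andP: (sqrt_maj_itv n).
Qed.

End SquareRoot.

Section Positive.
Variables (R : realType) (A : cstarAlgType R).
Implicit Types (x y z w k p q s d : A) (t c : R).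

(* For self-adjoint [x] this says that the spectrum of [x] is nonnegative. *)
Definition pos x := star x = x /\ exists t, rnorm (t%:C *: (1 : A) - x) <= t.

Lemma pos_sa x : pos x -> star x = x.
Proof. by case. Qed.

(** Enlarging [t] adds a nonnegative multiple of [1], of norm at most the increment. Hence two
    positive elements can be rescaled by one common [t]. *)
Lemma pos_large x : pos x ->
  exists2 t0, 0 < t0 & forall t, t0 <= t -> rnorm (t%:C *: (1 : A) - x) <= t.
Proof.
move=> [_ [t0 H]]; have t00 : 0 <= t0 by exact: le_trans (rnorm_ge0 _) H.
exists (t0 + 1) => [|t tt]; first by lra.
have -> : t%:C *: (1 : A) - x = (t - t0)%:C *: (1 : A) + (t0%:C *: (1 : A) - x) by nc.
rewrite (le_trans (rnormD _ _)) // rnormZr ger0_norm; last by lra.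
by have := rnorm1_le1 A; nra.
Qed.

Lemma pos_cst c : 0 <= c -> pos (c%:C *: (1 : A)).
Proof.
by move=> c0; split; [rewrite starZr star1|exists c; rewrite subrr rnorm0].
Qed.

Lemma posD x y : pos x -> pos y -> pos (x + y).
Proof.
move=> [sx [t tx]] [sy [t' ty]]; split; first by rewrite starD sx sy.
exists (t + t').
have -> : (t + t')%:C *: (1 : A) - (x + y) = (t%:C *: (1 : A) - x) + (t'%:C *: (1 : A) - y) by nc.
by rewrite (le_trans (rnormD _ _)) // lerD.
Qed.

Lemma posZ c x : 0 <= c -> pos x -> pos (c%:C *: x).
Proof.
move=> c0 [sx [t tx]]; split; first by rewrite starZr sx.
exists (c * t).
have -> : (c * t)%:C *: (1 : A) - c%:C *: x = c%:C *: (t%:C *: (1 : A) - x) by nc.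
by rewrite rnormZr ger0_norm // ler_wpM2l.
Qed.

Lemma pos0 : pos 0.
Proof. by have := pos_cst (lexx 0); rewrite scale0r. Qed.

Lemma pos_norm_add x : star x = x -> pos ((rnorm x)%:C *: (1 : A) + x).
Proof.
move=> sx; split; first by rewrite starD starZr star1 sx.
by exists (rnorm x); rewrite opprD addrA subrr add0r rnormN.
Qed.

Lemma pos_norm_sub x : star x = x -> pos ((rnorm x)%:C *: (1 : A) - x).
Proof.
by move=> sx; have := @pos_norm_add (- x); rewrite rnormN starN sx; apply.
Qed.

Lemma pos_sqrt_common x : pos x -> exists2 t0, 0 < t0 &
  forall t, t0 <= t -> rnorm (1 - (t^-1)%:C *: x) <= 1.
Proof.
move=> /pos_large[t0 t00 H]; exists t0 => // t tt.
have t1 : 0 < t by exact: lt_le_trans tt.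
have -> : 1 - (t^-1)%:C *: x = (t^-1)%:C *: (t%:C *: (1 : A) - x) by nc; rewrite gt_eqF.
by rewrite rnormZr ger0_norm ?invr_ge0 ?(ltW t1) // ler_pdivrMl // mulr1 H.
Qed.

(** The root [unit_sqrt] exists only near [1]. Both elements are divided by the same [t], so that
    [w] still intertwines them, and the roots are multiplied back by the root of [t]. *)
Lemma pos_sqrt_pair x1 x2 w : pos x1 -> pos x2 -> w * x1 = x2 * w ->
  exists s1 s2, [/\ s1 * s1 = x1, s2 * s2 = x2, w * s1 = s2 * w &
    forall z, (z * x1 = x1 * z -> z * s1 = s1 * z) /\
              (z * x2 = x2 * z -> z * s2 = s2 * z)] /\ pos s1 /\ pos s2.
Proof.
move=> p1 p2 wx.
have [t1 t10 H1] := pos_sqrt_common p1; have [t2 t20 H2] := pos_sqrt_common p2.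
pose t := Num.max t1 t2.
have t0 : 0 < t by rewrite lt_max t10.
have {}H1 : rnorm (1 - (t^-1)%:C *: x1) <= 1 by apply: H1; rewrite le_max lexx.
have {}H2 : rnorm (1 - (t^-1)%:C *: x2) <= 1 by apply: H2; rewrite le_max lexx orbT.
pose r x := (Num.sqrt t)%:C *: unit_sqrt ((t^-1)%:C *: x).
have rr x : rnorm (1 - (t^-1)%:C *: x) <= 1 -> r x * r x = x.
  move=> h; rewrite /r scalerMl scalerMr scalerA -rmorphM -expr2 sqr_sqrtr ?ltW //.
  by rewrite unit_sqrt_sqr // scalerA -rmorphM mulfV ?gt_eqF // scale1r.
have ri y x z : rnorm (1 - (t^-1)%:C *: x) <= 1 -> rnorm (1 - (t^-1)%:C *: y) <= 1 ->
    z * x = y * z -> z * r x = r y * z.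
  move=> h h' zx; rewrite /r scalerMl scalerMr (@unit_sqrt_intertwine _ _ _ ((t^-1)%:C *: y)) //.
  by rewrite scalerMl scalerMr zx.
have rp x : star x = x -> rnorm (1 - (t^-1)%:C *: x) <= 1 -> pos (r x).
  move=> sx h; apply: posZ; first exact: sqrtr_ge0.
  split; first by apply: unit_sqrt_sa => //; rewrite starZr sx.
  by exists 1; rewrite scale1r unit_sqrt_le.
exists (r x1), (r x2); split; last by split; apply: rp => //; exact: pos_sa.
by split; [exact: rr|exact: rr|exact: ri|split=> zx; exact: ri].
Qed.

Lemma pos_sqrt_ex x : pos x -> exists s,
  [/\ pos s, s * s = x & forall z, z * x = x * z -> z * s = s * z].
Proof.
(* A single root is the pair for [x] and [x], intertwined by [0]. *)
move=> px; have zx : 0 * x = x * 0 by rewrite mul0r mulr0.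
have [s [s' [[ss _ _ sz] [ps _]]]] := pos_sqrt_pair px px zx.
by exists s; split=> // z; have [] := sz z.
Qed.

(** After scaling to norm at most [1], the element [1 - y^2] has a root [s] commuting with [y]. From
    [s^2 + y^2 = 1] and [sqr_add_norm], [s] has norm at most [1], hence so has [s^2 = 1 - y^2],
    which is the condition for [y^2] with [t = 1]. *)
Lemma pos_sqr k : star k = k -> pos (k * k).
Proof.
move=> sk.
suff H y : star y = y -> rnorm y <= 1 -> pos (y * y).
  pose n := rnorm k + 1.
  have n0 : 0 < n by rewrite ltr_wpDl ?rnorm_ge0.
  have := H ((n^-1)%:C *: k); rewrite starZr sk rnormZr => /(_ erefl).
  rewrite ger0_norm ?invr_ge0 ?(ltW n0) // ler_pdivrMl // mulr1 => h.
  have := posZ (sqr_ge0 n) (h _); rewrite /n lerDl ler01 => /(_ erefl).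
  rewrite -/n (_ : _ *: _ = k * k) //.
  by nc; rewrite gt_eqF.
move=> sy y1; have syy : star (y * y) = y * y by rewrite starM sy.
have h1 : rnorm (1 - (1 - y * y)) <= 1.
  by rewrite subKr (le_trans (rnormM _ _)) // mulr_ile1 ?rnorm_ge0.
have sz : star (1 - y * y) = 1 - y * y by rewrite starB star1 syy.
have s2 := unit_sqrt_sqr h1; have ss := unit_sqrt_sa sz h1.
have sc := unit_sqrt_intertwine (w := y) h1 h1.
move: (unit_sqrt _) s2 ss sc => s s2 ss sc.
split=> //; exists 1; rewrite scale1r -s2 (le_trans (rnormM _ _)) //.
have : rnorm s ^+ 2 <= rnorm (s * s + y * y).
  by apply: sqr_add_norm => //; rewrite -sc // mulrBr mulrBl mulr1 mul1r mulrA.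
by rewrite s2 subrK => /le_trans; apply; exact: rnorm1_le1.
Qed.

Lemma pos_mul x y : pos x -> pos y -> x * y = y * x -> pos (x * y).
Proof.
move=> /pos_sqrt_ex[s [ps <- sc]] /pos_sqrt_ex[r [pr <- rc]] xy.
have sr : s * r = r * s by apply: rc; rewrite sc.
have -> : s * s * (r * r) = (s * r) * (s * r) by cnc.
by apply: pos_sqr; rewrite starM !pos_sa.
Qed.

Lemma pos_antisym x : pos x -> pos (- x) -> x = 0.
Proof.
move=> /pos_sqrt_ex[s [ps sx sc]] /pos_sqrt_ex[r [pr rx rc]].
have sr : s * r = r * s.
  by apply: rc; rewrite mulrN mulNr sc // -{1}sx -sx mulrA.
have := sqr_add_norm (pos_sa ps) (pos_sa pr) sr.
rewrite sx rx subrr rnorm0 => h; rewrite -sx.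
suff -> : s = 0 by rewrite mul0r.
apply: rnorm_eq0; apply/eqP; rewrite -sqrf_eq0 eq_le h.
by rewrite exprn_ge0 ?rnorm_ge0.
Qed.

(** For commuting roots and [g = s - d], the positive elements [g s g] and [g d g] have sum
    [g (s^2 - d^2) = 0], so both vanish by [pos_antisym]. Their difference is [g^3], whence
    [g^4 = 0] and [g = 0]. *)
Lemma pos_sqrt_uniq s d : pos s -> pos d -> s * s = d * d -> s = d.
Proof.
(* Two arbitrary roots need not be known to commute; each is compared with the root from
   [pos_sqrt_ex], which commutes with whatever commutes with its square. *)
wlog sc : s d / (forall z, z * (s * s) = s * s * z -> z * s = s * z).
  move=> H ps pd sd; have pss := pos_sqr (pos_sa ps).
  have [r [pr rs rc]] := pos_sqrt_ex pss.
  have rc' z : z * (r * r) = r * r * z -> z * r = r * z by rewrite rs; exact: rc.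
  have <- : r = s by apply: H.
  by apply: H; rewrite // rs.
move=> ps pd sd.
have ds : d * s = s * d by apply: sc; rewrite sd mulrA.
have [r [pr rs rc]] := pos_sqrt_ex ps; have [e [pe ed ec]] := pos_sqrt_ex pd.
set g := s - d.
have sg : star g = g by rewrite starB !pos_sa.
have gs : g * s = s * g by rewrite /g mulrBl mulrBr ds.
have gd : g * d = d * g by rewrite /g mulrBl mulrBr ds.
have gr := rc _ gs; have ge := ec _ gd.
have h0 : g * s * g + g * d * g = 0.
  have -> : g * s * g + g * d * g = g * (s * s - d * d) by rewrite /g; cnc.
  by rewrite sd subrr mulr0.
have p1 : pos (g * s * g).
  have -> : g * s * g = (g * r) * (g * r) by rewrite -rs; cnc.
  by apply: pos_sqr; rewrite starM sg gr pos_sa.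
have p2 : pos (g * d * g).
  have -> : g * d * g = (g * e) * (g * e) by rewrite -ed; cnc.
  by apply: pos_sqr; rewrite starM sg ge pos_sa.
have g1 : g * s * g = 0.
  by apply: pos_antisym => //; rewrite (_ : - _ = g * d * g) //; apply/eqP; rewrite eq_sym -addr_eq0 addrC h0.
have g2 : g * d * g = 0 by move: h0; rewrite g1 add0r.
have g3 : (g * g) * (g * g) = 0.
  have -> : (g * g) * (g * g) = (g * s * g - g * d * g) * g by rewrite {2}/g; cnc.
  by rewrite g1 g2 subrr mul0r.
apply/eqP; rewrite -subr_eq0; apply/eqP.
by apply: sqr_eq0_sa => //; apply: sqr_eq0_sa => //; rewrite starM sg.
Qed.

(** Chosen by its specification because the constructed root depends on a scale; uniqueness makes
    every construction agree with it. *)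
Definition csqrt x : A := xget 0 [set s | pos s /\ s * s = x].

Lemma csqrtP x : pos x -> pos (csqrt x) /\ csqrt x * csqrt x = x.
Proof.
move=> px; have [s [ps sx _]] := pos_sqrt_ex px.
by rewrite /csqrt; case: xgetP => [s' _ //|/(_ s)] h; case: h.
Qed.

Lemma csqrtE x s : pos s -> s * s = x -> csqrt x = s.
Proof.
move=> ps sx; have px : pos x by rewrite -sx; exact/pos_sqr/pos_sa.
by have [pc cx] := csqrtP px; apply: pos_sqrt_uniq; rewrite ?cx.
Qed.

Lemma csqrt_intertwine x1 x2 w : pos x1 -> pos x2 -> w * x1 = x2 * w ->
  w * csqrt x1 = csqrt x2 * w.
Proof.
move=> p1 p2 wx; have [s1 [s2 [[e1 e2 ws _] [q1 q2]]]] := pos_sqrt_pair p1 p2 wx.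
by rewrite (csqrtE q1 e1) (csqrtE q2 e2).
Qed.

Lemma csqrt_comm x z : pos x -> z * x = x * z -> z * csqrt x = csqrt x * z.
Proof. by move=> px; exact: csqrt_intertwine. Qed.

End Positive.

(** * Absolute values, positive and negative parts *)

Section PositiveParts.
Variables (R : realType) (A : cstarAlgType R).
Implicit Types (x y z w k p q s d : A) (t c : R).
Local Notation half := ((2^-1 : R)%:C).

Definition cabs k : A := csqrt (k * k).
Definition cpos k : A := half *: (cabs k + k).
Definition cneg k : A := half *: (cabs k - k).

Lemma cabs_pos k : star k = k -> pos (cabs k).
Proof. by move=> sk; have [] := csqrtP (pos_sqr sk). Qed.

Lemma cabs_sqr k : star k = k -> cabs k * cabs k = k * k.
Proof. by move=> sk; have [] := csqrtP (pos_sqr sk). Qed.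

Lemma cabs_comm k z : star k = k -> z * k = k * z -> z * cabs k = cabs k * z.
Proof.
move=> sk zk; apply: csqrt_comm; first exact: pos_sqr.
by rewrite mulrA zk -mulrA zk mulrA.
Qed.

Lemma cabsN k : cabs (- k) = cabs k.
Proof. by rewrite /cabs mulrNN. Qed.

Lemma cposN k : cpos (- k) = cneg k.
Proof. by rewrite /cpos cabsN. Qed.

Lemma cpos_sub_cneg k : cpos k - cneg k = k.
Proof. by rewrite /cpos /cneg; move: (cabs k) => m; nc. Qed.

Lemma cpos_add_cneg k : cpos k + cneg k = cabs k.
Proof. by rewrite /cpos /cneg; move: (cabs k) => m; nc. Qed.

Lemma cpos_sa k : star k = k -> star (cpos k) = cpos k.
Proof.
by move=> sk; rewrite /cpos starZr starD sk (pos_sa (cabs_pos sk)).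
Qed.

Lemma cpos_comm k z : star k = k -> z * k = k * z -> z * cpos k = cpos k * z.
Proof.
move=> sk zk; have := cabs_comm sk zk; rewrite /cpos.
by move: (cabs k) => m mz; rewrite scalerMr scalerMl mulrDl mulrDr mz zk.
Qed.

Lemma cpos_mul_cneg k : star k = k -> cpos k * cneg k = 0.
Proof.
move=> sk; have := cabs_sqr sk; have := cabs_comm sk (erefl (k * k)).
rewrite /cpos /cneg; move: (cabs k) => m km mm.
transitivity ((half * half) *: (m * m - k * k)); first by cnc.
by rewrite mm subrr scaler0.
Qed.

(** Let [P] and [Q] be the absolute values of the two parts [p] and [q]. As [p q = 0], the positive
    elements [P + Q] and [m = p + q] have the same square, so they are equal. Multiplying by [p]
    gives [p P = p^2], hence [(p - P)^2 = 0] and [p] is its own absolute value. *)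
Lemma cpos_pos k : star k = k -> pos (cpos k).
Proof.
move=> sk; set p := cpos k; set q := cneg k; set m := cabs k.
have sp : star p = p by exact: cpos_sa.
have sq : star q = q by rewrite /q -cposN cpos_sa // starN sk.
have pq : p * q = 0 by exact: cpos_mul_cneg.
have qp : q * p = 0 by rewrite -[RHS]star0 -pq starM sp sq.
have pq' : p * q = q * p by rewrite pq qp.
have pE : p + q = m by exact: cpos_add_cneg.
have pp := cabs_pos sp; have pp2 := cabs_sqr sp; have pc := cabs_comm sp.
have qq := cabs_pos sq; have qq2 := cabs_sqr sq; have qc := cabs_comm sq.
move: (cabs p) pp pp2 pc (cabs q) qq qq2 qc => P pP PP Pc Q pQ QQ Qc.
have Pp : p * P = P * p by exact: Pc.
have Pq : q * P = P * q by exact: Pc.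
have Qp : p * Q = Q * p by exact: Qc.
have Qq : q * Q = Q * q by exact: Qc.
have PQ : P * Q = Q * P by apply: Qc.
have PQ0 : P * Q = 0.
  apply: sqr_eq0_sa; first by rewrite starM !pos_sa.
  have -> : P * Q * (P * Q) = (P * P) * (Q * Q) by cnc.
  have -> : (P * P) * (Q * Q) = (p * q) * (p * q) by rewrite PP QQ; cnc.
  by rewrite pq mul0r.
have pQ0 : p * Q = 0.
  apply: sqr_eq0_sa; first by rewrite starM sp pos_sa.
  have -> : p * Q * (p * Q) = (p * p) * (Q * Q) by cnc.
  have -> : (p * p) * (Q * Q) = (p * q) * (p * q) by rewrite QQ; cnc.
  by rewrite pq mul0r.
have PQm : P + Q = m.
  apply: pos_sqrt_uniq; [exact: posD|exact: cabs_pos|].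
  rewrite -pE; have -> : (P + Q) * (P + Q) = P * P + Q * Q + 2%:R%:C *: (P * Q) by cnc.
  have -> : (p + q) * (p + q) = p * p + q * q + 2%:R%:C *: (p * q) by cnc.
  by rewrite PQ0 pq PP QQ.
have pP2 : p * P = p * p.
  have : p * (P + Q) = p * (p + q) by rewrite PQm pE.
  by rewrite !mulrDr pQ0 pq !addr0.
suff -> : p = P by [].
apply/eqP; rewrite -subr_eq0; apply/eqP; apply: sqr_eq0_sa.
  by rewrite starB sp pos_sa.
transitivity (p * p - 2%:R%:C *: (p * P) + P * P); first by cnc.
by rewrite PP pP2; nc.
Qed.

Lemma cneg_pos k : star k = k -> pos (cneg k).
Proof. by move=> sk; rewrite -cposN; apply: cpos_pos; rewrite starN sk. Qed.

Lemma cneg_comm k z : star k = k -> z * k = k * z -> z * cneg k = cneg k * z.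
Proof.
by move=> sk zk; rewrite -cposN cpos_comm ?starN ?sk // mulrN mulNr zk.
Qed.

Lemma cneg_mul k : star k = k -> cneg k * k = - (cneg k * cneg k).
Proof.
move=> sk; have pn := cpos_mul_cneg sk.
have np : cneg k * cpos k = 0.
  by rewrite -[RHS]star0 -pn starM (pos_sa (cpos_pos sk)) (pos_sa (cneg_pos sk)).
by rewrite -{2}[k]cpos_sub_cneg mulrBr np sub0r.
Qed.

(* Kelley and Vaught: with [b] the negative part of [x^* x] and [y = x b], both
   [-y^* y = b^3] and [y y^*] are positive, and [y^*] intertwines [y y^*] with
   [-b^3]; passing to the square roots of the squares kills the sign. *)
Lemma pos_star_mul x : pos (star x * x).
Proof.
set e := star x * x; have se : star e = e by rewrite starM starK.
set b := cneg e; have pb : pos b by exact: cneg_pos.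
have sb := pos_sa pb.
suff b0 : b = 0 by rewrite -[e]cpos_sub_cneg -/b b0 subr0; exact: cpos_pos.
set y := x * b; set c := b * b * b.
have yy : star y * y = - c.
  rewrite /y starM sb -mulrA (mulrA (star x)) -/e mulrA cneg_mul // -/b.
  by rewrite mulNr.
have pc : pos c by apply: pos_mul => //; [exact: pos_sqr|rewrite mulrA].
(* Here [y = u + 'i v], and [y * star y + star y * y = 2 (u^2 + v^2)]; this exhibits [y * star y] as
   a sum of positive elements. *)
pose u := half *: (y + star y); pose v := (half * 'i) *: (star y - y).
have su : star u = u by rewrite /u starZr starD starK addrC.
have sv : star v = v.
  rewrite /v starZ starB starK -[y - _]opprB scalerN -scaleNr; congr (_ *: _).
  by apply/eqP; rewrite eq_complex /=; apply/andP; split; apply/eqP; ring.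
have yE : y * star y = 2%:R%:C *: (u * u + v * v) + c.
  transitivity (2%:R%:C *: (u * u + v * v) - star y * y); last by rewrite yy opprK.
  by rewrite /u /v; move: (star y) => ys; nc.
have pd : pos (y * star y).
  by rewrite yE; apply: posD => //; apply: posZ => //; apply: posD; exact: pos_sqr.
have sd := pos_sa pd; have sc := pos_sa pc.
have yd : star y * (y * star y) = - (c * star y) by rewrite mulrA yy mulNr.
have : star y * csqrt ((y * star y) * (y * star y)) = csqrt (c * c) * star y.
  apply: csqrt_intertwine; [exact: pos_sqr|exact: pos_sqr|].
  by rewrite (mulrA (star y) (y * star y)) yd mulNr -(mulrA c (star y)) yd mulrN opprK mulrA.
rewrite (csqrtE pd erefl) (csqrtE pc erefl) yd => /eqP.
rewrite eq_sym -subr_eq0 opprK -mulr2n -scaler_nat scaler_eq0 pnatr_eq0 /= => /eqP cy.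
have c0 : c = 0.
  by apply: sqr_eq0_sa => //; rewrite -{2}[c]opprK -yy mulrN mulrA cy mul0r oppr0.
apply: sqr_eq0_sa => //; apply: sqr_eq0_sa; first by rewrite starM sb.
by rewrite mulrA -/c c0 mul0r.
Qed.

(** With [g] the root of [(t - w) (t + w)] one has [w^2 + g^2 = t^2], and [sqr_add_norm] bounds
    [w]. *)
Lemma pos_norm_le w t : 0 <= t -> pos (t%:C *: (1 : A) - w) -> pos (t%:C *: (1 : A) + w) ->
  rnorm w <= t.
Proof.
move=> t0 p1 p2.
have sw : star w = w.
  by have := pos_sa p2; rewrite starD starZr star1 => /addrI.
have [g [pg gg gc]] : exists g, [/\ pos g, g * g = (t%:C *: (1 : A) - w) * (t%:C *: (1 : A) + w) &
    forall z, z * w = w * z -> z * g = g * z].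
  have [|g [pg gg gc]] := pos_sqrt_ex (pos_mul p1 p2 _); first by nc.
  by exists g; split=> // z zw; apply: gc; cnc.
have := sqr_add_norm sw (pos_sa pg) (gc w erefl).
have -> : w * w + g * g = (t ^+ 2)%:C *: (1 : A) by rewrite gg; nc.
rewrite rnormZr ger0_norm ?sqr_ge0 // => h.
rewrite -(@ler_pXn2r _ 2) ?nnegrE ?rnorm_ge0 // (le_trans h) //.
by rewrite ler_piMr ?sqr_ge0 // rnorm1_le1.
Qed.

Lemma pos_cst_ge0 t : (1 : A) <> 0 -> pos (t%:C *: (1 : A)) -> 0 <= t.
Proof.
move=> one0 /pos_large[s s0 /(_ s (lexx s))].
have -> : s%:C *: (1 : A) - t%:C *: (1 : A) = (s - t)%:C *: (1 : A) by nc.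
have n1 : 1 <= rnorm (1 : A).
  have := rnormM (1 : A) 1; rewrite mulr1.
  have : rnorm (1 : A) != 0 by apply/eqP => /rnorm_eq0.
  by have := rnorm_ge0 (1 : A); rewrite le_eqVlt => /orP[/eqP <-|? _]; [rewrite eqxx|rewrite ler_pMr].
rewrite rnormZr => h; have : `|s - t| <= s.
  by apply: le_trans h; rewrite ler_peMr.
by rewrite ler_norml => /andP[]; lra.
Qed.

(* [min(w, t) = w - (w - t)^+] *)
Lemma truncation_norm w t : pos w -> 0 <= t -> rnorm (w - cpos (w - t%:C *: (1 : A))) <= t.
Proof.
move=> pw t0; set k := w - t%:C *: (1 : A); set n := cneg k.
have sk : star k = k by rewrite /k starB starZr star1 pos_sa.
have pn : pos n by exact: cneg_pos.
have wk : w * k = k * w by rewrite /k; nc.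
have wn : w * n = n * w by exact: cneg_comm.
have nn : n * k = - (n * n) by exact: cneg_mul.
have -> : w - cpos k = t%:C *: (1 : A) - n.
  have -> : cpos k = k + n by rewrite -{2}(cpos_sub_cneg k) subrK.
  by rewrite {1}/k; nc.
(* The truncation equals [t - n], and [n w = n (t - n)] is positive. Completing the square,
   [z = n - t/2] satisfies [z^2 + g^2 = (t/2)^2], so [n] stays within [t/2] of the midpoint
   [t/2]. *)
have [g [pg gg gc]] := pos_sqrt_ex (pos_mul pn pw (esym wn)).
have ng : n * g = g * n by apply: gc; cnc.
set z := n - (t / 2)%:C *: (1 : A).
have sz : star z = z by rewrite /z starB starZr star1 pos_sa.
have zg : z * g = g * z by rewrite /z; cnc.
have : rnorm z ^+ 2 <= (t / 2) ^+ 2.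
  rewrite (le_trans (sqr_add_norm sz (pos_sa pg) zg)) //.
  have -> : z * z + g * g = ((t / 2) ^+ 2)%:C *: (1 : A).
    have -> : g * g = n * k + t%:C *: n by rewrite gg /k; nc.
    by rewrite nn /z; nc.
  by rewrite rnormZr ger0_norm ?sqr_ge0 // ler_piMr ?sqr_ge0 // rnorm1_le1.
have t2 : 0 <= t / 2 by lra.
rewrite ler_pXn2r ?nnegrE ?rnorm_ge0 // => hz.
have -> : t%:C *: (1 : A) - n = (t / 2)%:C *: (1 : A) - z by rewrite /z; nc.
rewrite (le_trans (rnormD _ _)) // rnormN rnormZr ger0_norm //.
by have := rnorm1_le1 A; nra.
Qed.

End PositiveParts.

(** * Central elements modulo an ideal *)

Section QuotientOrder.
Variables (R : realType) (A : cstarAlgType R) (I : cideal A).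
Implicit Types (x y k : A).

Lemma rnorm_qproj x : rnorm (qproj I x) <= rnorm x.
Proof. by rewrite quot_rnormE quot_rnorm_le. Qed.

Lemma qprojB x y : qproj I (x - y) = qproj I x - qproj I y.
Proof. by rewrite qprojD qprojN. Qed.

Lemma qproj_eq0 x : qproj I x = 0 <-> I x.
Proof. by have := qprojP I x 0; rewrite subr0. Qed.

Lemma pos_qproj x : pos x -> pos (qproj I x).
Proof.
move=> [sx [t tx]]; split; first by rewrite -qproj_star sx.
exists t; rewrite -qproj1 -qprojZ -qprojB.
by rewrite (le_trans (rnorm_qproj _)).
Qed.

Lemma cabs_qproj k : star k = k -> qproj I (cabs k) = cabs (qproj I k).
Proof.
move=> sk; symmetry; apply: csqrtE; first exact/pos_qproj/cabs_pos.
by rewrite -!qprojM cabs_sqr.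
Qed.

Lemma cpos_qproj k : star k = k -> qproj I (cpos k) = cpos (qproj I k).
Proof. by move=> sk; rewrite /cpos qprojZ qprojD cabs_qproj. Qed.

End QuotientOrder.

Section CentralModulo.
Variables (R : realType) (A : cstarAlgType R).
Implicit Types (x y k : A) (I J : cideal A).

Definition central_mod I x := alg_center (quot I) (qproj I x).

Lemma central_modP I x : central_mod I x <-> forall b, I (x * b - b * x).
Proof.
split=> [H b|H]; first by apply/qprojP; rewrite !qprojM H.
by elim/qprojW => b; rewrite -!qprojM; apply/qprojP.
Qed.

Lemma central_mod_sub I J x : I `<=` J -> central_mod I x -> central_mod J x.
Proof. by move=> IJ /central_modP H; apply/central_modP => b; apply: IJ. Qed.

Lemma alg_center_mod I x : alg_center A x -> central_mod I x.
Proof.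
by move=> H; apply/central_modP => b; rewrite H subrr; exact: cideal0.
Qed.

Lemma central_modD I x y : central_mod I x -> central_mod I y -> central_mod I (x + y).
Proof. by move=> Hx Hy b; rewrite qprojD mulrDl mulrDr Hx Hy. Qed.

Lemma central_modM I x y : central_mod I x -> central_mod I y -> central_mod I (x * y).
Proof. by move=> Hx Hy b; rewrite qprojM -mulrA Hy mulrA Hx mulrA. Qed.

Lemma central_modZ I (c : R[i]) x : central_mod I x -> central_mod I (c *: x).
Proof. by move=> Hx b; rewrite qprojZ scalerMl scalerMr Hx. Qed.

Lemma central_mod1 I : central_mod I 1.
Proof. by move=> b; rewrite qproj1 mul1r mulr1. Qed.

Lemma central_modB I x y : central_mod I x -> central_mod I y -> central_mod I (x - y).
Proof. by move=> Hx Hy; rewrite -scaleN1r; apply: central_modD; last exact: central_modZ. Qed.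

Lemma central_mod_star I x : central_mod I x -> central_mod I (star x).
Proof.
by move=> Hx b; rewrite qproj_star -[b]starK -!starM Hx.
Qed.

Lemma central_mod_cabs I k : star k = k -> central_mod I k -> central_mod I (cabs k).
Proof.
move=> sk Hk b; rewrite cabs_qproj //; symmetry; apply: cabs_comm.
  by rewrite -qproj_star sk.
by rewrite Hk.
Qed.

Lemma central_mod_cpos I k : star k = k -> central_mod I k -> central_mod I (cpos k).
Proof.
by move=> sk Hk; apply: central_modZ; apply: central_modD => //; exact: central_mod_cabs.
Qed.

Lemma alg_center_cpos k : star k = k -> alg_center A k -> alg_center A (cpos k).
Proof. by move=> sk Hk b; symmetry; apply: cpos_comm => //; rewrite Hk. Qed.

End CentralModulo.

(** * Schur's lemma for prime algebras *)

Section Schur.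
Variables (R : realType) (D : cstarAlgType R).
Hypothesis one0 : (1 : D) <> 0.
Hypothesis primeD : forall s t : D, (forall b, s * b * t = 0) -> s = 0 \/ t = 0.

(** The positive and negative parts of [l - z] are central with product [0], so primeness kills one
    of them: every real [l] lies above or below [z]. The infimum of those above is then within every
    [e] of [z]. *)
Lemma center_scalar_sa (z : D) : alg_center D z -> star z = z ->
  exists l : R, z = l%:C *: (1 : D).
Proof.
move=> cz sz; pose k (l : R) : D := l%:C *: (1 : D) - z.
have sk l : star (k l) = k l by rewrite starB starZr star1 sz.
have ck l : alg_center D (k l) by move=> b; rewrite /k mulrBl mulrBr cz; nc.
have dich l : pos (k l) \/ pos (- k l).
  have [|p0|n0] := primeD (s := cpos (k l)) (t := cneg (k l)) _.
  - move=> b; rewrite (alg_center_cpos (sk l) (ck l)) -mulrA cpos_mul_cneg //.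
    by rewrite mulr0.
  - by right; rewrite -{1}(cpos_sub_cneg (k l)) p0 sub0r opprK; exact: cneg_pos.
  - by left; rewrite -(cpos_sub_cneg (k l)) n0 subr0; exact: cpos_pos.
pose S := [set l | pos (k l)].
have Slb : lbound S (- rnorm z).
  move=> l Sl; rewrite lerNl -subr_ge0 opprK; apply: (pos_cst_ge0 one0).
  have := posD Sl (pos_norm_add sz).
  by rewrite (_ : k l + _ = (rnorm z + l)%:C *: (1 : D)) //; rewrite /k; nc.
have hS : has_inf S.
  by split; [exists (rnorm z); exact: pos_norm_sub|exists (- rnorm z)].
exists (inf S); apply/eqP; rewrite -subr_eq0; apply/eqP.
apply: rnorm_small_eq0 => e e0; apply: pos_norm_le; first exact: ltW.
  have [l Sl le] := inf_adherent e0 hS.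
  have le' : 0 <= inf S + e - l by lra.
  have := posD Sl (pos_cst D le').
  by rewrite (_ : k l + _ = e%:C *: (1 : D) - (z - (inf S)%:C *: (1 : D))) //; rewrite /k; nc.
have [H|] := dich (inf S - e); last first.
  by rewrite (_ : - k _ = e%:C *: (1 : D) + (z - (inf S)%:C *: (1 : D))) //; rewrite /k; nc.
have : inf S <= inf S - e by apply: ge_inf => //; exists (- rnorm z).
by lra.
Qed.

Lemma center_scalar (z : D) : alg_center D z -> exists l : R[i], z = l *: (1 : D).
Proof.
move=> cz; have csz : alg_center D (star z).
  by move=> b; rewrite -[b]starK -!starM cz.
pose u : D := (2^-1 : R)%:C *: (z + star z).
pose v : D := ((2^-1 : R)%:C * 'i) *: (star z - z).
have su : star u = u by rewrite /u starZr starD starK addrC.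
have sv : star v = v.
  rewrite /v starZ starB starK -[z - _]opprB scalerN -scaleNr; congr (_ *: _).
  by apply/eqP; rewrite eq_complex /=; apply/andP; split; apply/eqP; ring.
have cu : alg_center D u.
  by move=> b; rewrite /u scalerMl scalerMr mulrDl mulrDr cz csz.
have cv : alg_center D v.
  by move=> b; rewrite /v scalerMl scalerMr mulrBl mulrBr cz csz.
have [l ul] := center_scalar_sa cu su; have [m vm] := center_scalar_sa cv sv.
exists (l%:C + 'i * m%:C); rewrite scalerDl -scalerA -ul -vm /u /v.
by move: (star z) => zs; nc.
Qed.

End Schur.

(** * Primitive ideals as closed ideals *)

Section PrimIdeal.
Variables (R : realType) (A : cstarAlgType R).

Lemma inner0l (H : hilbertType R) (x : H) : inner 0 x = 0.
Proof.
have := inner_linearl (-1) 0 0 x.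
by rewrite scaleN1r oppr0 addr0 mulN1r addNr.
Qed.

Lemma inner_sqr (H : hilbertType R) (x : H) : inner x x = (rnorm x ^+ 2)%:C.
Proof. by rewrite inner_norm normE -rmorphXn. Qed.

Lemma rep_norm_le (H : hilbertType R) (pi : star_rep A H) (x : H) (b : A) :
  rnorm (pi b x) ^+ 2 <= rnorm b ^+ 2 * rnorm (pi 1 x) ^+ 2.
Proof.
have ps y : pos y -> 0 <= inner (pi y x) x.
  move=> /pos_sqrt_ex[s [ps <- _]].
  by rewrite repM -{1}(pos_sa ps) rep_star inner_sqr ler0c sqr_ge0.
have sE y : inner (pi (star y * y) x) x = (rnorm (pi y x) ^+ 2)%:C.
  by rewrite repM rep_star inner_sqr.
have : pos ((rnorm (star b * b))%:C *: (1 : A) - star b * b).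
  by apply: pos_norm_sub; rewrite starM starK.
move/ps; rewrite rnorm_star_mul.
have -> : pi ((rnorm b ^+ 2)%:C *: (1 : A) - star b * b) x =
    (-1) *: pi (star b * b) x + ((rnorm b ^+ 2)%:C *: pi 1 x + 0).
  by rewrite -scaleN1r repD !repZ addr0 addrC.
rewrite !inner_linearl sE inner0l addr0.
have -> : inner (pi 1 x) x = (rnorm (pi 1 x) ^+ 2)%:C by rewrite -sE star1 mul1r.
rewrite mulN1r addrC subr_ge0 -rmorphM lecR.
by [].
Qed.

Lemma prim0 (P : Prim A) : P 0.
Proof.
have [H [pi [_ ->]]] := prim_primitive P => x.
by have := repZ pi 0 0 x; rewrite !scale0r.
Qed.

Lemma primD (P : Prim A) x y : P x -> P y -> P (x + y).
Proof.
have [H [pi [_ ->]]] := prim_primitive P => Px Py v.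
by rewrite repD Px Py addr0.
Qed.

Lemma prim_closed (P : Prim A) : closed (P : set A).
Proof.
have [H [pi [_ PE]]] := prim_primitive P; rewrite PE => b clb x.
have : forall e : R, 0 < e -> exists2 y, rep_kernel pi y & rnorm (b - y) <= e.
  move=> e e0; have [|y [yP yb]] := clb (ball b (e%:C : R[i])).
    by apply: nbhsx_ballx; rewrite ltcR.
  by exists y => //; move: yb; rewrite -ball_normE /ball_ /= normE ltcR => /ltW.
move=> {}clb; apply: rnorm_small_eq0 => e e0.
pose c := rnorm (pi 1 x) + 1; have c0 : 0 < c by rewrite ltr_wpDl // rnorm_ge0.
have [y yP yb] := clb (e / c) (divr_gt0 e0 c0).
rewrite -(@ler_pXn2r _ 2) ?nnegrE ?rnorm_ge0 ?(ltW e0) //.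
have -> : pi b x = pi (b - y) x by rewrite repD -scaleN1r repZ yP scaler0 addr0.
rewrite (le_trans (rep_norm_le _ _ _)) // -exprMn ler_pXn2r ?nnegrE ?mulr_ge0 ?rnorm_ge0 ?(ltW e0) //.
rewrite (le_trans (ler_wpM2r (rnorm_ge0 _) yb)) // -mulrA ler_piMr ?(ltW e0) //.
by rewrite mulrC ler_pdivrMr // mul1r lerDl.
Qed.

Definition prim_ideal (P : Prim A) : cideal A :=
  CIdeal (@prim0 P) (@primD P) (@primMl _ _ P) (@primMr _ _ P) (@prim_closed P).

End PrimIdeal.

(** * Values of elements at a primitive ideal *)

Section Value.
Variables (R : realType) (A : cstarAlgType R) (P : Prim A).
Implicit Types (x y k : A) (l m : R[i]) (r t : R).

(** A relation, because the algebraic rules hold for any elements that have values, whereas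
    existence requires centrality modulo [P]. *)
Definition has_value x l := P (x - l *: (1 : A)).

Lemma has_valueP x l : has_value x l <-> qproj (prim_ideal P) x = l *: (1 : quot (prim_ideal P)).
Proof.
rewrite /has_value -qproj1 -qprojZ; symmetry; exact: (qprojP (prim_ideal P)).
Qed.

Lemma prim_quot_one : (1 : quot (prim_ideal P)) <> 0.
Proof. by rewrite -qproj1 => /qproj_eq0; exact: prim_proper. Qed.

Lemma has_value_uniq x l m : has_value x l -> has_value x m -> l = m.
Proof.
move=> /has_valueP Hl /has_valueP; rewrite Hl => /eqP; rewrite -subr_eq0 -scalerBl scaler_eq0.
by rewrite subr_eq0 => /orP[/eqP //|/eqP /prim_quot_one].
Qed.

Lemma has_value_mem x : has_value x 0 <-> P x.
Proof. by rewrite /has_value scale0r subr0. Qed.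

Lemma has_value_cst l : has_value (l *: (1 : A)) l.
Proof. by rewrite /has_value subrr; exact: prim0. Qed.

Lemma has_valueD x y l m : has_value x l -> has_value y m -> has_value (x + y) (l + m).
Proof.
move=> Hx Hy; rewrite /has_value.
have -> : x + y - (l + m) *: (1 : A) = (x - l *: (1 : A)) + (y - m *: (1 : A)) by nc.
exact: primD.
Qed.

Lemma has_valueZ x l m : has_value x l -> has_value (m *: x) (m * l).
Proof.
by move=> /has_valueP Hx; apply/has_valueP; rewrite qprojZ Hx scalerA.
Qed.

Lemma has_valueB x y l m : has_value x l -> has_value y m -> has_value (x - y) (l - m).
Proof.
by move=> Hx /(has_valueZ (-1)); rewrite scaleN1r mulN1r; exact: has_valueD.
Qed.

Lemma has_valueM x y l m : has_value x l -> has_value y m -> has_value (x * y) (l * m).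
Proof.
move=> /has_valueP Hx /has_valueP Hy; apply/has_valueP.
by rewrite qprojM Hx Hy scalerMl scalerMr mulr1 scalerA.
Qed.

Lemma has_value_star x l : has_value x l -> has_value (star x) (conjc l).
Proof.
by move=> /has_valueP Hx; apply/has_valueP; rewrite qproj_star Hx starZ star1.
Qed.

Lemma has_value_real x l : star x = x -> has_value x l -> l = (complex.Re l)%:C.
Proof.
move=> sx Hx; have := has_value_star Hx; rewrite sx => /(has_value_uniq Hx).
case: l {Hx} => a b /= [ab]; congr (_ +i* _)%C; lra.
Qed.

(** Quotient maps preserve absolute values by uniqueness of roots, and the absolute value of [r]
    times [1] is the positive root of [r^2] times [1]. This gives the lattice operations on
    values. *)
Lemma has_value_cpos k r : star k = k -> has_value k r%:C ->
  has_value (cpos k) (Num.max r 0)%:C.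
Proof.
move=> sk /has_valueP Hk; apply/has_valueP; rewrite cpos_qproj // Hk /cpos.
have -> : cabs (r%:C *: (1 : quot (prim_ideal P))) = `|r|%:C *: (1 : quot (prim_ideal P)).
  apply: csqrtE; first exact: pos_cst.
  by rewrite !scalerMl !scalerMr !scalerA -!rmorphM -!expr2 real_normK ?num_real.
rewrite -scalerDl scalerA -rmorphD -rmorphM; congr (_%:C *: _).
by case: (lerP 0 r) => r0; [rewrite ger0_norm | rewrite ltr0_norm] => //; lra.
Qed.

(** The quotient by a primitive ideal is prime and nonzero, so its centre is scalar. *)
Lemma has_value_ex x : central_mod (prim_ideal P) x -> exists l, has_value x l.
Proof.
move=> cx; have [|l /has_valueP] := center_scalar prim_quot_one _ cx; last by exists l.
elim/qprojW => s; elim/qprojW => t st; rewrite !qproj_eq0.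
by apply: prim_prime => b; apply/(qproj_eq0 (prim_ideal P)); rewrite !qprojM st.
Qed.

Lemma has_value_ex_sa x : star x = x -> central_mod (prim_ideal P) x ->
  exists r, has_value x r%:C.
Proof.
move=> sx /has_value_ex[l xl]; exists (complex.Re l).
by rewrite -(has_value_real sx xl).
Qed.

End Value.

(** * Existence of the Dauns-Hofmann function *)

Section DaunsHofmann.
Variables (R : realType) (B : cstarAlgType R).

(** A continuous function of values must be exhibited for the choice not to fall back on its
    default. Near [P0], with [w = z - f P0], the element [cpos (e^2 - star w * w)] has value
    [max (e^2 - |f Q - f P0|^2, 0)] at [Q]. The [Q] not containing it form an open set around [P0]
    on which [f] varies by less than [e]. *)
Lemma dauns_hofmannP (z : B) (P : Prim B) : alg_center B z ->
  has_value P z (dauns_hofmann z P).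
Proof.
move=> cz; pose f (P : Prim B) : R[i]^o := xget 0 [set l | has_value P z l].
have fP Q : has_value Q z (f Q).
  rewrite /f; case: xgetP => [l -> //|H]; exfalso.
  have [l zl] := has_value_ex (alg_center_mod (I := prim_ideal Q) cz).
  exact: (H l).
have cf : continuous f.
  move=> P0; have FP0 : Filter (nbhs P0) by exact: nbhs_filter.
  apply/(@cvgrPdist_lt _ _ _ (nbhs P0) FP0 f (f P0)) => e e0.
  have e0' : 0 < complex.Re e by move: e0; rewrite ltcE => /andP[].
  pose N (c : R[i]) : R := complex.Re c ^+ 2 + complex.Im c ^+ 2.
  have NE (c : R[i]) : conjc c * c = (N c)%:C.
    by case: c => a b; rewrite /N /=; apply/eqP; rewrite eq_complex /=; apply/andP; split; apply/eqP; ring.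
  pose w : B := z - f P0 *: (1 : B).
  pose k : B := (complex.Re e ^+ 2)%:C *: (1 : B) - star w * w.
  have sk : star k = k by rewrite starB starZr star1 starM starK.
  have kv Q : has_value Q (cpos k) (Num.max (complex.Re e ^+ 2 - N (f Q - f P0)) 0)%:C.
    apply: has_value_cpos => //; rewrite rmorphB /= -NE.
    apply: has_valueB; first exact: has_value_cst.
    have wv : has_value Q w (f Q - f P0).
      by apply: has_valueB => //; exact: has_value_cst.
    by apply: has_valueM => //; exact: has_value_star.
  have oU : open [set Q : Prim B | ~ ([set cpos k] `<=` Q)] by exists [set cpos k].
  apply: filterS (open_nbhs_nbhs _); last first.
    split; [exact: oU|] => /= kP0.
    have : has_value P0 (cpos k) 0 by apply/has_value_mem; exact: kP0.
    move/(has_value_uniq (kv P0))/complexI.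
    rewrite subrr /N /= expr0n /= addr0 subr0 => h.
    have : 0 < complex.Re e ^+ 2 by rewrite exprn_gt0.
    by move=> h'; move: h; rewrite max_l ?ltW // => h; rewrite h ltxx in h'.
  move=> Q /= kQ; have {kQ} : N (f Q - f P0) < complex.Re e ^+ 2.
    rewrite ltNge; apply/negP => h; apply: kQ => _ ->; apply/has_value_mem.
    by have := kv Q; rewrite max_r ?subr_le0.
  rewrite distrC; case: (f Q - f P0) => a b; rewrite /N /= => h.
  rewrite -(@RRe_real _ e) ?gtr0_real // normc_def ltcR.
  rewrite -(@ltr_pXn2r _ 2) ?nnegrE ?sqrtr_ge0 ?(ltW e0') //.
  by rewrite sqr_sqrtr // addr_ge0 // sqr_ge0.
rewrite /dauns_hofmann; case: xgetP => [g _ gP|H]; first exact: gP.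
by exfalso; apply: (H (mkcts cf)) => Q; exact: fP.
Qed.

End DaunsHofmann.

(** * Extreme points below a sublinear functional *)

Section ExtremePoint.
Variables (R : realType) (V : lmodType R[i]).
Implicit Types (p q f g : V -> R) (x y : V) (t l : R).

Definition sublinear q :=
  (forall x y, q (x + y) <= q x + q y) /\
  (forall t x, 0 < t -> q (t%:C *: x) = t * q x).

Definition rlinear f :=
  (forall x y, f (x + y) = f x + f y) /\ (forall t x, f (t%:C *: x) = t * f x).

(* A sublinear [q] below [p] encodes the convex set of linear functionals below
   [q]; it is a face of the set encoded by [p] when a proper convex combination
   in it has its endpoints in it. *)
Definition face p q := [/\ sublinear q, forall x, q x <= p x &
  forall f g l, rlinear f -> rlinear g ->
    (forall x, f x <= p x) -> (forall x, g x <= p x) -> 0 < l < 1 ->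
    (forall x, l * f x + (1 - l) * g x <= q x) -> forall x, f x <= q x].

Lemma sublinear0 q : sublinear q -> q 0 = 0.
Proof. by move=> [_ /(_ 2 0)]; rewrite scaler0 ltr0n => /(_ erefl); lra. Qed.

Lemma sublinear_ge q x : sublinear q -> - q (- x) <= q x.
Proof.
move=> sq; have := sq.1 x (- x); rewrite subrr (sublinear0 sq); lra.
Qed.

Section Refine.
Variables (p q : V -> R) (x : V).
Hypotheses (sp : sublinear p) (fq : face p q).

(* The face of the functionals attaining the bound [q] at [x]. *)
Definition refine (y : V) : R :=
  inf [set q (y + t%:C *: x) - t * q x | t in [set t : R | 0 <= t]].

Let sq : sublinear q. Proof. by case: fq. Qed.

Let qZ t : 0 <= t -> q (t%:C *: x) = t * q x.
Proof.
rewrite le_eqVlt => /orP[/eqP <-|]; last exact: sq.2.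
by rewrite scale0r mul0r sublinear0.
Qed.

Lemma refine_lbound y :
  lbound [set q (y + t%:C *: x) - t * q x | t in [set t : R | 0 <= t]] (- q (- y)).
Proof.
move=> _ [t /= t0 <-]; have := sq.1 (y + t%:C *: x) (- y).
by rewrite addrAC subrr add0r (qZ t0); lra.
Qed.

Lemma refine_has_inf y :
  has_inf [set q (y + t%:C *: x) - t * q x | t in [set t : R | 0 <= t]].
Proof.
split; last by exists (- q (- y)); exact: refine_lbound.
by exists (q (y + 0%:C *: x) - 0 * q x), 0 => //; exact: lexx.
Qed.

Lemma refine_le y t : 0 <= t -> refine y <= q (y + t%:C *: x) - t * q x.
Proof.
move=> t0; apply: ge_inf; last by exists t.
by exists (- q (- y)); exact: refine_lbound.
Qed.

Lemma refine_le_self y : refine y <= q y.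
Proof. by have := @refine_le y 0 (lexx _); rewrite scale0r addr0 mul0r subr0. Qed.

Lemma refine_opp : refine (- x) <= - q x.
Proof.
have := @refine_le (- x) 1 ler01.
by rewrite scale1r addNr sublinear0 // mul1r sub0r.
Qed.

Lemma le_refine y (c : R) :
  (forall t, 0 <= t -> c <= q (y + t%:C *: x) - t * q x) -> c <= refine y.
Proof.
move=> H; apply: lb_le_inf; first by case: (refine_has_inf y).
by move=> _ [t /= t0 <-]; exact: H.
Qed.

Lemma refine_sublinear : sublinear refine.
Proof.
split=> [y z|t y t0].
  apply/ler_addgt0Pr => e e0; have e2 : 0 < e / 2 by rewrite divr_gt0.
  have [_ [t /= t0 <-] Ht] := inf_adherent e2 (refine_has_inf y).
  have [_ [s /= s0 <-] Hs] := inf_adherent e2 (refine_has_inf z).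
  have := refine_le (y + z) (addr_ge0 t0 s0).
  have := sq.1 (y + t%:C *: x) (z + s%:C *: x).
  rewrite addrACA -scalerDl -rmorphD; rewrite -/(refine y) in Ht.
  by rewrite -/(refine z) in Hs; lra.
have half s w : 0 < s -> refine (s%:C *: w) <= s * refine w.
  move=> s0; rewrite mulrC -ler_pdivrMr //; apply: le_refine => u u0.
  rewrite ler_pdivrMr //; have := refine_le (s%:C *: w) (mulr_ge0 (ltW s0) u0).
  by rewrite rmorphM -scalerA -scalerDr sq.2 //; lra.
apply/eqP; rewrite eq_le half //=.
have ti : 0 < t^-1 by rewrite invr_gt0.
have := half t^-1 (t%:C *: y) ti.
by rewrite scalerA -rmorphM mulVf ?gt_eqF // scale1r ler_pdivlMl.
Qed.

(** By [refine_opp] a convex combination below [refine] attains [q x] at [x]; both endpoints are at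
    most [q x] there, so [f x = q x]. Then [f y = f (y + t x) - t q x] is below each term of the
    infimum. *)
Lemma refine_face : face p refine.
Proof.
have [_ qp qf] := fq.
split; first exact: refine_sublinear.
  by move=> y; exact: le_trans (refine_le_self y) _.
move=> f g l lf lg fp gp l01 fg y.
have fgq z : l * f z + (1 - l) * g z <= q z.
  exact: le_trans (fg z) (refine_le_self z).
have fq' := qf f g l lf lg fp gp l01 fgq.
have gq' : forall z, g z <= q z.
  apply: (qf g f (1 - l)) => //; first by case/andP: l01; lra.
  by move=> z; rewrite addrC subKr.
have opp h : rlinear h -> h (- x) = - h x.
  by move=> [_ /(_ (-1) x)]; rewrite rmorphN1 scaleN1r mulN1r.
have fx : f x = q x.
  have := le_trans (fg (- x)) refine_opp; rewrite !opp //.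
  have := fq' x; have := gq' x; case/andP: l01; nra.
apply: le_refine => t t0; have := fq' (y + t%:C *: x).
by rewrite lf.1 lf.2 fx; lra.
Qed.

End Refine.

(** Minimality gives [q] below its own refinement, so [q (- x) <= - q x] for every [x]. An odd
    sublinear functional is linear. *)
Lemma minimal_face_rlinear p q : sublinear p -> face p q ->
  (forall r, face p r -> (forall x, r x <= q x) -> forall x, q x <= r x) -> rlinear q.
Proof.
move=> sp fq qmin; have [sq _ _] := fq.
have qN x : q (- x) = - q x.
  apply/eqP; rewrite eq_le; apply/andP; split.
    apply: le_trans (refine_opp x fq).
    exact: (qmin _ (refine_face x fq) (refine_le_self x fq)).
  by have := sublinear_ge x sq; lra.
split=> [x y|t x].
  apply/eqP; rewrite eq_le sq.1 /=.
  by have := sq.1 (x + y) (- y); rewrite addrK qN; lra.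
have [t0|t0|->] := ltrgt0P t; [exact: sq.2| |].
  have := sq.2 (- t) x; rewrite oppr_gt0 => /(_ t0).
  by rewrite rmorphN scaleNr qN mulNr => /oppr_inj.
by rewrite scale0r mul0r sublinear0.
Qed.

(** The pointwise infimum works: it is finite because members are bounded below by [- p (- x)], and
    it is subadditive because, of two members that are nearly optimal at [x] and [y], the smaller
    one serves for both. *)
Lemma chain_face p (F : set (V -> R)) : sublinear p -> F !=set0 ->
  (forall q, F q -> face p q) ->
  (forall q r, F q -> F r -> (forall x, q x <= r x) \/ (forall x, r x <= q x)) ->
  exists2 q, face p q & forall r x, F r -> q x <= r x.
Proof.
move=> sp [q0 Fq0] Ff Ft; pose S x := [set q x | q in F].
have hS x : has_inf (S x).
  split; first by exists (q0 x); exists q0.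
  exists (- p (- x)) => _ [q Fq <-]; have [sq qp _] := Ff q Fq.
  by have := sublinear_ge x sq; have := qp (- x); lra.
have le x r : F r -> inf (S x) <= r x.
  by move=> Fr; apply: ge_inf; [case: (hS x)|exists r].
exists (fun x => inf (S x)); last by move=> r x; exact: le.
have half (t : R) x : 0 < t -> inf (S (t%:C *: x)) <= t * inf (S x).
  move=> t0; rewrite mulrC -ler_pdivrMr //; apply: lb_le_inf; first by case: (hS x).
  move=> _ [q Fq <-]; rewrite ler_pdivrMr // mulrC.
  by have [[_ qZ] _ _] := Ff q Fq; rewrite -qZ //; exact: le.
split.
- split=> [x y|t x t0].
    apply/ler_addgt0Pr => e e0; have e2 : 0 < e / 2 by rewrite divr_gt0.
    have [_ [q Fq <-] Hq] := inf_adherent e2 (hS x).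
    have [_ [r Fr <-] Hr] := inf_adherent e2 (hS y).
    have [[qD _] _ _] := Ff q Fq; have [[rD _] _ _] := Ff r Fr.
    have [qr|rq] := Ft q r Fq Fr.
      by have := le (x + y) q Fq; have := qD x y; have := qr y; lra.
    by have := le (x + y) r Fr; have := rD x y; have := rq x; lra.
  apply/eqP; rewrite eq_le half //=.
  have ti : 0 < t^-1 by rewrite invr_gt0.
  have := half t^-1 (t%:C *: x) ti.
  by rewrite scalerA -rmorphM mulVf ?gt_eqF // scale1r ler_pdivlMl.
- by move=> x; have [_ qp _] := Ff _ Fq0; exact: le_trans (le x q0 Fq0) (qp x).
- move=> f g l lf lg fp gp l01 fg x; apply: lb_le_inf; first by case: (hS x).
  move=> _ [q Fq <-]; have [_ _ qf] := Ff q Fq.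
  apply: (qf f g l) => // y; exact: le_trans (fg y) (le y q Fq).
Qed.

(** A minimal face is a single linear functional [q]. If [q] is a proper convex combination, the
    face property puts the endpoint [g] below [q], and comparing at [x] and [- x] gives equality. *)
Lemma extreme_functional p : sublinear p ->
  exists f, [/\ rlinear f, forall x, f x <= p x &
    forall g h l, rlinear g -> rlinear h ->
      (forall x, g x <= p x) -> (forall x, h x <= p x) -> 0 < l < 1 ->
      (forall x, f x = l * g x + (1 - l) * h x) -> forall x, g x = f x].
Proof.
move=> sp; have fp : face p p by split.
pose T := {q : V -> R | face p q}.
(* The order is reversed, since Zorn's lemma provides maximal elements. *)
pose r (s t : T) := `[< forall x, sval t x <= sval s x >].
have [|a b c /asboolP ab /asboolP bc|F Ft|[q fq] qmin] := @ZL_preorder T (exist _ p fp) r.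
- by move=> t; apply/asboolP.
- by apply/asboolP => x; exact: le_trans (bc x) (ab x).
- have [[t0 Ft0]|F0] := pselect (F !=set0); last first.
    by exists (exist _ p fp) => s Fs; exfalso; apply: F0; exists s.
  have [||_ _ [s Fs <-] [t Ftt <-]|q fq qle] := @chain_face p [set sval t | t in F] sp.
  + by exists (sval t0); exists t0.
  + by move=> _ [t _ <-]; case: t.
  + by case: (Ft s t Fs Ftt) => /asboolP; [right|left].
  + by exists (exist _ q fq) => s Fs; apply/asboolP => x; apply: qle; exists s.
have lq : rlinear q.
  apply: (minimal_face_rlinear sp fq) => q' fq' q'q.
  by have /asboolP := qmin (exist _ q' fq') (introT (asboolP _) q'q).
have [_ qp qf] := fq.
exists q; split=> // g h l lg lh gp hp l01 qE.
have gq : forall x, g x <= q x.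
  by apply: (qf g h l) => // x; rewrite qE.
have opp f x : rlinear f -> f (- x) = - f x.
  by move=> [_ /(_ (-1) x)]; rewrite rmorphN1 scaleN1r mulN1r.
move=> x; apply/eqP; rewrite eq_le gq /=.
by have := gq (- x); rewrite !opp // lerN2.
Qed.

End ExtremePoint.

(** * Completion of a pre-Hilbert space *)

Section ComplexModulus.
Variable R : realType.
Implicit Types (a b c : R[i]) (t : R).

Definition cmod c : R := complex.Re `|c|.

Lemma cmodE c : `|c| = (cmod c)%:C.
Proof. exact: (@normE R R[i]^o c). Qed.

Lemma cmod_ge0 c : 0 <= cmod c. Proof. exact: (@rnorm_ge0 R R[i]^o c). Qed.

Lemma cmodD a b : cmod (a + b) <= cmod a + cmod b.
Proof. exact: (@rnormD R R[i]^o a b). Qed.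

Lemma cmodN a : cmod (- a) = cmod a. Proof. by rewrite /cmod normrN. Qed.

Lemma cmod0 : cmod 0 = 0. Proof. by rewrite /cmod normr0. Qed.

Lemma cmodM a b : cmod (a * b) = cmod a * cmod b.
Proof. by apply: complexI; rewrite [RHS]rmorphM /= -!cmodE normrM. Qed.

Lemma cmod_conj a : cmod (conjc a) = cmod a.
Proof. by case: a => x y; rewrite /cmod !normc_def /= sqrrN. Qed.

Lemma cmod_real t : cmod t%:C = `|t|. Proof. exact: Re_normc_real. Qed.

Lemma cmod_sqr c : (cmod c ^+ 2)%:C = conjc c * c.
Proof.
case: c => x y; rewrite /cmod normc_def /= sqr_sqrtr ?addr_ge0 ?sqr_ge0 //.
by apply/eqP; rewrite eq_complex /=; apply/andP; split; apply/eqP; ring.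
Qed.

Lemma cmod_eq0 c : cmod c = 0 -> c = 0.
Proof. exact: (@rnorm_eq0 R R[i]^o c). Qed.

Lemma cmod_le_ReIm c : cmod c <= `|complex.Re c| + `|complex.Im c|.
Proof.
case: c => x y; rewrite /cmod normc_def /=.
rewrite -(@ler_pXn2r _ 2) ?nnegrE ?addr_ge0 ?sqrtr_ge0 //.
rewrite sqr_sqrtr ?addr_ge0 ?sqr_ge0 // sqrrD !real_normK ?num_real //.
by rewrite addrAC lerDl mulrn_wge0 // mulr_ge0.
Qed.

Lemma Re_cmod_le c : `|complex.Re c| <= cmod c.
Proof.
case: c => x y; rewrite /cmod normc_def /=.
by rewrite -sqrtr_sqr ler_wsqrtr // lerDl sqr_ge0.
Qed.

Lemma Im_cmod_le c : `|complex.Im c| <= cmod c.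
Proof.
case: c => x y; rewrite /cmod normc_def /=.
by rewrite -sqrtr_sqr ler_wsqrtr // lerDr sqr_ge0.
Qed.

Lemma real_cauchy_cvg (u : nat -> R) :
  (forall e : R, 0 < e -> exists N, forall n, (N <= n)%N -> `|u n - u N| <= e) ->
  exists l, forall e : R, 0 < e -> exists N, forall n, (N <= n)%N -> `|l - u n| <= e.
Proof.
move=> H.
have cu : cauchy (u @ \oo).
  apply/cauchy_ballP => e e0; have e2 : 0 < e / 4 by rewrite divr_gt0.
  have [N HN] := H _ e2.
  exists (ball (u N) (e / 2), ball (u N) (e / 2)) => /=.
    have uN : (u @ \oo) (ball (u N) (e / 2)).
      exists N => // n /= Nn; rewrite -ball_normE /ball_ /= distrC.
      by rewrite (le_lt_trans (HN _ Nn)) //; lra.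
    by [].
  by move=> [x y] /= [xN yN]; exact: ball_splitr xN yN.
have ul : u @ \oo --> lim (u @ \oo) by apply: cauchy_cvg cu.
exists (lim (u @ \oo)) => e e0.
by move/cvgrPdist_le : ul => /(_ _ e0)[N _ HN]; exists N => n Nn; exact: HN.
Qed.

Lemma complex_cauchy_cvg (u : nat -> R[i]) :
  (forall e : R, 0 < e -> exists N, forall n, (N <= n)%N -> cmod (u n - u N) <= e) ->
  exists l, forall e : R, 0 < e -> exists N, forall n, (N <= n)%N -> cmod (l - u n) <= e.
Proof.
move=> H.
have [|x Hx] := @real_cauchy_cvg (fun n => complex.Re (u n)).
  move=> e /H[N HN]; exists N => n /HN; apply: le_trans.
  by rewrite -raddfB Re_cmod_le.
have [|y Hy] := @real_cauchy_cvg (fun n => complex.Im (u n)).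
  move=> e /H[N HN]; exists N => n /HN; apply: le_trans.
  by rewrite -raddfB Im_cmod_le.
exists (x +i* y)%C => e e0; have e2 : 0 < e / 2 by rewrite divr_gt0.
have [N HN] := Hx _ e2; have [M HM] := Hy _ e2.
exists (maxn N M) => n; rewrite geq_max => /andP[/HN h1 /HM h2].
rewrite (le_trans (cmod_le_ReIm _)) //.
by move: h1 h2; case: (u n) => a b /=; lra.
Qed.

End ComplexModulus.

Section CompleteBySequences.
Variables (R : realType) (V : normedModType R[i]).
Hypothesis Vcvg : forall u : nat -> V,
  (forall n, rnorm (u n.+1 - u n) <= 2 * 2^-1 ^+ n) -> exists l, rcvg u l.

(** A Cauchy filter contains balls of radius [2^-n]; the limit of their centres is the limit of the
    filter. *)
Lemma complete_by_sequences (F : set_system V) : ProperFilter F -> cauchy F -> cvg F.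
Proof.
move=> FF /cauchyP cF.
have h0 n : 0 < (2^-1 : R) ^+ n by rewrite exprn_gt0 // invr_gt0.
have /choice[b Hb] : forall n, exists q : V, F (ball q ((2^-1 ^+ n)%:C : R[i])).
  by move=> n; apply: cF; rewrite ltcR.
have ballE (p q : V) (e : R) : ball p (e%:C : R[i]) q -> rnorm (p - q) < e.
  by rewrite -ball_normE /ball_ /= normE ltcR.
have [n|l Hl] := Vcvg (u := b).
  have [z [/ballE z1 /ballE z2]] := filter_ex (filterI (Hb n.+1) (Hb n)).
  rewrite -(subrKA z) (le_trans (rnormD _ _)) // (rnormB z).
  by move: z1 z2 (h0 n); rewrite exprS; lra.
apply: (@cvgP _ _ l); apply/cvg_ballP => e e0.
have e0' : 0 < complex.Re e by move: e0; rewrite ltcE => /andP[].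
have e2 : 0 < complex.Re e / 2 by rewrite divr_gt0.
have [N1 H1] := Hl _ e2.
have hh0 : (0 : R) <= 2^-1 by rewrite invr_ge0.
have hh1 : (2^-1 : R) < 1 by lra.
have [N2 H2] := pow_lt_eps hh0 hh1 e2.
pose n := maxn N1 N2.
apply: filterS (Hb n) => z /ballE bz; rewrite -ball_normE /ball_ /= normE.
rewrite -(@RRe_real _ e) ?gtr0_real // ltcR.
rewrite -(subrKA (b n)) (le_lt_trans (rnormD _ _)) //.
by move: (H1 n (leq_maxl _ _)) (H2 n (leq_maxr _ _)) bz; lra.
Qed.

End CompleteBySequences.

(** The form may be degenerate, as for a state. No quotient by null vectors is taken: a null vector
    induces the zero functional in the completion. *)
Record preHilbert (R : realType) (V : lmodType R[i]) := PreHilbert {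
  sform :> V -> V -> R[i];
  sform_linearl : forall (c : R[i]) x y z,
    sform (c *: x + y) z = c * sform x z + sform y z;
  sformC : forall x y, sform y x = conjc (sform x y);
  sform_ge0 : forall x, 0 <= complex.Re (sform x x)
}.

Section Form.
Variables (R : realType) (V : lmodType R[i]) (S : preHilbert V).
Implicit Types (x y z a b : V) (c : R[i]).

Definition fnorm x : R := Num.sqrt (complex.Re (S x x)).

Lemma sform0l z : S 0 z = 0.
Proof.
by have := sform_linearl S (-1) 0 0 z; rewrite scaler0 addr0 mulN1r addNr.
Qed.

Lemma sformZl c x z : S (c *: x) z = c * S x z.
Proof. by have := sform_linearl S c x 0 z; rewrite !addr0 sform0l addr0. Qed.

Lemma sformDl x y z : S (x + y) z = S x z + S y z.
Proof. by have := sform_linearl S 1 x y z; rewrite scale1r mul1r. Qed.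

Lemma sformBl x y z : S (x - y) z = S x z - S y z.
Proof. by rewrite -scaleN1r sformDl sformZl mulN1r. Qed.

Lemma sformDr x y z : S x (y + z) = S x y + S x z.
Proof. by rewrite sformC sformDl rmorphD /= -!sformC. Qed.

Lemma sformZr c x z : S x (c *: z) = conjc c * S x z.
Proof. by rewrite sformC sformZl rmorphM /= -sformC. Qed.

Lemma sformBr x y z : S x (y - z) = S x y - S x z.
Proof. by rewrite sformC sformBl rmorphB /= -!sformC. Qed.

Lemma sform_sqr x : S x x = (fnorm x ^+ 2)%:C.
Proof.
rewrite sqr_sqrtr ?sform_ge0 //.
by have := sformC S x x; case: (S x x) => a b /= [ab]; congr (_ +i* _)%C; lra.
Qed.

Lemma fnorm_ge0 x : 0 <= fnorm x. Proof. exact: sqrtr_ge0. Qed.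

Lemma fnormZ c x : fnorm (c *: x) = cmod c * fnorm x.
Proof.
have -> : fnorm (c *: x) = Num.sqrt ((cmod c * fnorm x) ^+ 2).
  rewrite [LHS]/fnorm sformZl sformZr mulrA (mulrC c) -cmod_sqr sform_sqr -rmorphM.
  by rewrite exprMn.
by rewrite sqrtr_sqr ger0_norm ?mulr_ge0 ?cmod_ge0 ?fnorm_ge0.
Qed.

Lemma fnorm_sqrD x y :
  fnorm (x + y) ^+ 2 = fnorm x ^+ 2 + 2 * complex.Re (S x y) + fnorm y ^+ 2.
Proof.
have E z : fnorm z ^+ 2 = complex.Re (S z z) by rewrite sqr_sqrtr ?sform_ge0.
rewrite !E sformDl !sformDr (sformC S x y).
by case: (S x y) (S x x) (S y y) => u v [u1 v1] [u2 v2] /=; ring.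
Qed.

(** The factor [S x y] makes the cross term real. This quadratic in [t] yields both the
    Cauchy-Schwarz inequality and the orthogonality to a nearest point. *)
Lemma fnorm_sqr_proj x y (t : R) :
  fnorm (x + ((- t)%:C * S x y) *: y) ^+ 2 =
  fnorm x ^+ 2 - 2 * t * cmod (S x y) ^+ 2 + t ^+ 2 * cmod (S x y) ^+ 2 * fnorm y ^+ 2.
Proof.
have E : S x (((- t)%:C * S x y) *: y) = (- t * cmod (S x y) ^+ 2)%:C.
  rewrite sformZr [RHS]rmorphM /= cmod_sqr; case: (S x y) => u v.
  by apply/eqP; rewrite eq_complex /=; apply/andP; split; apply/eqP; ring.
rewrite fnorm_sqrD fnormZ E cmodM cmod_real normrN !exprMn real_normK ?num_real //=.
by ring.
Qed.

Lemma sform_le x y : cmod (S x y) <= fnorm x * fnorm y.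
Proof.
rewrite -(@ler_pXn2r _ 2) ?nnegrE ?mulr_ge0 ?cmod_ge0 ?fnorm_ge0 // exprMn.
have := fnorm_sqr_proj x y.
set M := cmod (S x y) ^+ 2; set X := fnorm x ^+ 2; set Y := fnorm y ^+ 2 => E.
have H t : 0 <= X - 2 * t * M + t ^+ 2 * M * Y by rewrite -E sqr_ge0.
have X0 : 0 <= X by exact: sqr_ge0.
have Y0 : 0 <= Y by exact: sqr_ge0.
have M0 : 0 <= M by exact: sqr_ge0.
have [Y1|Y1] := eqVneq Y 0.
  have [->|M1] := eqVneq M 0; first by rewrite mulr_ge0.
  have Mp : 0 < M by rewrite lt_def M1.
  (* For [Y = 0] the quadratic is affine in [t]; this [t] gives it the value [-1]. *)
  have := H ((X + 1) / M / 2); rewrite Y1 mulr0 addr0.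
  rewrite (_ : 2 * _ * M = X + 1); first by lra.
  by field.
have Yp : 0 < Y by rewrite lt_def Y1.
have := H Y^-1; rewrite (_ : _ - _ + _ = X - M / Y); last by field.
by rewrite subr_ge0 ler_pdivrMr.
Qed.

End Form.

(* The completion is realised inside the conjugate-linear functionals: [f] belongs
   to it when it is a limit, for the dual norm, of functionals [b |-> S a b]. *)
Record completion (R : realType) (V : lmodType R[i]) (S : preHilbert V) := Completion {
  cfun :> V -> R[i];
  cfun_approx : forall e : R, 0 < e ->
    exists a, forall b, cmod (cfun b - S a b) <= e * fnorm S b
}.

HB.instance Definition _ (R : realType) (V : lmodType R[i]) (S : preHilbert V) :=
  gen_eqMixin (completion S).
HB.instance Definition _ (R : realType) (V : lmodType R[i]) (S : preHilbert V) :=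
  gen_choiceMixin (completion S).

Section CompletionModule.
Variables (R : realType) (V : lmodType R[i]) (S : preHilbert V).
Implicit Types (f g h : completion S) (a b : V) (c : R[i]).

Lemma cfun_ext f g : (forall b, f b = g b) -> f = g.
Proof.
case: f g => f Hf [g Hg] /= fg; have fgE : f = g by apply/funext.
by subst g; congr (Completion _); exact: Prop_irrelevance.
Qed.

Lemma embed_subproof a (e : R) : 0 < e ->
  exists a', forall b, cmod (S a b - S a' b) <= e * fnorm S b.
Proof.
by move=> e0; exists a => b; rewrite subrr cmod0 mulr_ge0 ?fnorm_ge0 ?ltW.
Qed.
Definition embed a : completion S := Completion (@embed_subproof a).

Lemma cadd_subproof f g (e : R) : 0 < e ->
  exists a, forall b, cmod (f b + g b - S a b) <= e * fnorm S b.
Proof.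
move=> e0; have e2 : 0 < e / 2 by rewrite divr_gt0.
have [a Ha] := cfun_approx f e2; have [a' Ha'] := cfun_approx g e2.
exists (a + a') => b; rewrite (sformDl S a a' b) opprD addrACA (le_trans (cmodD _ _)) //.
by have := Ha b; have := Ha' b; lra.
Qed.
Definition cadd f g : completion S := Completion (@cadd_subproof f g).

Lemma cscale_subproof c f (e : R) : 0 < e ->
  exists a, forall b, cmod (c * f b - S a b) <= e * fnorm S b.
Proof.
move=> e0; have c1 : 0 < cmod c + 1 by rewrite ltr_wpDl ?cmod_ge0.
have [a Ha] := cfun_approx f (divr_gt0 e0 c1).
exists (c *: a) => b; rewrite sformZl -mulrBr cmodM.
rewrite (le_trans (ler_wpM2l (cmod_ge0 c) (Ha b))) // mulrA ler_wpM2r ?fnorm_ge0 //.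
by rewrite mulrA ler_pdivrMr // mulrC ler_wpM2l ?(ltW e0) // lerDl.
Qed.
Definition cscale c f : completion S := Completion (@cscale_subproof c f).

Definition copp f := cscale (-1) f.

Lemma caddA : associative cadd.
Proof. by move=> f g h; apply: cfun_ext => b /=; rewrite addrA. Qed.

Lemma caddC : commutative cadd.
Proof. by move=> f g; apply: cfun_ext => b /=; rewrite addrC. Qed.

Lemma cadd0 : left_id (embed 0) cadd.
Proof. by move=> f; apply: cfun_ext => b /=; rewrite sform0l add0r. Qed.

Lemma caddN : left_inverse (embed 0) copp cadd.
Proof. by move=> f; apply: cfun_ext => b /=; rewrite sform0l mulN1r addNr. Qed.

HB.instance Definition _ := GRing.isZmodule.Build (completion S) caddA caddC cadd0 caddN.

Lemma cscaleA (b c : R[i]) f : cscale b (cscale c f) = cscale (b * c) f.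
Proof. by apply: cfun_ext => x /=; rewrite mulrA. Qed.

Lemma cscale1 : left_id 1 cscale.
Proof. by move=> f; apply: cfun_ext => x /=; rewrite mul1r. Qed.

Lemma cscaleDr : right_distributive cscale +%R.
Proof. by move=> c f g; apply: cfun_ext => x /=; rewrite mulrDr. Qed.

Lemma cscaleDl f : {morph cscale^~ f : b c / b + c}.
Proof. by move=> b c; apply: cfun_ext => x /=; rewrite mulrDl. Qed.

HB.instance Definition _ := GRing.Zmodule_isLmodule.Build R[i] (completion S)
  cscaleA cscale1 cscaleDr cscaleDl.

Lemma cfunD f g b : (f + g) b = f b + g b. Proof. by []. Qed.
Lemma cfunZ c f b : (c *: f) b = c * f b. Proof. by []. Qed.
Lemma cfunN f b : (- f) b = - f b. Proof. by rewrite /= mulN1r. Qed.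
Lemma cfunB f g b : (f - g) b = f b - g b. Proof. by rewrite cfunD cfunN. Qed.
Lemma cfun0 b : (0 : completion S) b = 0. Proof. exact: sform0l. Qed.
Lemma embedE a b : embed a b = S a b. Proof. by []. Qed.

Definition cnorm f : R :=
  inf [set t : R | 0 <= t /\ forall b, cmod (f b) <= t * fnorm S b].

Lemma cnorm_has_inf f :
  has_inf [set t : R | 0 <= t /\ forall b, cmod (f b) <= t * fnorm S b].
Proof.
split; last by exists 0 => t [].
have [a Ha] := cfun_approx f ltr01.
exists (1 + fnorm S a); split; first by rewrite addr_ge0 ?fnorm_ge0.
move=> b; rewrite -[f b](subrK (S a b)) (le_trans (cmodD _ _)) // mulrDl.
by rewrite lerD // sform_le.
Qed.

Lemma cnorm_le f t : 0 <= t -> (forall b, cmod (f b) <= t * fnorm S b) -> cnorm f <= t.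
Proof. by move=> t0 H; apply: ge_inf => //; case: (cnorm_has_inf f). Qed.

Lemma cnorm_ge0 f : 0 <= cnorm f.
Proof. by apply: lb_le_inf => [|t []//]; case: (cnorm_has_inf f). Qed.

Lemma cfun_le f b : cmod (f b) <= cnorm f * fnorm S b.
Proof.
apply/ler_addgt0Pr => e e0.
have b1 : 0 < fnorm S b + 1 by rewrite ltr_wpDl ?fnorm_ge0.
have [t [t0 Ht] lt] := inf_adherent (divr_gt0 e0 b1) (cnorm_has_inf f).
rewrite (le_trans (Ht b)) // (le_trans (ler_wpM2r (fnorm_ge0 _ _) (ltW lt))) //.
rewrite -/(cnorm f) mulrDl lerD2l mulrAC ler_pdivrMr // ler_wpM2l ?(ltW e0) //.
by rewrite lerDl.
Qed.

Lemma cnormD f g : cnorm (f + g) <= cnorm f + cnorm g.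
Proof.
apply: cnorm_le => [|b]; first by rewrite addr_ge0 ?cnorm_ge0.
by rewrite cfunD (le_trans (cmodD _ _)) // mulrDl lerD // cfun_le.
Qed.

Lemma cnormZ c f : cnorm (c *: f) = cmod c * cnorm f.
Proof.
have half d g : cnorm (d *: g) <= cmod d * cnorm g.
  apply: cnorm_le => [|b]; first by rewrite mulr_ge0 ?cmod_ge0 ?cnorm_ge0.
  by rewrite cfunZ cmodM -mulrA ler_wpM2l ?cmod_ge0 // cfun_le.
apply/eqP; rewrite eq_le half /=.
have [->|c0] := eqVneq c 0; first by rewrite cmod0 mul0r cnorm_ge0.
have c1 : 0 < cmod c.
  by rewrite lt_def cmod_ge0 andbT; apply: contra_neq c0; exact: cmod_eq0.
have h1 : cmod c^-1 * cmod c = 1 by rewrite -cmodM mulVf // (cmod_real 1) normr1.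
have := half c^-1 (c *: f); rewrite scalerA mulVf // scale1r.
move/(ler_wpM2l (ltW c1)); rewrite mulrA (mulrC (cmod c) (cmod c^-1)) h1 mul1r.
by [].
Qed.

Lemma cnorm_eq0 f : cnorm f = 0 -> f = 0.
Proof.
move=> f0; apply: cfun_ext => b; rewrite cfun0; apply: cmod_eq0.
by apply/eqP; rewrite eq_le cmod_ge0 andbT (le_trans (cfun_le f b)) // f0 mul0r.
Qed.

Let normD f g : (cnorm (f + g))%:C <= (cnorm f)%:C + (cnorm g)%:C.
Proof. by rewrite -rmorphD lecR cnormD. Qed.

Let normZ c f : (cnorm (c *: f))%:C = `|c| * (cnorm f)%:C.
Proof. by rewrite cnormZ [LHS]rmorphM /= -cmodE. Qed.

Let norm_eq0 f : (cnorm f)%:C = 0 -> f = 0.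
Proof. by move=> /complexI; exact: cnorm_eq0. Qed.

HB.instance Definition _ := Lmodule_isNormed.Build R[i] (completion S) normD normZ norm_eq0.

Lemma rnorm_cnorm f : rnorm f = cnorm f. Proof. by []. Qed.

Lemma cnorm_embed a : cnorm (embed a) = fnorm S a.
Proof.
apply/eqP; rewrite eq_le; apply/andP; split.
  by apply: cnorm_le; [exact: fnorm_ge0|move=> b; exact: sform_le].
have [->|a1] := eqVneq (fnorm S a) 0; first exact: cnorm_ge0.
have a0 : 0 < fnorm S a by rewrite lt_def a1 fnorm_ge0.
have := cfun_le (embed a) a; rewrite embedE sform_sqr cmod_real ger0_norm ?sqr_ge0 //.
by rewrite expr2 ler_pM2r.
Qed.

Lemma embed_dense f (e : R) : 0 < e -> exists a, cnorm (f - embed a) <= e.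
Proof.
move=> e0; have [a Ha] := cfun_approx f e0; exists a.
by apply: cnorm_le => [|b]; [exact: ltW|rewrite cfunB; exact: Ha].
Qed.

Lemma embed_linear c a b : embed (c *: a + b) = c *: embed a + embed b.
Proof. by apply: cfun_ext => x; rewrite embedE sform_linearl. Qed.

Lemma embedB a b : embed (a - b) = embed a - embed b.
Proof. by rewrite addrC -scaleN1r embed_linear scaleN1r addrC. Qed.

Lemma completion_complete (F : set_system (completion S)) :
  ProperFilter F -> cauchy F -> cvg F.
Proof.
apply: complete_by_sequences => u uS.
have h0 : (0 : R) <= 2^-1 by rewrite invr_ge0.
have h1 : (2^-1 : R) < 1 by lra.
have uN n k : cnorm (u (n + k)%N - u n) <= 4 * 2^-1 ^+ n.
  suff : cnorm (u (n + k)%N - u n) <= 4 * 2^-1 ^+ n * (1 - 2^-1 ^+ k).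
    move/le_trans; apply; rewrite ler_piMr ?mulr_ge0 ?exprn_ge0 //.
    by rewrite gerBl exprn_ge0.
  elim: k => [|k IH].
    by rewrite addn0 subrr expr0 subrr mulr0 -rnorm_cnorm rnorm0.
  rewrite addnS -(subrKA (u (n + k)%N)) (le_trans (cnormD _ _)) //.
  have := uS (n + k)%N; rewrite rnorm_cnorm exprD exprS; move: IH; lra.
have ub n k b : cmod (u (n + k)%N b - u n b) <= 4 * 2^-1 ^+ n * fnorm S b.
  by rewrite -cfunB (le_trans (cfun_le _ _)) // ler_wpM2r ?fnorm_ge0.
have /choice[f Hf] : forall b, exists l, forall e : R, 0 < e ->
    exists N, forall n, (N <= n)%N -> cmod (l - u n b) <= e.
  move=> b; apply: complex_cauchy_cvg => e e0.
  have b1 : 0 < fnorm S b + 1 by rewrite ltr_wpDl ?fnorm_ge0.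
  have [|N HN] := pow_lt_eps h0 h1 (e := e / 4 / (fnorm S b + 1)).
    by rewrite !divr_gt0.
  exists N => n Nn; rewrite -(subnKC Nn) (le_trans (ub _ _ _)) //.
  have := HN N (leqnn N); rewrite ltr_pdivlMr // => h.
  have q0 : 0 <= (2^-1 : R) ^+ N by rewrite exprn_ge0.
  by have := fnorm_ge0 S b; nra.
have fu n b : cmod (f b - u n b) <= 4 * 2^-1 ^+ n * fnorm S b.
  apply/ler_addgt0Pr => e e0; have [N HN] := Hf b e e0.
  have := HN (n + N)%N (leq_addl _ _); have := ub n N b.
  have := cmodD (f b - u (n + N)%N b) (u (n + N)%N b - u n b).
  by rewrite subrKA; lra.
have fa (e : R) : 0 < e -> exists a, forall b, cmod (f b - S a b) <= e * fnorm S b.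
  move=> e0; have e8 : 0 < e / 8 by rewrite divr_gt0.
  have [N HN] := pow_lt_eps h0 h1 e8.
  have e2 : 0 < e / 2 by rewrite divr_gt0.
  have [a Ha] := cfun_approx (u N) e2; exists a => b.
  have := cmodD (f b - u N b) (u N b - S a b); rewrite subrKA.
  by have := fu N b; have := Ha b; have := HN N (leqnn N); have := fnorm_ge0 S b; nra.
exists (Completion fa) => e e0.
have e4 : 0 < e / 4 by rewrite divr_gt0.
have [N HN] := pow_lt_eps h0 h1 e4.
exists N => n Nn; apply: cnorm_le => [|b]; first exact: ltW.
rewrite cfunB (le_trans (fu n b)) // ler_wpM2r ?fnorm_ge0 //.
by have := HN n Nn; lra.
Qed.

HB.instance Definition _ := Uniform_isComplete.Build (completion S) completion_complete.

End CompletionModule.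

Section CompletionInner.
Variables (R : realType) (V : lmodType R[i]) (S : preHilbert V).
Implicit Types (f g h : completion S) (a b : V) (c : R[i]).

Lemma cnorm0 : cnorm (0 : completion S) = 0.
Proof. exact: (@rnorm0 R (completion S)). Qed.

(** Additivity is not a field of [completion]; it is inherited from the approximating
    functionals. *)
Lemma cfun_sub f a b : f (a - b) = f a - f b.
Proof.
apply/eqP; rewrite -subr_eq0; apply/eqP/cmod_eq0/eqP; rewrite eq_le cmod_ge0 andbT.
apply/ler_addgt0Pr => e e0; rewrite add0r.
pose k := fnorm S (a - b) + fnorm S a + fnorm S b + 1.
have k0 : 0 < k by rewrite ltr_wpDl // !addr_ge0 ?fnorm_ge0.
have [x Hx] := cfun_approx f (divr_gt0 e0 k0).
have -> : f (a - b) - (f a - f b) =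
    (f (a - b) - S x (a - b)) - (f a - S x a) + (f b - S x b).
  by rewrite sformBr; ring.
rewrite (le_trans (cmodD _ _)) // (le_trans (lerD (cmodD _ _) (lexx _))) // cmodN.
rewrite (le_trans (lerD (lerD (Hx _) (Hx _)) (Hx _))) // -!mulrDr.
by rewrite -mulrA ler_piMr ?(ltW e0) // mulrC ler_pdivrMr // mul1r lerDl.
Qed.

(** The inner product with [g] is the limit of [f a] as [embed S a] tends to [g]. The estimate
    characterises it without reference to a particular sequence. *)
Lemma cinner_ex f g : exists c, forall a,
  cmod (c - f a) <= cnorm f * cnorm (g - embed S a).
Proof.
have h0 : (0 : R) <= 2^-1 by rewrite invr_ge0.
have h1 : (2^-1 : R) < 1 by lra.
have p0 n : (0 : R) < 2^-1 ^+ n by rewrite exprn_gt0 // invr_gt0.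
have /choice[u Hu] : forall n, exists a, cnorm (g - embed S a) <= 2^-1 ^+ n.
  by move=> n; exact: embed_dense.
have fab a b : cmod (f a - f b) <=
    cnorm f * (cnorm (g - embed S a) + cnorm (g - embed S b)).
  rewrite -cfun_sub (le_trans (cfun_le _ _)) // ler_wpM2l ?cnorm_ge0 //.
  rewrite -cnorm_embed embedB.
  have -> : embed S a - embed S b = - (g - embed S a) + (g - embed S b).
    by rewrite opprB addrA subrK.
  by rewrite (le_trans (cnormD _ _)) // -!rnorm_cnorm rnormN.
have [|c Hc] := @complex_cauchy_cvg R (fun n => f (u n)).
  move=> e e0; have k0 : 0 < cnorm f * 2 + 1 by rewrite ltr_wpDl // mulr_ge0 ?cnorm_ge0.
  have [N HN] := pow_lt_eps h0 h1 (divr_gt0 e0 k0).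
  exists N => n Nn; rewrite (le_trans (fab _ _)) //.
  have := HN n Nn; have := HN N (leqnn N); rewrite !ltr_pdivlMr //.
  have := Hu n; have := Hu N; have := cnorm_ge0 f; have := p0 N; have := p0 n; nra.
exists c => a; apply/ler_addgt0Pr => e e0; have e2 : 0 < e / 2 by rewrite divr_gt0.
have k0 : 0 < cnorm f + 1 by rewrite ltr_wpDl // cnorm_ge0.
have [N HN] := Hc _ e2; have [M HM] := pow_lt_eps h0 h1 (divr_gt0 e2 k0).
pose n := maxn N M.
have h2 := HN n (leq_maxl _ _); have := HM n (leq_maxr _ _); rewrite ltr_pdivlMr // => h3.
have := cmodD (c - f (u n)) (f (u n) - f a); rewrite subrKA => h4.
by have := fab (u n) a; have := Hu n; have := cnorm_ge0 f; have := p0 n; nra.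
Qed.

Definition cinner f g : R[i] :=
  xget 0 [set c | forall a, cmod (c - f a) <= cnorm f * cnorm (g - embed S a)].

Lemma cinnerP f g a : cmod (cinner f g - f a) <= cnorm f * cnorm (g - embed S a).
Proof.
rewrite /cinner; case: xgetP => [c _ //|H]; exfalso.
by have [c Hc] := cinner_ex f g; exact: (H c).
Qed.

(** Density of the embedded vectors reduces an identity to an error linear in the distance to [g].
    Only approximants within distance [1] count, so that [k] can absorb quadratic errors. *)
Lemma embed_eq g (x y : R[i]) (k : R) :
  (forall a, cnorm (g - embed S a) <= 1 -> cmod (x - y) <= k * cnorm (g - embed S a)) ->
  x = y.
Proof.
move=> H; apply/eqP; rewrite -subr_eq0; apply/eqP/cmod_eq0/eqP.
rewrite eq_le cmod_ge0 andbT; apply/ler_addgt0Pr => e e0; rewrite add0r.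
have k0 : 0 < `|k| + 1 by rewrite ltr_wpDl.
have d0 : 0 < Num.min 1 (e / (`|k| + 1)) by rewrite lt_min ltr01 divr_gt0.
have [a] := embed_dense g d0; rewrite le_min => /andP[a1 Ha].
rewrite (le_trans (H a a1)) // (le_trans (ler_wpM2r (cnorm_ge0 _) (ler_norm k))) //.
move: Ha; rewrite ler_pdivlMr //; have := cnorm_ge0 (g - embed S a); nra.
Qed.

Lemma cinner_linear c f g h : cinner (c *: f + g) h = c * cinner f h + cinner g h.
Proof.
apply: (@embed_eq h _ _ (cnorm (c *: f + g) + (cmod c * cnorm f + cnorm g))) => a _.
have -> : cinner (c *: f + g) h - (c * cinner f h + cinner g h) =
   (cinner (c *: f + g) h - (c *: f + g) a)
   - (c * (cinner f h - f a) + (cinner g h - g a)) by rewrite cfunD cfunZ; ring.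
rewrite (le_trans (cmodD _ _)) // cmodN mulrDl lerD ?cinnerP //.
rewrite (le_trans (cmodD _ _)) // mulrDl lerD ?cinnerP // cmodM -mulrA.
by rewrite ler_wpM2l ?cmod_ge0 // cinnerP.
Qed.

Lemma cinner_embedr f a : cinner f (embed S a) = f a.
Proof.
apply/eqP; rewrite -subr_eq0; apply/eqP/cmod_eq0/eqP; rewrite eq_le cmod_ge0 andbT.
by have := cinnerP f (embed S a) a; rewrite subrr cnorm0 mulr0.
Qed.

Lemma cinner_le f g : cmod (cinner f g) <= cnorm f * cnorm g.
Proof.
have f0 : f 0 = 0 by rewrite -(subrr 0) cfun_sub subrr.
have e0 : embed S 0 = 0 by [].
by have := cinnerP f g 0; rewrite f0 e0 !subr0.
Qed.

Lemma cinnerC f g : cinner g f = conjc (cinner f g).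
Proof.
have conjcB' (x y : R[i]) : conjc (x - y) = conjc x - conjc y by exact: rmorphB.
have half f' a : cinner (embed S a) f' = conjc (f' a).
  apply: (@embed_eq f' _ _ (fnorm S a + fnorm S a)) => b _.
  have -> : cinner (embed S a) f' - conjc (f' a) =
     (cinner (embed S a) f' - embed S a b) - conjc (f' a - S b a).
    by rewrite embedE (sformC S b a) conjcB'; ring.
  rewrite (le_trans (cmodD _ _)) // cmodN cmod_conj mulrDl lerD //.
    by rewrite (le_trans (cinnerP _ _ _)) // cnorm_embed.
  by have := cfun_le (f' - embed S b) a; rewrite cfunB mulrC.
apply: (@embed_eq g _ _ (cnorm f + cnorm f)) => a _.
have -> : cinner g f - conjc (cinner f g) =
    cinner ((-1) *: embed S a + g) f - conjc (cinner f g - f a).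
  by rewrite cinner_linear half conjcB'; ring.
rewrite (le_trans (cmodD _ _)) // cmodN cmod_conj mulrDl lerD ?cinnerP //.
by rewrite (le_trans (cinner_le _ _)) // scaleN1r addrC mulrC.
Qed.

Lemma cinner_norm f : cinner f f = `|f| ^+ 2.
Proof.
rewrite normE -rmorphXn rnorm_cnorm.
(* The three summands bound the errors in [cinner f f - f a], in [f a - S a a] and in the difference
   of the squared norms, using [fnorm S a <= cnorm f + 1]. *)
apply: (@embed_eq f _ _ (cnorm f + (cnorm f + 1) + (2 * cnorm f + 1))) => a a1.
have h1 : cmod (f a - S a a) <= cnorm (f - embed S a) * fnorm S a.
  by have := cfun_le (f - embed S a) a; rewrite cfunB.
have h2 : `|fnorm S a - cnorm f| <= cnorm (f - embed S a).
  rewrite -cnorm_embed ler_norml; apply/andP; split.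
    by have := cnormD (f - embed S a) (embed S a); rewrite subrK; lra.
  have := cnormD (- (f - embed S a)) f; rewrite opprB subrK.
  by rewrite -[X in _ <= X + _ -> _]rnorm_cnorm rnormB rnorm_cnorm; lra.
have -> : cinner f f - (cnorm f ^+ 2)%:C = (cinner f f - f a) + (f a - S a a)
    + (fnorm S a ^+ 2 - cnorm f ^+ 2)%:C by rewrite sform_sqr rmorphB; ring.
rewrite (le_trans (cmodD _ _)) // mulrDl lerD //.
  rewrite (le_trans (cmodD _ _)) // mulrDl lerD ?cinnerP //.
  rewrite (le_trans h1) // mulrC ler_wpM2r ?cnorm_ge0 //.
  by move: h2; rewrite ler_norml => /andP[]; lra.
rewrite cmod_real subr_sqr normrM mulrC ler_pM //.
rewrite ger0_norm ?addr_ge0 ?fnorm_ge0 ?cnorm_ge0 //.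
by move: h2; rewrite ler_norml => /andP[]; lra.
Qed.

HB.instance Definition _ := CompleteNormedModule_isHilbert.Build R (completion S)
  cinner_linear cinnerC cinner_norm.

Lemma inner_embedr f a : inner f (embed S a) = f a.
Proof. exact: cinner_embedr. Qed.

End CompletionInner.

(** * Hilbert space projections *)

Section HilbertProjection.
Variables (R : realType) (H : hilbertType R).
Implicit Types (x y u v w : H).

Lemma inner_ge0 x : 0 <= complex.Re (inner x x).
Proof. by rewrite inner_sqr sqr_ge0. Qed.

Definition inner_form : preHilbert H :=
  PreHilbert (@inner_linearl R H) (@innerC R H) inner_ge0.

Lemma fnorm_inner x : fnorm inner_form x = rnorm x.
Proof. by rewrite /fnorm /= inner_sqr /= sqrtr_sqr ger0_norm ?rnorm_ge0. Qed.

Lemma innerDl x y z : inner (x + y) z = inner x z + inner y z.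
Proof. exact: (sformDl inner_form). Qed.

Lemma innerZl (c : R[i]) x z : inner (c *: x) z = c * inner x z.
Proof. exact: (sformZl inner_form). Qed.

Lemma innerDr x y z : inner x (y + z) = inner x y + inner x z.
Proof. exact: (sformDr inner_form). Qed.

Lemma inner_eq0C x y : inner x y = 0 -> inner y x = 0.
Proof. by move=> xy; rewrite innerC xy rmorph0. Qed.

Lemma parallelogram x y :
  rnorm (x + y) ^+ 2 + rnorm (x - y) ^+ 2 = 2 * rnorm x ^+ 2 + 2 * rnorm y ^+ 2.
Proof.
have := fnorm_sqrD inner_form x (- y); have := fnorm_sqrD inner_form x y.
rewrite !fnorm_inner rnormN => -> ->.
have -> : inner_form x (- y) = - inner_form x y.
  have := sformDr inner_form x y (- y); rewrite subrr => h.
  apply/eqP; rewrite -addr_eq0 addrC -h.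
  by rewrite (sformC inner_form 0 x) sform0l conjc0.
by rewrite raddfN; ring.
Qed.

Lemma hilbert_projection (V : set H) x : V 0 ->
  (forall (c : R[i]) y z, V y -> V z -> V (c *: y + z)) -> closed V ->
  exists2 v, V v & forall u, V u -> inner (x - v) u = 0.
Proof.
move=> V0 Vl Vc; pose D := [set rnorm (x - v) | v in V].
have hD : has_inf D.
  split; first by exists (rnorm (x - 0)); exists 0.
  by exists 0 => _ [v _ <-]; exact: rnorm_ge0.
set d := inf D.
have dle v : V v -> d <= rnorm (x - v).
  by move=> Vv; apply: ge_inf; [case: hD|exists v].
have d0 : 0 <= d by apply: lb_le_inf => [|_ [v _ <-]]; [case: hD|exact: rnorm_ge0].
have h0 : (0 : R) <= 2^-1 by rewrite invr_ge0.
have h1 : (2^-1 : R) < 1 by lra.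
have p0 n : (0 : R) < 2^-1 ^+ n by rewrite exprn_gt0 // invr_gt0.
have /choice[s Hs] : forall n, exists v, V v /\ rnorm (x - v) <= d + 2^-1 ^+ n.
  by move=> n; have [_ [v Vv <-] /ltW h] := inf_adherent (p0 n) hD; exists v.
(* The midpoint stays at distance at least [d], so the parallelogram law leaves
   [4 (d + e)^2 - 4 d^2 = 4 e (2 d + e)], and [e <= 1]. *)
have ss (e : R) m n : 0 <= e -> e <= 1 -> rnorm (x - s m) <= d + e ->
    rnorm (x - s n) <= d + e -> rnorm (s n - s m) ^+ 2 <= 4 * e * (2 * d + 1).
  move=> e0 e1 hm hn; have := parallelogram (x - s m) (x - s n).
  have -> : x - s m - (x - s n) = s n - s m by rewrite opprB addrC addrA subrK.
  pose mid := (2^-1 : R)%:C *: s m + ((2^-1 : R)%:C *: s n + 0).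
  have Vmid : V mid.
    by apply: (Vl); [case: (Hs m)|apply: (Vl) => //; case: (Hs n)].
  have -> : x - s m + (x - s n) = (2%:R : R)%:C *: (x - mid).
    rewrite /mid addr0 -scalerDr scalerBr scalerA -rmorphM mulfV ?pnatr_eq0 // scale1r.
    by rewrite rmorph_nat scaler_nat mulr2n opprD addrACA.
  rewrite rnormZr ger0_norm // exprMn.
  have := dle _ Vmid; have := rnorm_ge0 (x - s m); have := rnorm_ge0 (x - s n).
  move: (rnorm (x - s m)) (rnorm (x - s n)) hm hn (rnorm (x - mid)) => a b ha hb c b0 a0 dc E.
  have : a ^+ 2 <= (d + e) ^+ 2 by rewrite ler_pXn2r ?nnegrE // addr_ge0.
  have : b ^+ 2 <= (d + e) ^+ 2 by rewrite ler_pXn2r ?nnegrE // addr_ge0.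
  have : d ^+ 2 <= c ^+ 2 by rewrite ler_pXn2r ?nnegrE // (le_trans d0).
  rewrite sqrrD; nra.
have [|v sv] := rnorm_cauchy_cvg (u := s).
  move=> e e0; have k0 : 0 < 4 * (2 * d + 1) by lra.
  have [N HN] := pow_lt_eps h0 h1 (divr_gt0 (exprn_gt0 2 e0) k0).
  exists N => n Nn; rewrite -(@ler_pXn2r _ 2) ?nnegrE ?rnorm_ge0 ?(ltW e0) //.
  have pn : 2^-1 ^+ n <= 2^-1 ^+ N :> R by rewrite ler_wiXn2l // ltW.
  rewrite (le_trans (ss (2^-1 ^+ N) N n _ _ _ _)) ?(ltW (p0 N)) //.
  - by rewrite exprn_ile1 // ltW.
  - by case: (Hs N).
  - by case: (Hs n) => _ /le_trans; apply; rewrite lerD2l.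
  - by have := HN N (leqnn N); rewrite ltr_pdivlMr //; lra.
have Vv : V v by apply: (rcvg_closed Vc sv) => n; case: (Hs n).
have xv : rnorm (x - v) <= d.
  apply/ler_addgt0Pr => e e0; have e2 : 0 < e / 2 by rewrite divr_gt0.
  have [N HN] := sv _ e2; have [M HM] := pow_lt_eps h0 h1 e2.
  pose n := maxn N M; have := HN n (leq_maxl _ _); have := HM n (leq_maxr _ _).
  have := rnormD (x - s n) (s n - v); rewrite subrKA (rnormB (s n)).
  by case: (Hs n) => _; lra.
exists v => // u Vu; apply/cmod_eq0/eqP; rewrite -sqrf_eq0 eq_le sqr_ge0 andbT.
set w := x - v; pose q := rnorm u ^+ 2.
have q1 : 0 < q + 1 by rewrite ltr_wpDl ?sqr_ge0.
(* With [t q <= 1], moving from [w] by [z] lowers the squared norm by at least [t M], so minimality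
   forces [M = 0]. Adding [1] to [q] covers [u = 0]. *)
pose t := (q + 1)^-1; have t0 : 0 < t by rewrite invr_gt0.
have := fnorm_sqr_proj inner_form w u t; rewrite !fnorm_inner /=.
set z := _ *: u; set M := cmod _ ^+ 2 => E.
have Vz : V (v - z).
  by rewrite /z addrC -scaleNr; exact: Vl.
have : rnorm w ^+ 2 <= rnorm (w + z) ^+ 2.
  rewrite ler_pXn2r ?nnegrE ?rnorm_ge0 // (le_trans xv) //.
  by have := dle _ Vz; rewrite opprB addrCA addrC /w.
rewrite E -/q; have M0 : 0 <= M by exact: sqr_ge0.
have tq : t * q <= 1 by rewrite /t mulrC ler_pdivrMr // mul1r lerDl.
have h : t ^+ 2 * M * q <= t * M.
  by rewrite (_ : _ * q = t * M * (t * q)); [rewrite ler_piMr // mulr_ge0 // ltW|ring].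
move=> h'; have tM : t * M <= 0 by lra.
by move: tM; rewrite pmulr_rle0.
Qed.

End HilbertProjection.

(** * Pure states and irreducible representations *)

Section PureState.
Variables (R : realType) (D : cstarAlgType R).
Hypothesis one0 : (1 : D) <> 0.
Implicit Types (x y : D) (t l : R).
Local Notation half := ((2^-1 : R)%:C).

Definition cre x : D := half *: (x + star x).

Lemma cre_sa x : star (cre x) = cre x.
Proof. by rewrite /cre starZr starD starK addrC. Qed.

Lemma cre_id x : star x = x -> cre x = x.
Proof. by move=> sx; rewrite /cre sx; nc. Qed.

Lemma creD x y : cre (x + y) = cre x + cre y.
Proof. by rewrite /cre starD -scalerDr addrACA. Qed.

Lemma creZ t x : cre (t%:C *: x) = t%:C *: cre x.
Proof. by rewrite /cre starZr -scalerDr scalerA mulrC -scalerA. Qed.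

(* The largest value at [x] of (the real part of) a state. *)
Definition state_bound x : R := inf [set t : R | pos (t%:C *: (1 : D) - cre x)].

Lemma state_bound_has_inf x : has_inf [set t : R | pos (t%:C *: (1 : D) - cre x)].
Proof.
split; first by exists (rnorm (cre x)); exact/pos_norm_sub/cre_sa.
exists (- rnorm (cre x)) => t /= pt; rewrite -subr_ge0 opprK.
apply: (pos_cst_ge0 one0); have := posD pt (pos_norm_add (cre_sa x)).
by move: (cre x) => y; rewrite (_ : _ - y + _ = (t + rnorm y)%:C *: (1 : D)) //; nc.
Qed.

Lemma state_bound_le x t : pos (t%:C *: (1 : D) - cre x) -> state_bound x <= t.
Proof. by move=> pt; apply: ge_inf => //; case: (state_bound_has_inf x). Qed.

Lemma le_state_bound x (c : R) :
  (forall t, pos (t%:C *: (1 : D) - cre x) -> c <= t) -> c <= state_bound x.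
Proof. by move=> H; apply: lb_le_inf => //; case: (state_bound_has_inf x). Qed.

Lemma state_bound_sublinear : sublinear state_bound.
Proof.
split=> [x y|t x t0].
  apply/ler_addgt0Pr => e e0; have e2 : 0 < e / 2 by rewrite divr_gt0.
  have [t pt Ht] := inf_adherent e2 (state_bound_has_inf x).
  have [s ps Hs] := inf_adherent e2 (state_bound_has_inf y).
  rewrite -/(state_bound x) in Ht; rewrite -/(state_bound y) in Hs.
  apply: le_trans (state_bound_le (t := t + s) _) _; last by lra.
  have := posD pt ps; rewrite creD.
  by congr (pos _); move: (cre x) (cre y) => u v; nc.
have hf s y : 0 < s -> state_bound (s%:C *: y) <= s * state_bound y.
  move=> s0; rewrite mulrC -ler_pdivrMr //; apply: le_state_bound => u pu.
  rewrite ler_pdivrMr //; apply: state_bound_le.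
  have := posZ (ltW s0) pu; rewrite creZ.
  by congr (pos _); move: (cre y) => v; nc.
apply/eqP; rewrite eq_le hf //=.
have ti : 0 < t^-1 by rewrite invr_gt0.
have := hf t^-1 (t%:C *: x) ti.
by rewrite scalerA -rmorphM mulVf ?gt_eqF // scale1r ler_pdivlMl.
Qed.

(** The real part of a positive functional; invariance under [star] expresses that the functional is
    hermitian. *)
Definition state_like (f : D -> R) :=
  [/\ rlinear f, forall x, f (star x) = f x & forall x, pos x -> 0 <= f x].

Definition pure_state (f : D -> R) := [/\ state_like f, f 1 = 1 &
  forall g, state_like g -> (forall x, pos x -> g x <= f x) -> 0 < g 1 < 1 ->
  forall x, g x = g 1 * f x].

Lemma rlinearN (f : D -> R) x : rlinear f -> f (- x) = - f x.
Proof. by move=> [_ /(_ (-1) x)]; rewrite rmorphN1 scaleN1r mulN1r. Qed.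

Lemma rlinearB (f : D -> R) x y : rlinear f -> f (x - y) = f x - f y.
Proof. by move=> lf; rewrite lf.1 rlinearN. Qed.

Lemma state_like_le g x : state_like g -> g 1 = 1 -> g x <= state_bound x.
Proof.
move=> [lg sg pg] g1; apply: le_state_bound => t /pg.
rewrite rlinearB // lg.2 g1 mulr1 lg.2 lg.1 sg.
by rewrite subr_ge0; lra.
Qed.

(** The bound sees only [cre x]: it vanishes at [star x - x] and at its opposite, which gives
    invariance. It is at most [0] at [- x] for positive [x], which gives positivity, and its values
    at [1] and [- 1] fix the normalisation. *)
Lemma state_bound_state_like f : rlinear f -> (forall x, f x <= state_bound x) ->
  state_like f /\ f 1 = 1.
Proof.
move=> lf fb.
have bneg x : pos x -> f (- x) <= 0.
  move=> px; rewrite (le_trans (fb _)) //; apply: state_bound_le.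
  by rewrite cre_id ?starN ?(pos_sa px) // opprK scale0r add0r.
have f0 x : cre x = 0 -> f x <= 0.
  move=> x0; rewrite (le_trans (fb _)) //; apply: state_bound_le.
  by rewrite x0 subr0 scale0r; exact: pos0.
have fst x : f (star x) = f x.
  have h1 : cre (star x - x) = 0 by rewrite /cre starB starK; nc.
  have h2 : cre (x - star x) = 0 by rewrite /cre starB starK; nc.
  by have := f0 _ h1; have := f0 _ h2; rewrite !rlinearB //; lra.
split; first split=> // x px.
  by have := bneg x px; rewrite rlinearN //; lra.
apply/eqP; rewrite eq_le; apply/andP; split.
  rewrite (le_trans (fb _)) //; apply: state_bound_le.
  by rewrite cre_id ?star1 // scale1r subrr; exact: pos0.
have : f (- 1) <= -1.
  rewrite (le_trans (fb _)) //; apply: state_bound_le.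
  by rewrite cre_id ?starN ?star1 // rmorphN1 scaleN1r opprK addNr; exact: pos0.
by rewrite rlinearN //; lra.
Qed.

(** Domination becomes extremality: with [c = g 1], [f] is the convex combination of the states
    [g / c] and [(f - g) / (1 - c)] with weights [c] and [1 - c]. *)
Lemma pure_state_ex : exists f : D -> R, pure_state f.
Proof.
have [f [lf fb fext]] := extreme_functional state_bound_sublinear.
have [sf f1] := state_bound_state_like lf fb.
exists f; split=> // g sg gf /andP[g0 g1] x.
have [lg stg pg] := sg; have [_ stf pf] := sf.
have scl (h : D -> R) (c : R) : state_like h -> 0 < c -> state_like (fun x => c * h x).
  move=> [lh sh ph] c0; split=> [|y|y py].
  - by split=> [y z|t y]; [rewrite lh.1 mulrDr|rewrite lh.2 mulrCA].
  - by rewrite sh.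
  - by rewrite mulr_ge0 ?ph // ltW.
have sub : state_like (fun x => f x - g x).
  split=> [|y|y py].
  - split=> [y z|t y]; first by rewrite lf.1 lg.1; ring.
    by rewrite lf.2 lg.2; ring.
  - by rewrite stf stg.
  - by rewrite subr_ge0 gf.
have d0 : 0 < 1 - g 1 by rewrite subr_gt0.
have i0 : 0 < (g 1)^-1 by rewrite invr_gt0.
have j0 : 0 < (1 - g 1)^-1 by rewrite invr_gt0.
have s1 := scl _ _ sg i0; have s2 := scl _ _ sub j0.
have [l1 _ _] := s1; have [l2 _ _] := s2.
rewrite -(fext (fun x => (g 1)^-1 * g x) (fun x => (1 - g 1)^-1 * (f x - g x)) (g 1)) //.
- by rewrite mulrA mulfV ?mul1r // gt_eqF.
- by move=> y; apply: state_like_le s1 _; rewrite mulVf // gt_eqF.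
- by move=> y; apply: state_like_le s2 _; rewrite f1 mulVf // gt_eqF.
- by rewrite g0 g1.
- move=> y; rewrite !mulrA !mulfV ?gt_eqF //; ring.
Qed.

End PureState.

Lemma lipschitz_cts (R : realType) (V W : normedModType R[i]) (F : V -> W) (k : R) :
  (forall x y, rnorm (F x - F y) <= k * rnorm (x - y)) -> continuous F.
Proof.
move=> kF x; apply/cvgrPdist_le => e e0.
have e0' : 0 < complex.Re e by move: e0; rewrite ltcE => /andP[].
have k1 : 0 < `|k| + 1 by rewrite ltr_wpDl.
apply/nbhs_ballP; exists ((complex.Re e / (`|k| + 1))%:C) => /=.
  by rewrite ltcR divr_gt0.
move=> y; rewrite -ball_normE /ball_ /= !normE ltcR ltr_pdivlMr // => xy.
rewrite -(@RRe_real _ e) ?gtr0_real // lecR (le_trans (kF _ _)) //.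
have := ler_norm k; have := rnorm_ge0 (x - y); nra.
Qed.

(** * The GNS representation *)

Section GNS.
Variables (R : realType) (D : cstarAlgType R) (f : D -> R).
Hypothesis sf : state_like f.
Implicit Types (x y z a b : D).

(** The complex-linear functional with real part [f]. *)
Definition cfunctional x : R[i] := (f x +i* - f ('i *: x))%C.

Let lf : rlinear f. Proof. by case: sf. Qed.

Lemma cfunctionalD x y : cfunctional (x + y) = cfunctional x + cfunctional y.
Proof.
rewrite /cfunctional scalerDr !lf.1.
by apply/eqP; rewrite eq_complex /=; apply/andP; split; apply/eqP; ring.
Qed.

Lemma cfunctionalZ (c : R[i]) x : cfunctional (c *: x) = c * cfunctional x.
Proof.
case: c => u v; rewrite /cfunctional.
have -> : (u +i* v)%C *: x = u%:C *: x + v%:C *: ('i *: x) by nc.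
have -> : 'i *: (u%:C *: x + v%:C *: ('i *: x)) = u%:C *: ('i *: x) + (- v)%:C *: x by nc.
rewrite !lf.1 !lf.2.
by apply/eqP; rewrite eq_complex /=; apply/andP; split; apply/eqP; ring.
Qed.

Lemma cfunctional_star x : cfunctional (star x) = conjc (cfunctional x).
Proof.
have [_ st _] := sf; rewrite /cfunctional /= st; congr (_ +i* _)%C.
have -> : 'i *: star x = - star ('i *: x).
  by rewrite starZ -scaleNr; congr (_ *: _); apply/eqP; rewrite eq_complex /=; apply/andP; split; apply/eqP; ring.
by rewrite rlinearN // st opprK.
Qed.

Let gform x y : R[i] := cfunctional (star y * x).

Let gform_linear (c : R[i]) x y z : gform (c *: x + y) z = c * gform x z + gform y z.
Proof. by rewrite /gform mulrDr scalerMr cfunctionalD cfunctionalZ. Qed.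

Let gformC x y : gform y x = conjc (gform x y).
Proof. by rewrite /gform -cfunctional_star starM starK. Qed.

Let gform_ge0 x : 0 <= complex.Re (gform x x).
Proof. by have [_ _ pf] := sf; apply: pf; exact: pos_star_mul. Qed.

Definition gns_form : preHilbert D := PreHilbert gform_linear gformC gform_ge0.

Local Notation H := (completion gns_form).

Lemma gns_formE x y : gns_form x y = cfunctional (star y * x). Proof. by []. Qed.

Lemma gns_form_mul x a b : gns_form (x * a) b = gns_form a (star x * b).
Proof. by rewrite !gns_formE starM starK mulrA. Qed.

(** Write [rnorm x ^+ 2 - star x * x] as [c^2] with [c] positive; the difference of the squared
    sides is [f] at [star (c b) * (c b)]. *)
Lemma fnorm_mul x b : fnorm gns_form (x * b) <= rnorm x * fnorm gns_form b.
Proof.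
have [_ _ pf] := sf.
rewrite -(@ler_pXn2r _ 2) ?nnegrE ?mulr_ge0 ?rnorm_ge0 ?fnorm_ge0 // exprMn.
have E y : fnorm gns_form y ^+ 2 = f (star y * y) by rewrite sqr_sqrtr // sform_ge0.
rewrite !E starM -mulrA -subr_ge0 -lf.2 -rlinearB //.
have : pos ((rnorm x ^+ 2)%:C *: (1 : D) - star x * x).
  by rewrite -rnorm_star_mul; apply: pos_norm_sub; rewrite starM starK.
move=> /pos_sqrt_ex[c [pc cc _]].
have -> : (rnorm x ^+ 2)%:C *: (star b * b) - star b * (star x * (x * b)) =
    star b * ((rnorm x ^+ 2)%:C *: (1 : D) - star x * x) * b by nc.
rewrite -cc -{1}(pos_sa pc) mulrA -(mulrA _ c) -starM.
by apply: pf; exact: pos_star_mul.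
Qed.

Lemma gns_act_subproof x (h : H) (e : R) : 0 < e ->
  exists a, forall b, cmod (h (star x * b) - gns_form a b) <= e * fnorm gns_form b.
Proof.
move=> e0; have x1 : 0 < rnorm x + 1 by rewrite ltr_wpDl ?rnorm_ge0.
have [a Ha] := cfun_approx h (divr_gt0 e0 x1).
exists (x * a) => b; rewrite gns_form_mul (le_trans (Ha _)) //.
rewrite mulrAC ler_pdivrMr // -mulrA ler_wpM2l ?(ltW e0) //.
have := fnorm_mul (star x) b; rewrite rnorm_star => /le_trans; apply.
by rewrite mulrC ler_wpM2l ?fnorm_ge0 // lerDl.
Qed.

(** Left multiplication by [x], extended from embedded vectors by moving its adjoint to the argument
    of the functional. *)
Definition gns_act x (h : H) : H := Completion (@gns_act_subproof x h).

Lemma gns_actE x (h : H) b : gns_act x h b = h (star x * b). Proof. by []. Qed.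

Lemma gns_act_embed x a : gns_act x (embed gns_form a) = embed gns_form (x * a).
Proof. by apply: cfun_ext => b; rewrite gns_actE !embedE gns_form_mul. Qed.

Lemma gns_act_linear x (c : R[i]) (g h : H) :
  gns_act x (c *: g + h) = c *: gns_act x g + gns_act x h.
Proof. by apply: cfun_ext. Qed.

Lemma gns_actB x (g h : H) : gns_act x (g - h) = gns_act x g - gns_act x h.
Proof. by rewrite addrC -scaleN1r gns_act_linear scaleN1r addrC. Qed.

Lemma gns_act_le x (h : H) : cnorm (gns_act x h) <= rnorm x * cnorm h.
Proof.
apply: cnorm_le => [|b]; first by rewrite mulr_ge0 ?rnorm_ge0 ?cnorm_ge0.
rewrite gns_actE (le_trans (cfun_le _ _)) // (mulrC (rnorm x)) -mulrA.
rewrite ler_wpM2l ?cnorm_ge0 //.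
by have := fnorm_mul (star x) b; rewrite rnorm_star.
Qed.

Lemma gns_act_continuous x : continuous (gns_act x).
Proof.
apply: (lipschitz_cts (k := rnorm x)) => g h.
by rewrite -gns_actB; exact: gns_act_le.
Qed.

Lemma cfun_conj_linear (h : H) (c : R[i]) x y : h (c *: x + y) = conjc c * h x + h y.
Proof.
rewrite -!(inner_embedr h) embed_linear innerDr.
by congr (_ + _); exact: (sformZr (inner_form H)).
Qed.

Lemma gns_actD x y (h : H) : gns_act (x + y) h = gns_act x h + gns_act y h.
Proof.
apply: cfun_ext => b; rewrite cfunD !gns_actE starD mulrDl.
by rewrite -[star x * b]scale1r cfun_conj_linear conjc1 mul1r scale1r.
Qed.

Lemma gns_actZ (c : R[i]) x (h : H) : gns_act (c *: x) h = c *: gns_act x h.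
Proof.
apply: cfun_ext => b; rewrite cfunZ !gns_actE starZ scalerMl.
have h0 : h 0 = 0 by rewrite -(subrr 0) cfun_sub subrr.
by rewrite -[_ *: _]addr0 cfun_conj_linear h0 addr0; congr (_ * _); exact: conjcK.
Qed.

Lemma gns_actM x y (h : H) : gns_act (x * y) h = gns_act x (gns_act y h).
Proof. by apply: cfun_ext => b; rewrite !gns_actE starM mulrA. Qed.

Lemma gns_act_star x (g h : H) :
  inner (gns_act (star x) g) h = inner g (gns_act x h).
Proof.
apply: (@embed_eq _ _ _ h _ _ (cnorm (gns_act (star x) g) + cnorm g * rnorm x)) => a _.
have -> : inner (gns_act (star x) g) h - inner g (gns_act x h) =
   (cinner (gns_act (star x) g) h - gns_act (star x) g a)
   - (cinner g (gns_act x h) - g (x * a)).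
  by rewrite gns_actE starK opprB addrA subrK.
rewrite (le_trans (cmodD _ _)) // cmodN mulrDl lerD ?cinnerP //.
rewrite (le_trans (cinnerP _ _ _)) // -mulrA ler_wpM2l ?cnorm_ge0 //.
by rewrite -gns_act_embed -gns_actB gns_act_le.
Qed.

Definition gns_rep : star_rep D H :=
  StarRep gns_act_linear gns_act_continuous gns_actD gns_actZ gns_actM gns_act_star.

End GNS.

(** * Irreducibility of the GNS representation of a pure state *)

Section Irreducible.
Variables (R : realType) (D : cstarAlgType R) (f : D -> R).
Hypothesis pf : pure_state f.
Let sf : state_like f. Proof. by case: pf. Qed.
Local Notation H := (completion (gns_form sf)).
Local Notation pi := (gns_rep sf).
Local Notation xi := (embed (gns_form sf) 1).
Implicit Types (x : D) (u v w h : H).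

Lemma gns_rep1 h : pi 1 h = h.
Proof. by apply: cfun_ext => b /=; rewrite star1 mul1r. Qed.

Lemma gns_rep_xi x : pi x xi = embed (gns_form sf) x.
Proof. by rewrite /= gns_act_embed mulr1. Qed.

Lemma gns_state x : complex.Re (inner (pi x xi) xi) = f x.
Proof. by rewrite gns_rep_xi inner_embedr embedE gns_formE star1 mul1r. Qed.

Lemma rep_functional_state_like (K : hilbertType R) (rho : star_rep D K) (v : K) :
  state_like (fun x => complex.Re (inner (rho x v) v)).
Proof.
split=> [|x|x /pos_sqrt_ex[s [ps <- _]]].
- split=> [x y|t x]; first by rewrite repD innerDl raddfD.
  by rewrite repZ innerZl; case: (inner _ _) => a b /=; ring.
- by rewrite rep_star innerC; case: (inner _ _).
- by rewrite repM -{1}(pos_sa ps) rep_star inner_sqr /= sqr_ge0.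
Qed.

(** Project the cyclic vector [xi] to an invariant subspace: [xi = v + w]. The vector functionals of
    [v] and [w] add up to [f], so if both vectors are nonzero purity makes that of [v] equal to
    [l f]. Then [v - l xi] is orthogonal to the orbit of [xi], hence zero, and [xi] lies in the
    subspace. *)
Lemma gns_irreducible : irreducible_rep pi.
Proof.
have [_ f1 fpure] := pf; have [lf _ _] := sf.
split.
  move=> kT; have : rep_kernel pi 1 by rewrite kT.
  move=> /(_ xi); rewrite gns_rep1 => xi0.
  have := gns_state 1; rewrite gns_rep1 xi0 inner0l f1 /= => /eqP.
  by rewrite eq_sym oner_eq0.
move=> V V0 Vl Vc Vi.
have [v Vv vort] := hilbert_projection xi V0 Vl Vc.
set w := xi - v in vort.
have xiE : xi = v + w by rewrite /w addrC subrK.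
clearbody w.
have VZ (c : R[i]) u : V u -> V (c *: u) by move=> Vu; rewrite -[_ *: _]addr0; exact: Vl.
have wpi x u : V u -> inner (pi x w) u = 0.
  by move=> Vu; rewrite -[x]starK rep_star; apply: vort; exact: Vi.
have piD x : pi x xi = pi x v + pi x w.
  by rewrite xiE -[v]scale1r rep_linear !scale1r.
have cyc u : (forall x, inner (pi x xi) u = 0) -> u = 0.
  move=> H0; apply: cfun_ext => b; rewrite cfun0 -inner_embedr -gns_rep_xi.
  exact/inner_eq0C/H0.
have dense : V xi -> V = setT.
  move=> Vxi; apply/seteqP; split=> // u _; apply: (closedP_rnorm Vc) => e e0.
  have [a Ha] := embed_dense u e0; exists (embed (gns_form sf) a) => //.
  by rewrite -gns_rep_xi; exact: Vi.
(* If [v = 0], the whole orbit of [xi = w] is orthogonal to [V], so [V] is zero. *)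
have [v0|v0] := eqVneq v 0.
  left; apply/seteqP; split=> [u Vu|_ ->] //.
  by apply: cyc => x; rewrite piD v0 rep0 add0r; exact: wpi.
have [w0|w0] := eqVneq w 0; first by right; apply: dense; rewrite xiE w0 addr0.
right; apply: dense.
pose g x := complex.Re (inner (pi x v) v); pose k x := complex.Re (inner (pi x w) w).
have sg : state_like g by exact: rep_functional_state_like.
have sk : state_like k by exact: rep_functional_state_like.
have fE x : f x = g x + k x.
  rewrite -gns_state piD xiE innerDl !innerDr /g /k.
  rewrite (wpi x v Vv) (inner_eq0C (vort _ (Vi x _ Vv))) addr0 add0r.
  by rewrite raddfD.
have n2 (u : H) : u != 0 -> 0 < rnorm u ^+ 2.
  move=> u0; rewrite lt_def sqr_ge0 andbT sqrf_eq0.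
  by apply: contra_neq u0; exact: rnorm_eq0.
have g1E : g 1 = rnorm v ^+ 2 by rewrite /g gns_rep1 inner_sqr.
have k1E : k 1 = rnorm w ^+ 2 by rewrite /k gns_rep1 inner_sqr.
have gE := fpure g sg.
have {}gE : forall x, g x = g 1 * f x.
  apply: gE; first by move=> x px; rewrite fE lerDl; case: sk => _ _; exact.
  rewrite g1E n2 //= -g1E -f1 fE ltrDl k1E; exact: n2.
set l := g 1 in gE.
have l0 : 0 < l by rewrite /l g1E n2.
have Rez x : complex.Re (inner (pi x (v - l%:C *: xi)) xi) = 0.
  have -> : pi x (v - l%:C *: xi) = (- l%:C) *: pi x xi + pi x v.
    by rewrite addrC -scaleNr rep_linear.
  rewrite inner_linearl raddfD /=.
  have -> : inner (pi x v) xi = inner (pi x v) v.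
    by rewrite xiE innerDr (inner_eq0C (vort _ (Vi x _ Vv))) addr0.
  rewrite -/(g x) gE -(gns_state x); case: (inner _ _) => a b /=; ring.
(* The real part at ['i x] supplies the imaginary part at [x]. *)
have hz x : inner (pi x (v - l%:C *: xi)) xi = 0.
  have := Rez x; have := Rez ('i *: x); rewrite repZ innerZl.
  case: (inner _ _) => a b /= h1 h2; apply/eqP; rewrite eq_complex /= h2 eqxx /=.
  by apply/eqP; move: h1; rewrite mul0r mul1r sub0r => /eqP; rewrite oppr_eq0 => /eqP.
have vE : v - l%:C *: xi = 0.
  apply: cyc => x; apply: inner_eq0C.
  by have := hz (star x); rewrite rep_star.
have -> : xi = (l^-1)%:C *: v.
  move/eqP: vE; rewrite subr_eq0 => /eqP ->.
  by rewrite scalerA -rmorphM mulVf ?gt_eqF // scale1r.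
exact: VZ.
Qed.

End Irreducible.

Lemma irreducible_rep_ex (R : realType) (D : cstarAlgType R) : (1 : D) <> 0 ->
  exists (H : hilbertType R) (pi : star_rep D H), irreducible_rep pi.
Proof.
move=> one0; have [f pf] := pure_state_ex one0.
by eexists; eexists; exact: (gns_irreducible pf).
Qed.

(** * Primitive ideals containing a given ideal *)

Section PrimitiveAbove.
Variables (R : realType) (A : cstarAlgType R).

Lemma prim_above_closed (K : cideal A) : ~ K 1 -> exists P : Prim A, K `<=` P.
Proof.
move=> K1; have one0 : (1 : quot K) <> 0 by rewrite -qproj1 => /qproj_eq0.
have [H [pi [pi0 irr]]] := irreducible_rep_ex one0.
pose rho (a : A) := pi (qproj K a).
have rl a : forall (c : R[i]) x y, rho a (c *: x + y) = c *: rho a x + rho a y.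
  exact: rep_linear.
have rc a : continuous (rho a) by exact: rep_continuous.
have rD a b x : rho (a + b) x = rho a x + rho b x by rewrite /rho qprojD repD.
have rZ (c : R[i]) a x : rho (c *: a) x = c *: rho a x by rewrite /rho qprojZ repZ.
have rM a b x : rho (a * b) x = rho a (rho b x) by rewrite /rho qprojM repM.
have rs a x y : inner (rho (star a) x) y = inner x (rho a y).
  by rewrite /rho qproj_star rep_star.
pose sig := @StarRep R A H rho rl rc rD rZ rM rs.
have pk : primitive_ideal (rep_kernel sig).
  exists H, sig; split=> //; split.
    move=> kT; apply: pi0; apply/seteqP; split=> // q _ x; rewrite -[q]qprojK.
    have kq : rep_kernel sig (repr q) by rewrite kT.
    exact: kq.
  move=> V V0 Vl Vc Vi; apply: irr => // q x Vx; rewrite -[q]qprojK; exact: Vi.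
exists (MkPrim pk) => a Ka x /=; rewrite /rho.
have -> : qproj K a = 0 by exact/qproj_eq0.
by have := repZ pi 0 0 x; rewrite !scale0r.
Qed.

(* An ideal at distance less than [1] from [1] contains an invertible element. *)
Lemma prim_above (J : set A) : J 0 -> (forall x y, J x -> J y -> J (x + y)) ->
  (forall a x, J x -> J (a * x)) -> (forall a x, J x -> J (x * a)) -> ~ J 1 ->
  exists P : Prim A, J `<=` P.
Proof.
move=> J0 JD JMl JMr J1.
pose K (x : A) := forall e : R, 0 < e -> exists2 y, J y & rnorm (x - y) <= e.
have JK : J `<=` K by move=> x Jx e e0; exists x; rewrite // subrr rnorm0 ltW.
have KD x y : K x -> K y -> K (x + y).
  move=> Kx Ky e e0; have e2 : 0 < e / 2 by rewrite divr_gt0.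
  have [u Ju xu] := Kx _ e2; have [v Jv yv] := Ky _ e2.
  exists (u + v); first exact: JD.
  by rewrite opprD addrACA (le_trans (rnormD _ _)) //; lra.
have KM (F : A -> A) (k : R) : 0 <= k -> (forall x, J x -> J (F x)) ->
    (forall x y, rnorm (F x - F y) <= k * rnorm (x - y)) -> forall x, K x -> K (F x).
  move=> k0 JF kF x Kx e e0; have k1 : 0 < k + 1 by rewrite ltr_wpDl.
  have [u Ju xu] := Kx _ (divr_gt0 e0 k1); exists (F u); first exact: JF.
  rewrite (le_trans (kF _ _)) //; move: xu; rewrite ler_pdivlMr //.
  by have := rnorm_ge0 (x - u); nra.
have KMl a x : K x -> K (a * x).
  apply: (KM _ (rnorm a)) => [||y z]; [exact: rnorm_ge0|exact: JMl|].
  by rewrite -mulrBr rnormM.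
have KMr a x : K x -> K (x * a).
  apply: (KM (fun x => x * a) (rnorm a)) => [||y z]; [exact: rnorm_ge0|exact: JMr|].
  by rewrite -mulrBl mulrC rnormM.
have Kc : closed K.
  move=> x clx e e0; have e2 : 0 < e / 2 by rewrite divr_gt0.
  have [|y [Ky]] := clx (ball x ((e / 2)%:C : R[i])).
    by apply: nbhsx_ballx; rewrite ltcR.
  rewrite -ball_normE /ball_ /= normE ltcR => xy.
  have [u Ju yu] := Ky _ e2; exists u => //.
  by rewrite -(subrKA y) (le_trans (rnormD _ _)) //; lra.
have K1 : ~ K 1.
  move=> /(_ (1 / 2)) [|y Jy y1]; first by lra.
  have [|z [z1 _]] := rnorm_neumann (x := 1 - y); first by lra.
  by apply: J1; rewrite -z1 subKr; exact: JMr.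
have [P KP] := @prim_above_closed (CIdeal (JK _ J0) KD KMl KMr Kc) K1.
by exists P => x /JK; exact: KP.
Qed.

End PrimitiveAbove.

(** * Approximation by the centre *)

Section RealValue.
Variables (R : realType) (A : cstarAlgType R) (I : cideal A).
Implicit Types (x y z k : A) (P : Prim A) (r t : R).

Lemma central_mod_prim x P : I `<=` P -> central_mod I x -> central_mod (prim_ideal P) x.
Proof. by move=> IP; exact: central_mod_sub. Qed.

Definition sa_central_mod x := star x = x /\ central_mod I x.

Definition rvalue P x : R := xget 0 [set r | has_value P x r%:C].

Lemma rvalue_eq P x r : has_value P x r%:C -> rvalue P x = r.
Proof.
move=> xr; rewrite /rvalue; case: xgetP => [s _ xs|/(_ r)//].
by have /complexI := has_value_uniq xs xr.
Qed.

Lemma rvalueP P x : I `<=` P -> sa_central_mod x -> has_value P x (rvalue P x)%:C.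
Proof.
move=> IP [sx cx]; have [r xr] := has_value_ex_sa sx (central_mod_prim IP cx).
by rewrite (rvalue_eq xr).
Qed.

Lemma sa_central_modD x y : sa_central_mod x -> sa_central_mod y -> sa_central_mod (x + y).
Proof.
by move=> [sx cx] [sy cy]; split; [rewrite starD sx sy|exact: central_modD].
Qed.

Lemma sa_central_modB x y : sa_central_mod x -> sa_central_mod y -> sa_central_mod (x - y).
Proof.
by move=> [sx cx] [sy cy]; split; [rewrite starB sx sy|exact: central_modB].
Qed.

Lemma sa_central_mod_cst t : sa_central_mod (t%:C *: (1 : A)).
Proof.
by split; [rewrite starZr star1|apply: central_modZ; exact: central_mod1].
Qed.

Lemma sa_central_mod_cpos x : sa_central_mod x -> sa_central_mod (cpos x).
Proof. by move=> [sx cx]; split; [exact: cpos_sa|exact: central_mod_cpos]. Qed.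

Section Above.
Variables (P : Prim A) (IP : I `<=` P).

Lemma rvalueD x y : sa_central_mod x -> sa_central_mod y ->
  rvalue P (x + y) = rvalue P x + rvalue P y.
Proof.
move=> /(rvalueP IP) hx /(rvalueP IP) hy; apply: rvalue_eq.
by rewrite rmorphD; exact: has_valueD.
Qed.

Lemma rvalueB x y : sa_central_mod x -> sa_central_mod y ->
  rvalue P (x - y) = rvalue P x - rvalue P y.
Proof.
move=> /(rvalueP IP) hx /(rvalueP IP) hy; apply: rvalue_eq.
by rewrite rmorphB; exact: has_valueB.
Qed.

Lemma rvalue_cst t : rvalue P (t%:C *: (1 : A)) = t.
Proof. by apply: rvalue_eq; exact: has_value_cst. Qed.

Lemma rvalue_cpos x : sa_central_mod x -> rvalue P (cpos x) = Num.max (rvalue P x) 0.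
Proof.
by move=> gx; apply: rvalue_eq; apply: has_value_cpos; [case: gx|exact: rvalueP].
Qed.

Lemma rvalue_mem x : sa_central_mod x -> rvalue P x = 0 -> P x.
Proof. by move=> /(rvalueP IP) + x0; rewrite x0 => /has_value_mem. Qed.

End Above.

(** The norm [c] of [x] modulo [I] is attained as a value: [k = c - x] is central and not invertible
    modulo [I], so [k A + I] is a proper two-sided ideal. A primitive ideal above it contains [k],
    and it contains [x] by assumption, so [c = 0]. *)
Lemma pos_mem_of_prims x : pos x -> central_mod I x ->
  (forall P, I `<=` P -> P x) -> I x.
Proof.
move=> px cx HP; apply: contrapT => Ix.
pose X := qproj I x; pose c := rnorm X.
have pX : pos X by exact: pos_qproj.
have c0 : 0 < c.
  rewrite lt_def rnorm_ge0 andbT; apply/eqP => /rnorm_eq0 /qproj_eq0; exact: Ix.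
have one0 : (1 : quot I) <> 0.
  by rewrite -qproj1 => /qproj_eq0 I1; apply: Ix; rewrite -[x]mulr1; exact: cidealMl.
pose k := c%:C *: (1 : A) - x.
have ck : central_mod I k.
  by apply: central_modB => //; apply: central_modZ; exact: central_mod1.
pose J y := exists b, I (y - k * b).
have [|||||P JP] := @prim_above _ _ J.
- by exists 0; rewrite mulr0 subrr; exact: cideal0.
- move=> y z [b yb] [b' zb]; exists (b + b').
  by rewrite mulrDr opprD addrACA; exact: cidealD.
- move=> a y [b yb]; exists (a * b).
  have -> : a * y - k * (a * b) = a * (y - k * b) - (k * a - a * k) * b.
    by nc.
  by apply: cidealB; [exact: cidealMl|apply: cidealMr; exact: ((central_modP I k).1 ck a)].
- move=> a y [b yb]; exists (b * a).
  by rewrite mulrA -mulrBl; exact: cidealMr.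
(* Suppose [B] inverts [K = c - X]. Then [B] is positive and at most its norm, so [K] is at least
   the inverse of that norm. This pushes the norm of [X] strictly below [c]. *)
- move=> [b /qprojP]; rewrite qproj1 qprojM; set B := qproj I b; set K := qproj I k.
  move=> /esym KB.
  have BK : B * K = 1 by rewrite -ck.
  have KE : K = c%:C *: (1 : quot I) - X by rewrite /K /k qprojB qprojZ.
  have pK : pos K by rewrite KE; apply: pos_norm_sub; case: pX.
  have sB : star B = B.
    have : star B * K = 1 by rewrite -{1}(pos_sa pK) -starM KB star1.
    by move=> h; rewrite -[LHS]mulr1 -KB mulrA h mul1r.
  have pB : pos B.
    have [s [ps ss _]] := pos_sqrt_ex pK.
    have -> : B = star (s * B) * (s * B); last exact: pos_star_mul.
    by rewrite starM sB (pos_sa ps) -mulrA (mulrA s) ss KB mulr1.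
  have nB : 0 < rnorm B.
    rewrite lt_def rnorm_ge0 andbT; apply/eqP => /rnorm_eq0 B0.
    by apply: one0; rewrite -KB B0 mulr0.
  have pt : pos ((c - (rnorm B)^-1)%:C *: (1 : quot I) - X).
    have h : pos (((rnorm B)%:C *: (1 : quot I) - B) * K).
      have BKC : B * K = K * B by rewrite BK KB.
      by apply: pos_mul => //; exact: pos_norm_sub.
    have i0 : 0 <= (rnorm B)^-1 by rewrite invr_ge0 ltW.
    have := posZ i0 h; congr (pos _).
    transitivity (K - (rnorm B)^-1%:C *: (B * K)); first by nc; rewrite gt_eqF.
    by rewrite BK KE; nc.
  have t0 : 0 <= c - (rnorm B)^-1.
    apply: (pos_cst_ge0 one0); have := posD pt pX; congr (pos _).
    by rewrite subrK.
  have : c <= c - (rnorm B)^-1.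
    by apply: pos_norm_le => //; apply: posD => //; exact: pos_cst.
  by have : 0 < (rnorm B)^-1; [rewrite invr_gt0|lra].
- have Jk : J k by exists 1; rewrite mulr1 subrr; exact: cideal0.
  have IP : I `<=` P.
    by move=> y Iy; apply: JP; exists 0; rewrite mulr0 subr0.
  have : has_value P k 0 by apply/has_value_mem; exact: JP.
  have : has_value P k (c%:C - 0).
    by apply: has_valueB; [exact: has_value_cst|exact/has_value_mem/HP].
  move=> h /(has_value_uniq h); rewrite subr0 => /complexI h0.
  by move: c0; rewrite h0 ltxx.
Qed.

(* Compactness of the set of primitive ideals above [I]: the elements vanishing
   wherever some [k] in [K] is nonpositive form an ideal. *)
Lemma directed_positive (K : set A) : K !=set0 -> K `<=` sa_central_mod ->
  (forall k1 k2, K k1 -> K k2 -> exists2 k, K k & forall P, I `<=` P ->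
     rvalue P k1 <= rvalue P k /\ rvalue P k2 <= rvalue P k) ->
  (forall P, I `<=` P -> exists2 k, K k & 0 < rvalue P k) ->
  exists2 k, K k & forall P, I `<=` P -> 0 < rvalue P k.
Proof.
move=> [k0 Kk0] Kg Kd Kp.
pose J x := exists2 k, K k & forall P, I `<=` P -> rvalue P k <= 0 -> P x.
have [[k Kk H]|J1] := pselect (J 1).
  exists k => // P IP; rewrite ltNge; apply/negP => h.
  exact: (@prim_proper _ _ P (H P IP h)).
have [||||//|P JP] := @prim_above _ _ J.
- by exists k0 => // P _ _; exact: prim0.
- move=> x y [k1 K1 H1] [k2 K2 H2]; have [k Kk Hk] := Kd _ _ K1 K2.
  exists k => // P IP h; have [h1 h2] := Hk P IP.
  by apply: primD; [apply: H1|apply: H2] => //; apply: le_trans h.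
- by move=> a x [k Kk H]; exists k => // P IP h; apply: primMl; exact: H.
- by move=> a x [k Kk H]; exists k => // P IP h; apply: primMr; exact: H.
have IP : I `<=` P by move=> x Ix; apply: JP; exists k0 => // Q IQ _; exact: IQ.
have [k Kk kP] := Kp P IP; exfalso; have gk := Kg _ Kk.
have : P (cpos k).
  apply: JP; exists k => // Q IQ h; apply: (rvalue_mem IQ); first exact: sa_central_mod_cpos.
  by rewrite rvalue_cpos // max_r.
move=> /has_value_mem /(rvalue_eq (r := 0)).
by rewrite rvalue_cpos // max_l ?ltW // => k1; rewrite k1 ltxx in kP.
Qed.

Definition sa_center z := star z = z /\ alg_center A z.

Lemma sa_center_mod z : sa_center z -> sa_central_mod z.
Proof. by move=> [sz cz]; split=> //; exact: alg_center_mod. Qed.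

Lemma sa_centerD x y : sa_center x -> sa_center y -> sa_center (x + y).
Proof.
move=> [sx cx] [sy cy]; split; first by rewrite starD sx sy.
by move=> b; rewrite mulrDl mulrDr cx cy.
Qed.

Lemma sa_centerB x y : sa_center x -> sa_center y -> sa_center (x - y).
Proof.
move=> [sx cx] [sy cy]; split; first by rewrite starB sx sy.
by move=> b; rewrite mulrBl mulrBr cx cy.
Qed.

Lemma sa_centerZ t x : sa_center x -> sa_center (t%:C *: x).
Proof.
move=> [sx cx]; split; first by rewrite starZr sx.
by move=> b; rewrite scalerMl scalerMr cx.
Qed.

Lemma sa_center1 : sa_center 1.
Proof. by split; [exact: star1|move=> b; rewrite mul1r mulr1]. Qed.

Lemma sa_center_cpos x : sa_center x -> sa_center (cpos x).
Proof. by move=> [sx cx]; split; [exact: cpos_sa|exact: alg_center_cpos]. Qed.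

(** * The Kakutani-Stone argument and lifting to the centre *)

Section Kakutani.
Variable a : A.
Hypothesis ga : sa_central_mod a.
Hypothesis aval : forall P1 P2 : Prim A, I `<=` P1 -> I `<=` P2 ->
  P1 `&` alg_center A = P2 `&` alg_center A -> rvalue P1 a = rvalue P2 a.

(** If self-adjoint central elements do not separate, a central [y] in one ideal puts [star y * y]
    in the other; primeness yields [y] or [star y] there, and ideals are closed under [star]. *)
Lemma center_separates P1 P2 : P1 `&` alg_center A <> P2 `&` alg_center A ->
  exists y, sa_center y /\ ((P1 y /\ ~ P2 y) \/ (P2 y /\ ~ P1 y)).
Proof.
move=> neq; apply: contrapT => H; apply: neq.
have key (Q1 Q2 : Prim A) y : alg_center A y -> Q1 y ->
    (forall s, sa_center s -> Q1 s -> Q2 s) -> Q2 y.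
  move=> cy Q1y HQ.
  have csy : alg_center A (star y) by move=> b; rewrite -[b]starK -!starM cy.
  have : Q2 (star y * y).
    apply: HQ; last exact: primMl.
    by split; [rewrite starM starK|move=> b; rewrite -mulrA cy mulrA csy mulrA].
  move=> Qy; have [|//|Qs] := @prim_prime _ _ Q2 y (star y).
    by move=> b; rewrite (cy b) -mulrA (cy (star y)); exact: primMl.
  by rewrite -[y]starK; exact: (@cideal_star _ _ (prim_ideal Q2) _ Qs).
apply/seteqP; split=> y [Py cy]; split=> //; apply: key Py _ => // s ss Ps;
  by apply: contrapT => nP; apply: H; exists s; split=> //; tauto.
Qed.

(** If the traces on the centre agree, a constant interpolates by [aval]; otherwise an affine
    function of a separating element, which vanishes at exactly one of the two ideals. *)
Lemma interpolation P1 P2 : I `<=` P1 -> I `<=` P2 ->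
  exists z, [/\ sa_center z, rvalue P1 z = rvalue P1 a & rvalue P2 z = rvalue P2 a].
Proof.
move=> I1 I2.
have aff y (r t : R) P : I `<=` P -> sa_center y ->
    rvalue P (r%:C *: (1 : A) + t%:C *: y) = r + t * rvalue P y.
  move=> IP sy; apply: rvalue_eq; rewrite rmorphD rmorphM.
  apply: has_valueD; first exact: has_value_cst.
  by apply: has_valueZ; apply: rvalueP => //; exact: sa_center_mod.
have [eqP|neq] := pselect (P1 `&` alg_center A = P2 `&` alg_center A).
  exists ((rvalue P1 a)%:C *: (1 : A)); split; rewrite ?rvalue_cst //.
    by apply: sa_centerZ; exact: sa_center1.
  exact: aval.
have sep (Q1 Q2 : Prim A) y : I `<=` Q1 -> I `<=` Q2 -> sa_center y -> Q1 y -> ~ Q2 y ->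
    exists z, [/\ sa_center z, rvalue Q1 z = rvalue Q1 a & rvalue Q2 z = rvalue Q2 a].
  move=> J1 J2 sy Q1y Q2y.
  have v1 : rvalue Q1 y = 0 by apply: rvalue_eq; exact/has_value_mem.
  have v2 : rvalue Q2 y != 0.
    by apply/eqP => h; apply: Q2y; apply: rvalue_mem h => //; exact: sa_center_mod.
  exists ((rvalue Q1 a)%:C *: (1 : A) + ((rvalue Q2 a - rvalue Q1 a) / rvalue Q2 y)%:C *: y).
  split.
  - by apply: sa_centerD; apply: sa_centerZ => //; exact: sa_center1.
  - by rewrite aff // v1 mulr0 addr0.
  - by rewrite aff // divfK // addrC subrK.
have [y [sy [[y1 y2]|[y2 y1]]]] := center_separates neq; first exact: sep y1 y2.
by have [z [sz z1 z2]] := sep _ _ _ I2 I1 sy y2 y1; exists z.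
Qed.

(** For each [P], interpolation at [P1] and [P] gives [z - a + e] the value [e] at [P]. These
    elements are directed under maxima, so one [z] works for all [P]; matching [a] at [P1] survives
    maxima. *)
Lemma center_above (e : R) P1 : 0 < e -> I `<=` P1 ->
  exists z, [/\ sa_center z, rvalue P1 z = rvalue P1 a &
    forall P, I `<=` P -> rvalue P a - e < rvalue P z].
Proof.
move=> e0 I1.
pose f z := z - a + e%:C *: (1 : A).
have gf z : sa_center z -> sa_central_mod (f z).
  move=> sz; apply: sa_central_modD; last exact: sa_central_mod_cst.
  by apply: sa_central_modB => //; exact: sa_center_mod.
have fv z P : I `<=` P -> sa_center z -> rvalue P (f z) = rvalue P z - rvalue P a + e.
  move=> IP sz; have gz := sa_center_mod sz.
  rewrite rvalueD //; [|exact: sa_central_modB|exact: sa_central_mod_cst].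
  by rewrite rvalueB // rvalue_cst.
pose K := [set f z | z in [set z | sa_center z /\ rvalue P1 z = rvalue P1 a]].
have [||_ _ [z [sz z1] <-] [y [sy y1] <-]|P IP|_ [z [sz z1] <-] H] := @directed_positive K.
- exists (f ((rvalue P1 a)%:C *: (1 : A))), ((rvalue P1 a)%:C *: (1 : A)) => //.
  by split; [apply: sa_centerZ; exact: sa_center1|rewrite rvalue_cst].
- by move=> _ [z [sz _] <-]; exact: gf.
(* The maximum of [y] and [z], formed inside the centre. *)
- pose m := z + cpos (y - z).
  have sm : sa_center m by apply: sa_centerD => //; apply: sa_center_cpos; exact: sa_centerB.
  have mv P : I `<=` P -> rvalue P m = Num.max (rvalue P y) (rvalue P z).
    move=> IP; have gz := sa_center_mod sz; have gy := sa_center_mod sy.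
    rewrite rvalueD //; last by apply: sa_central_mod_cpos; exact: sa_central_modB.
    rewrite rvalue_cpos //; last exact: sa_central_modB.
    by rewrite rvalueB // addr_maxr addr0 addrC subrK.
  exists (f m); first by exists m => //; split=> //; rewrite mv // y1 z1 maxxx.
  move=> P IP; rewrite !fv // mv //.
  by split; rewrite lerD2r lerD2r le_max lexx ?orbT.
- have [z [sz z1 z2]] := interpolation I1 IP.
  by exists (f z); [exists z|rewrite fv // z2 subrr add0r].
exists z; split=> // P IP; have := H P IP; rewrite fv //; lra.
Qed.

(** The dual half: among the central elements above [a - e], minima are directed for [a - z + e],
    and [center_above] supplies one matching [a] at any prescribed [P]. *)
Lemma center_approx (e : R) : 0 < e -> exists z, sa_center z /\
  forall P, I `<=` P -> `|rvalue P a - rvalue P z| <= e.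
Proof.
move=> e0; have [[P0 I0]|noP] := pselect (exists P : Prim A, I `<=` P); last first.
  exists 1; split; first exact: sa_center1.
  by move=> P IP; exfalso; apply: noP; exists P.
pose f z := a - z + e%:C *: (1 : A).
have gf z : sa_center z -> sa_central_mod (f z).
  move=> sz; apply: sa_central_modD; last exact: sa_central_mod_cst.
  by apply: sa_central_modB => //; exact: sa_center_mod.
have fv z P : I `<=` P -> sa_center z -> rvalue P (f z) = rvalue P a - rvalue P z + e.
  move=> IP sz; have gz := sa_center_mod sz.
  rewrite rvalueD //; [|exact: sa_central_modB|exact: sa_central_mod_cst].
  by rewrite rvalueB // rvalue_cst.
pose K := [set f z | z in [set z | sa_center z /\
  forall P, I `<=` P -> rvalue P a - e < rvalue P z]].
have [||_ _ [z [sz z1] <-] [y [sy y1] <-]|P IP|_ [z [sz z1] <-] H] := @directed_positive K.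
- by have [z [sz _ z1]] := center_above e0 I0; exists (f z), z.
- by move=> _ [z [sz _] <-]; exact: gf.
- pose m := z - cpos (z - y).
  have sm : sa_center m by apply: sa_centerB => //; apply: sa_center_cpos; exact: sa_centerB.
  have mv P : I `<=` P -> rvalue P m = Num.min (rvalue P y) (rvalue P z).
    move=> IP; have gz := sa_center_mod sz; have gy := sa_center_mod sy.
    rewrite rvalueB //; last by apply: sa_central_mod_cpos; exact: sa_central_modB.
    rewrite rvalue_cpos //; last exact: sa_central_modB.
    rewrite rvalueB //; set u := rvalue P z; set v := rvalue P y.
    by case: (lerP u v) => uv; [rewrite max_r|rewrite max_l]; lra.
  exists (f m); first by exists m => //; split=> // P IP; rewrite mv // lt_min y1 // z1.
  move=> P IP; rewrite !fv // mv //.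
  by split; rewrite lerD2r lerD2l lerN2 ge_min lexx ?orbT.
- have [z [sz z1 z2]] := center_above e0 IP.
  by exists (f z); [exists z|rewrite fv // z1 subrr add0r].
exists z; split=> // P IP; have := H P IP; rewrite fv // => h1.
by have h2 := z1 P IP; rewrite ler_norml; apply/andP; split; lra.
Qed.

(** The part of [cpos w] exceeding [d] has value [0] at every primitive ideal above [I], so it lies
    in [I]; the same holds for [cpos (- w)]. Each truncated part has norm at most [d], and the
    triangle inequality gives [2 * d]. *)
Lemma center_truncation (d : R) w : 0 <= d -> sa_center w ->
  (forall P, I `<=` P -> `|rvalue P w| <= d) ->
  exists t : A, [/\ sa_center t, I (w - t) & rnorm t <= 2 * d].
Proof.
move=> d0 sw wd; have sd : sa_center (d%:C *: (1 : A)) by apply: sa_centerZ; exact: sa_center1.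
have half v : sa_center v -> (forall P, I `<=` P -> rvalue P v <= d) ->
    I (cpos (cpos v - d%:C *: (1 : A))).
  move=> sv vd; have sc := sa_center_cpos sv; have sk := sa_centerB sc sd.
  apply: pos_mem_of_prims; first by apply: cpos_pos; case: sk.
    by apply: central_mod_cpos; [case: sk|case: (sa_center_mod sk)].
  move=> P IP; have gv := sa_center_mod sv; have gk := sa_center_mod sk.
  apply: (rvalue_mem IP); first exact: sa_central_mod_cpos.
  rewrite rvalue_cpos // rvalueB ?rvalue_cst ?rvalue_cpos //;
    [|exact: sa_center_mod sc|exact: sa_center_mod sd].
  by rewrite max_r // subr_le0 ge_max vd.
have sN : sa_center (- w) by rewrite -sub0r -(subrr w); do !apply: sa_centerB.
pose t v := cpos v - cpos (cpos v - d%:C *: (1 : A)).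
have st v : sa_center v -> sa_center (t v).
  by move=> sv; do ?[apply: sa_centerB | apply: sa_center_cpos].
have tn v : sa_center v -> rnorm (t v) <= d.
  by move=> [sv _]; apply: truncation_norm => //; exact: cpos_pos.
exists (t w - t (- w)); split.
- by apply: sa_centerB; exact: st.
- have -> : w - (t w - t (- w)) =
      cpos (cpos w - d%:C *: (1 : A)) - cpos (cpos (- w) - d%:C *: (1 : A)).
    rewrite -{1}(cpos_sub_cneg w) -cposN /t.
    by nc.
  apply: cidealB; apply: half => // P IP; have := wd P IP.
    by rewrite ler_norml => /andP[].
  have -> : rvalue P (- w) = - rvalue P w.
    have gw := sa_center_mod sw; rewrite -[in LHS](sub0r w) -(subrr w).
    by rewrite !rvalueB //; [lra|exact: sa_central_modB].
  by rewrite ler_norml => /andP[]; lra.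
- rewrite (le_trans (rnormD _ _)) // rnormN.
  by have := tn _ sw; have := tn _ sN; lra.
Qed.

Lemma sa_center_lift : exists2 z, alg_center A z & I (a - z).
Proof.
have p0 n : (0 : R) < 2^-1 ^+ n by rewrite exprn_gt0 // invr_gt0.
have h0 : (0 : R) <= 2^-1 by rewrite invr_ge0.
have h1 : (2^-1 : R) < 1 by lra.
have /choice[z Hz] : forall n, exists z, sa_center z /\
    forall P, I `<=` P -> `|rvalue P a - rvalue P z| <= 2^-1 ^+ n.
  by move=> n; exact: center_approx.
(* Consecutive approximants differ in value by at most [2^-n + 2^-(n+1) <= 2 * 2^-n]; truncation
   doubles this bound. *)
have /choice[t Ht] : forall n, exists t : A,
    [/\ sa_center t, I (z n.+1 - z n - t) & rnorm t <= 2 * (2 * 2^-1 ^+ n)].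
  move=> n; have [s1 v1] := Hz n; have [s2 v2] := Hz n.+1.
  apply: center_truncation; [by rewrite mulr_ge0 // ltW|exact: sa_centerB|].
  move=> P IP; rewrite rvalueB //; [|exact: sa_center_mod s2|exact: sa_center_mod s1].
  have := v1 P IP; have := v2 P IP; have := p0 n; rewrite exprS !ler_norml.
  by move=> ? /andP[? ?] /andP[? ?]; apply/andP; split; lra.
pose u := fix u n := if n is m.+1 then u m + t m else z 0%N.
have uI n : I (z n - u n).
  elim: n => [|n IH] /=; first by rewrite subrr; exact: cideal0.
  have -> : z n.+1 - (u n + t n) = (z n.+1 - z n - t n) + (z n - u n).
    by move: (z n.+1) (z n) (t n) (u n) => *; nc.
  by apply: cidealD => //; case: (Ht n).
have us n : sa_center (u n).
  by elim: n => [|n IH] /=; [case: (Hz 0%N)|apply: sa_centerD => //; case: (Ht n)].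
have [|l Hl] := rnorm_geo_cvg (u := u) (C := 4) h0 h1.
  by move=> n /=; rewrite addrAC subrr add0r; case: (Ht n) => _ _; lra.
have cl : alg_center A l.
  move=> b; apply: (rcvg_uniq (rcvgMr b Hl)).
  have := rcvgMl b Hl; congr (rcvg _ _).
  by apply/funext => n; case: (us n) => _ ->.
exists l => //.
(* Subtracting its value puts [a - u n] in [P]. That value is at most [2^-n] in modulus because
   [u n] and [z n] agree modulo [I], and [P] is closed. *)
have aP P : I `<=` P -> P (a - l).
  move=> IP; apply: (closedP_rnorm (@prim_closed _ _ P)) => e e0.
  have e2 : 0 < e / 2 by rewrite divr_gt0.
  have [N1 H1] := Hl _ e2; have [N2 H2] := pow_lt_eps h0 h1 e2.
  pose n := maxn N1 N2; pose r := rvalue P (a - u n).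
  have gu := sa_center_mod (us n).
  exists (a - u n - r%:C *: (1 : A)).
    by apply: (rvalueP IP); exact: sa_central_modB.
  have rE : `|r| <= 2^-1 ^+ n.
    have [sz vz] := Hz n; have gz := sa_center_mod sz.
    have : rvalue P (z n - u n) = 0 by apply: rvalue_eq; apply/has_value_mem; exact/IP/uI.
    by rewrite rvalueB // => h; rewrite /r rvalueB //; have := vz P IP; congr (`|_| <= _); lra.
  have -> : a - l - (a - u n - r%:C *: (1 : A)) = - (l - u n) + r%:C *: (1 : A).
    by move: (u n) => y; nc.
  rewrite (le_trans (rnormD _ _)) // rnormN rnormZr.
  have := H1 n (leq_maxl _ _); have := H2 n (leq_maxr _ _).
  have := rnorm1_le1 A; have := normr_ge0 r; move: rE; nra.
have cy : central_mod I (a - l).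
  by apply: central_modB; [case: ga|exact: alg_center_mod].
(* The membership criterion concerns positive elements; the C*-identity in the quotient then returns
   to [a - l]. *)
have : I (star (a - l) * (a - l)).
  apply: pos_mem_of_prims; first exact: pos_star_mul.
    by apply: central_modM => //; exact: central_mod_star.
  by move=> P IP; apply: primMl; exact: aP.
move=> /qproj_eq0; rewrite qprojM qproj_star => /star_mul_eq0 h.
exact/qproj_eq0.
Qed.

End Kakutani.

Lemma center_lift a : central_mod I a ->
  (forall (P1 P2 : Prim A) l1 l2, I `<=` P1 -> I `<=` P2 ->
     P1 `&` alg_center A = P2 `&` alg_center A ->
     has_value P1 a l1 -> has_value P2 a l2 -> l1 = l2) ->
  exists2 z, alg_center A z & I (a - z).
Proof.
move=> ca aval; pose u : A := (2^-1 : R)%:C *: (a + star a).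
pose v : A := ((2^-1 : R)%:C * 'i) *: (star a - a).
have csa := central_mod_star ca.
have gu : sa_central_mod u.
  split; first by rewrite /u starZr starD starK addrC.
  by apply: central_modZ; exact: central_modD.
have gv : sa_central_mod v.
  split; last by apply: central_modZ; exact: central_modB.
  rewrite /v starZ starB starK -[a - _]opprB scalerN -scaleNr; congr (_ *: _).
  by apply/eqP; rewrite eq_complex /=; apply/andP; split; apply/eqP; ring.
have aE : a = u + 'i *: v by rewrite /u /v; move: (star a) => b; nc.
(* The values of the self-adjoint parts [u] and [v] are the real and imaginary parts of the value of
   [a]. *)
have aeq (P1 P2 : Prim A) : I `<=` P1 -> I `<=` P2 ->
    P1 `&` alg_center A = P2 `&` alg_center A ->
    rvalue P1 u = rvalue P2 u /\ rvalue P1 v = rvalue P2 v.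
  move=> I1 I2 E.
  have av P : I `<=` P -> has_value P a ((rvalue P u)%:C + 'i * (rvalue P v)%:C).
    move=> IP; rewrite {1}aE; apply: has_valueD; first exact: rvalueP.
    by apply: has_valueZ; exact: rvalueP.
  have := aval _ _ _ _ I1 I2 E (av _ I1) (av _ I2).
  by move=> /eqP; rewrite eq_complex /= => /andP[/eqP h1 /eqP h2]; split; lra.
have [|z cz Iz] := sa_center_lift gu.
  by move=> P1 P2 I1 I2 E; case: (aeq _ _ I1 I2 E).
have [|y cy Iy] := sa_center_lift gv.
  by move=> P1 P2 I1 I2 E; case: (aeq _ _ I1 I2 E).
exists (z + 'i *: y).
  by move=> b; rewrite mulrDl mulrDr scalerMl scalerMr cz cy.
have -> : a - (z + 'i *: y) = (u - z) + 'i *: (v - y) by rewrite {1}aE; nc.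
by apply: cidealD => //; exact: cidealZ.
Qed.

End RealValue.

(** * Values of [a] and the Dauns-Hofmann function of the quotient *)

Lemma dauns_hofmann_quot (R : realType) (A : cstarAlgType R) (I : cideal A) (a : A)
    (P : Prim A) (IP : I `<=` P) : central_mod I a ->
  has_value P a (dauns_hofmann (qproj I a) (prim_quot IP)).
Proof.
move=> ca; have := dauns_hofmannP (prim_quot IP) ca.
move: (dauns_hofmann _ _) => l [p Pp]; rewrite -qproj1 -qprojZ -qprojB => /qprojP h.
rewrite /has_value -(subKr p (a - _)); apply: primD => //.
by apply: (@cidealN _ _ (prim_ideal P)); exact: IP.
Qed.

Theorem theorem4p7 (R : realType) (A : cstarAlgType R) (I : cideal A) (a : A)
    (Za : alg_center (quot I) (qproj I a)) :
  [set z + i | z in alg_center A & i in I] a <->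
  forall (P1 P2 : Prim A) (IP1 : I `<=` P1) (IP2 : I `<=` P2),
    P1 `&` alg_center A = P2 `&` alg_center A ->
    dauns_hofmann (qproj I a) (prim_quot IP1) =
    dauns_hofmann (qproj I a) (prim_quot IP2).
Proof.
split=> [[z cz [i Ii aE]] P1 P2 I1 I2 E|H].
  have h1 := dauns_hofmann_quot I1 Za; have h2 := dauns_hofmann_quot I2 Za.
  have zval (P : Prim A) l : I `<=` P -> has_value P a l -> has_value P z l.
    move=> IP al; rewrite -[z](addrK i) aE -[l]subr0.
    by apply: has_valueB => //; apply/has_value_mem; exact: IP.
  have /(zval _ _ I1) z1 := h1; have /(zval _ _ I2) z2 := h2.
  set l1 := dauns_hofmann _ (prim_quot I1) in z1 *.
  (* Modulo [P1] and [P2] the elements [a] and [z] have the same values. Since [z - l1] is central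
     and lies in [P1], it lies in [P2], which makes [l1] the value of [z] there too. *)
  have : (P1 `&` alg_center A) (z - l1 *: (1 : A)).
    by split=> // b; rewrite mulrBl mulrBr scalerMl scalerMr mul1r mulr1 cz.
  by rewrite E => -[z1' _]; exact: has_value_uniq z1' z2.
have [|z cz Iaz] := center_lift Za; last first.
  by exists z => //; exists (a - z) => //; rewrite addrC subrK.
move=> P1 P2 l1 l2 I1 I2 E h1 h2.
rewrite (has_value_uniq h1 (dauns_hofmann_quot I1 Za)).
rewrite (has_value_uniq h2 (dauns_hofmann_quot I2 Za)).
exact: H.
Qed.
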